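(* Let $G$ be a discrete group possessing the approximation property (AP) and let $u:G\to\mathbb{C}$ be a Herz-Schur multiplier of $A(G)$. The following are equivalent: (i) the map $S_u:C_r^*(G)\to C_r^*(G)$ is completely compact; (ii) there exists a net $(u_i)_{i\in\mathbb{I}}$ of finitely supported elements of $A(G)$ such that $\|S_u-S_{u_i}\|_{\rm cb}\to_{i\in\mathbb{I}}0$; (iii) there exists a net $(\varphi_i)_{i\in\mathbb{I}}$ of band finite Schur multipliers such that $\|S_{N(u)}-S_{\varphi_i}\|\to_{i\in\mathbb{I}}0$; (iv) $u\in A_{\rm cb}(G)$.
   Context: $G$ is a discrete group, $\lambda^0$ its left regular representation on $\ell^2(G)$, $C_r^*(G)$ its reduced C*-algebra, $\mathrm{VN}(G)$ its von Neumann algebra. $A(G)$ is the Fourier algebra of $G$ (functions $s\mapsto(\lambda^0_s\xi,\eta)$, $\xi,\eta\in\ell^2(G)$), with the operator space structure of the predual of $\mathrm{VN}(G)$. A multiplier of $A(G)$ is a function $u:G\to\mathbb{C}$ with $uA(G)\subseteq A(G)$; it is a Herz-Schur multiplier if $v\mapsto uv$ is completely bounded on $A(G)$. The algebra of Herz-Schur multipliers is denoted $M^{\rm cb}A(G)$. Equivalently, $u\in M^{\rm cb}A(G)$ iff the map $S_u:\lambda^0(f)\mapsto\lambda^0(uf)$, $f\in\ell^1(G)$, extends to a completely bounded map on $C_r^*(G)$; $\|u\|_{\rm m}=\|S_u\|_{\rm cb}$. $A_{\rm cb}(G)$ is the closure of $A(G)$ in $M^{\rm cb}A(G)$ with respect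 to $\|\cdot\|_{\rm m}$. The space $M^{\rm cb}A(G)$ is a dual Banach space (its canonical predual being the completion of $\ell^1(G)$ in the norm $\|f\|=\sup\{|\sum_s f(s)v(s)|:v\in M^{\rm cb}A(G),\|v\|_{\rm m}\le1\}$); $G$ has the (AP) if there is a net of finitely supported Herz-Schur multipliers converging to the constant function $1$ in the weak* topology of $M^{\rm cb}A(G)$. A function $\varphi:G\times G\to\mathbb{C}$ is a Schur multiplier if $S_\varphi:(x_{p,q})_{p,q}\mapsto(\varphi(q,p)x_{p,q})_{p,q}$ is a completely bounded map on $\mathcal{B}(\ell^2(G))$, operators being identified with their $G\times G$ matrices. $\varphi$ is band finite if there is a finite set $E\subseteq G$ with $\varphi(s,t)=0$ whenever $ts^{-1}\notin E$. $N(u)(s,t)=u(ts^{-1})$. A completely bounded map $\Psi:\mathcal{X}\to\mathcal{Z}$ between operator spaces is completely compact if for every $\epsilon>0$ there is a finite dimensional subspace $\mathcal{Y}\subseteq\mathcal{Z}$ such that $\mathrm{dist}(\Psi^{(m)}(x),M_m(\mathcal{Y}))<\epsilon$ for all $m\in\mathbb{N}$ and all $x\in M_m(\mathcal{X})$ with $\|x\|\le1$. *)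

(* Defs.v *)
From HB Require Import structures.
From mathcomp Require Import all_boot all_order all_algebra.
From mathcomp Require Import all_classical all_reals all_analysis.
From mathcomp Require Import complex ring.

Set Implicit Arguments.
Unset Strict Implicit.
Unset Printing Implicit Defensive.

Import Order.TTheory GRing.Theory Num.Theory.
Import numFieldNormedType.Exports Normc.

Local Open Scope classical_set_scope.
Local Open Scope ring_scope.
Local Open Scope complex_scope.

(** * Unordered sums *)

Definition rsum (R : realType) (I : choiceType) (f : I -> R) : R :=
  fine (\esum_(i in [set: I]) (f^\+ i)%:E)%E -
  fine (\esum_(i in [set: I]) (f^\- i)%:E)%E.

Definition csum (R : realType) (I : choiceType) (f : I -> R[i]) : R[i] :=
  rsum (fun i => complex.Re (f i)) +i* rsum (fun i => complex.Im (f i)).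

(** f is in l^1(I). *)
Definition abs_summable (R : realType) (I : choiceType) (f : I -> R[i]) : Prop :=
  (\esum_(i in [set: I]) (normc (f i))%:E < +oo)%E.

(** * The Hilbert space l^2(I) *)

Section l2_closed.
Context (R : realType) (I : choiceType).
Implicit Types f g : I -> R[i].

Definition sq_summable f : Prop :=
  (\esum_(i in [set: I]) (normc (f i) ^+ 2)%:E < +oo)%E.

Definition l2_pred : {pred I -> R[i]} := fun f => `[< sq_summable f >].

Lemma normc_sqrE (z : R[i]) :
  normc z ^+ 2 = complex.Re z ^+ 2 + complex.Im z ^+ 2.
Proof. by case: z => a b /=; rewrite sqr_sqrtr ?addr_ge0 ?sqr_ge0. Qed.

Lemma normc_sqr_le (a x y : R[i]) :
  normc (a * x + y) ^+ 2 <= 2 * normc a ^+ 2 * normc x ^+ 2 + 2 * normc y ^+ 2.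
Proof.
rewrite -[2 * _ * _]mulrA -exprMn -normcM; move: (a * x) => z.
rewrite !normc_sqrE; case: z y => [z1 z2] [y1 y2] /=.
rewrite -subr_ge0.
have -> : 2 * (z1 ^+ 2 + z2 ^+ 2) + 2 * (y1 ^+ 2 + y2 ^+ 2) -
  ((z1 + y1) ^+ 2 + (z2 + y2) ^+ 2) = (z1 - y1) ^+ 2 + (z2 - y2) ^+ 2.
  by rewrite !sqrrD !sqrrN !mulrN !mulNrn; ring.
by rewrite addr_ge0 ?sqr_ge0.
Qed.

Lemma esumZ_le (k : R) (f : I -> \bar R) : 0 <= k -> (forall i, 0 <= f i)%E ->
  (\esum_(i in [set: I]) (k%:E * f i) <= k%:E * \esum_(i in [set: I]) f i)%E.
Proof.
move=> k0 f0; apply: ge_ereal_sup => _ [A [finA _] <-].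
rewrite -ge0_mule_fsumr//; apply: lee_wpmul2l; first by rewrite lee_fin.
by apply: ereal_sup_ubound; exists A.
Qed.

Lemma l2_submod_closed : submod_closed l2_pred.
Proof.
split.
  apply/asboolP; rewrite /sq_summable esum1 ?ltry// => i _.
  by rewrite [normc _]normc0 expr0n.
move=> a f g /asboolP f2 /asboolP g2; apply/asboolP; rewrite /sq_summable.
have nn (h : I -> R[i]) i : (0 <= (normc (h i) ^+ 2)%:E :> \bar R)%E.
  by rewrite lee_fin sqr_ge0.
have k0 : 0 <= 2 * normc a ^+ 2 by rewrite mulr_ge0// sqr_ge0.
apply: (@le_lt_trans _ _ (\esum_(i in [set: I])
    ((2 * normc a ^+ 2)%:E * (normc (f i) ^+ 2)%:E +
     2%:E * (normc (g i) ^+ 2)%:E))%E).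
  apply: le_esum => i _; rewrite -!EFinM -EFinD lee_fin.
  exact: normc_sqr_le.
rewrite esumD; last 2 first.
- by move=> i _; rewrite mule_ge0// lee_fin.
- by move=> i _; rewrite mule_ge0// lee_fin.
apply: lte_add_pinfty.
  have /le_lt_trans := esumZ_le k0 (nn f); apply.
  by rewrite lte_mul_pinfty.
have /le_lt_trans := esumZ_le (ler0n R 2) (nn g); apply.
by rewrite lte_mul_pinfty.
Qed.

HB.instance Definition _ :=
  GRing.isSubmodClosed.Build _ _ l2_pred l2_submod_closed.

End l2_closed.

Record l2 (R : realType) (I : choiceType) : Type :=
  L2 { l2val :> I -> R[i] ; _ : l2val \in @l2_pred R I }.

Section l2_theory.
Context (R : realType) (I : choiceType).

HB.instance Definition _ := [isSub for @l2val R I].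
HB.instance Definition _ := [Choice of l2 R I by <:].
HB.instance Definition _ := [SubChoice_isSubLmodule of l2 R I by <:].

(** The element of l^2(I) with coordinates f, and 0 if f is not square
    summable. *)
Definition tol2 (f : I -> R[i]) : l2 R I := insubd (0 : l2 R I) f.

Definition dot (x y : l2 R I) : R[i] := csum (fun i => x i * (y i)^*).

Definition sqnorm (x : l2 R I) : R := rsum (fun i => normc (x i) ^+ 2).

Definition basis (q : I) : l2 R I := tol2 (fun p => (p == q)%:R).

End l2_theory.

(** * Matricially normed spaces *)

(** The carrier is a linear subspace [mn_dom] of an ambient space. Only concrete
    operator spaces, preduals and matrix algebras are built below, so Ruan's
    axioms are theorems about the instances rather than fields. *)
Record mnspace (R : realType) := MNSpace {
  mn_sort :> lmodType R[i] ;
  mn_dom : set mn_sort ;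
  mn_norm : forall n, 'M[mn_sort]_n -> \bar R }.

Section mnspace_maps.
Context (R : realType).
Implicit Types X Z : mnspace R.

Definition mx_dom X (D : set X) n : set 'M[X]_n :=
  [set x | forall i j, D (x i j)].

Definition elt_norm X (x : X) : \bar R := mn_norm (const_mx x : 'M[X]_1).

Definition op_norm X Z (Psi : X -> Z) : \bar R :=
  ereal_sup [set elt_norm (Psi x) | x in
    [set x : X | mn_dom x /\ (elt_norm x <= 1)%E]].

Definition cb_norm X Z (Psi : X -> Z) : \bar R :=
  ereal_sup [set r | exists n (x : 'M[X]_n),
    [/\ mx_dom (@mn_dom R X) x, (mn_norm x <= 1)%E & r = mn_norm (map_mx Psi x)]].

Definition linear_on (V W : lmodType R[i]) (D : set V) (Psi : V -> W) : Prop :=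
  forall (a : R[i]) x y, D x -> D y -> Psi (a *: x + y) = a *: Psi x + Psi y.

Definition completely_bounded X Z (Psi : X -> Z) : Prop :=
  [/\ linear_on (@mn_dom R X) Psi,
      (forall x, mn_dom x -> mn_dom (Psi x)) &
      (cb_norm Psi < +oo)%E].

Definition lin_span (V : lmodType R[i]) k (b : 'I_k -> V) : set V :=
  [set \sum_j c j *: b j | c in [set: 'I_k -> R[i]]].

Definition mx_dist X (Y : set X) n (w : 'M[X]_n) : \bar R :=
  ereal_inf [set mn_norm (w - y)%R | y in @mx_dom X Y n].

Definition completely_compact X Z (Psi : X -> Z) : Prop :=
  completely_bounded Psi /\
  forall e : R, 0 < e -> exists k (b : 'I_k -> Z),
    (forall j, mn_dom (b j)) /\
    forall m (x : 'M[X]_m), mx_dom (@mn_dom R X) x -> (mn_norm x <= 1)%E ->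
      (mx_dist (lin_span b) (map_mx Psi x) < e%:E)%E.

(** The norm of a matrix of operators on a Hilbert space E with squared norm sq,
    acting on the Hilbert space sum of n copies of E. *)
Definition mxop_norm (E : lmodType R[i]) (sq : E -> R) n (T : 'M[E -> E]_n) :
    \bar R :=
  ereal_sup [set (Num.sqrt (\sum_i sq (\sum_j T i j (x j))))%:E | x in
    [set x : 'I_n -> E | \sum_j sq (x j) <= 1]].

(** The k x k complex matrices, acting on column vectors. *)
Definition matspace k : mnspace R :=
  @MNSpace R 'M[R[i]]_k [set: 'M[R[i]]_k] (fun n (A : 'M['M[R[i]]_k]_n) =>
    mxop_norm (fun x : 'cV[R[i]]_k => \sum_p normc (x p ord0) ^+ 2)
      (map_mx (fun a x => a *m x) A)).

End mnspace_maps.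

(** * Operators on l^2(I) *)

Section operators.
Context (R : realType) (I : choiceType).

Definition op : lmodType R[i] := l2 R I -> l2 R I.

Definition opmx_norm n (T : 'M[op]_n) : \bar R := mxop_norm (@sqnorm R I) T.

Definition opnorm (T : op) : \bar R := opmx_norm (const_mx T : 'M[op]_1).

Definition bounded_op : set op :=
  [set T | linear_on [set: l2 R I] T /\ (opnorm T < +oo)%E].

(** A set of bounded operators with the matrix norms inherited from B(l^2(I)). *)
Definition opspace (D : set op) : mnspace R := MNSpace D opmx_norm.

Definition Bl2 : mnspace R := opspace bounded_op.

Definition commutant (D : set op) : set op :=
  [set T | bounded_op T /\ forall S, D S -> T \o S = S \o T].

Definition entry (T : op) (p q : I) : R[i] := dot (T (basis R q)) (basis R p).

(** The bounded operator with matrix (phi(q,p) T_{p,q}), and 0 if there is none. *)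
Definition schur_map (phi : I -> I -> R[i]) (T : op) : op :=
  xget 0 [set T' | bounded_op T' /\
                   forall p q, entry T' p q = phi q p * entry T p q].

Definition schur_multiplier (phi : I -> I -> R[i]) : Prop :=
  (forall T, bounded_op T -> exists2 T', bounded_op T' &
     forall p q, entry T' p q = phi q p * entry T p q) /\
  @completely_bounded R Bl2 Bl2 (schur_map phi).

End operators.

(** * Multipliers of a discrete group *)

Section group.
Context (R : realType) (G : groupType).
Implicit Types u v f : G -> R[i].

Definition lreg (s : G) : op R G :=
  fun x => tol2 (fun t => x (s^-1 * t)%g).

(** Sum of f(s) lambda_s, i.e. convolution by f; for f in l^1(G) it preserves
    l^2(G), so the default of [tol2] is not reached. *)
Definition lreg_l1 f : op R G :=
  fun x => tol2 (fun t => csum (fun s => f s * x (s^-1 * t)%g)).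

Definition Cr : mnspace R :=
  opspace [set T : op R G | bounded_op T /\ forall e : R, 0 < e ->
    exists2 f, abs_summable f &
      (opnorm (T - lreg_l1 f)%R < e%:E)%E].

Definition VN : mnspace R := opspace (commutant (commutant (range lreg))).

Definition coeff (x y : l2 R G) : G -> R[i] := fun s => dot (lreg s x) y.

Definition in_fourier v : Prop := exists x y, v = coeff x y.

(** The value at T in VN(G) of the normal functional given by v in A(G); it does
    not depend on the choice of the vectors representing v. *)
Definition vn_pairing v (T : op R G) : R[i] :=
  let xy := xget (0, 0) [set xy | v = coeff xy.1 xy.2] in dot (T xy.1) xy.2.

(** A(G) as the predual of VN(G): M_n(A(G)) is normed inside CB(VN(G), M_n). *)
Definition fourier : mnspace R :=
  @MNSpace R (G -> R[i] : lmodType R[i]) in_fourier (fun n w =>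
    @cb_norm R VN (matspace R n)
      (fun T => \matrix_(i, j) vn_pairing (w i j) T)).

Definition multiplier u : Prop :=
  forall v, in_fourier v -> in_fourier (u \* v).

Definition herz_schur u : Prop :=
  multiplier u /\ @completely_bounded R fourier fourier (fun v => u \* v).

(** The unique completely bounded map on the reduced C*-algebra extending
    lambda(f) |-> lambda(uf), for u Herz-Schur; all notions used for it only
    involve its values on the algebra. *)
Definition Smap u : Cr -> Cr :=
  xget (fun=> 0) [set Psi : Cr -> Cr | completely_bounded Psi /\
    forall f, abs_summable f -> Psi (lreg_l1 f) = lreg_l1 (u \* f)].

Definition m_norm u : \bar R := cb_norm (Smap u).

Definition in_Acb u : Prop :=
  herz_schur u /\
  forall e : R, 0 < e -> exists2 v, in_fourier v & (m_norm (u - v)%R < e%:E)%E.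

Definition finitely_supported u : Prop := finite_set [set s | u s != 0].

(** The canonical predual of the Herz-Schur multipliers, realised as the closure
    of l^1(G) in the Banach dual of the space of Herz-Schur multipliers; only the
    values on Herz-Schur multipliers matter. *)
Definition predual (w : (G -> R[i]) -> R[i]) : Prop :=
  @linear_on R (G -> R[i] : lmodType R[i]) R[i] herz_schur w /\
  forall e : R, 0 < e -> exists2 f, abs_summable f &
    forall v, herz_schur v -> (m_norm v <= 1)%E ->
      normc (w v - csum (fun s => f s * v s)) <= e.

End group.

(** * Nets *)

Definition directed (J : Type) (le : J -> J -> Prop) : Prop :=
  [/\ inhabited J, (forall i, le i i),
      (forall i j k, le i j -> le j k -> le i k) &
      (forall i j, exists2 k, le i k & le j k)].

Definition tails (J : Type) (le : J -> J -> Prop) : set_system J :=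
  [set A | exists i0, forall i, le i0 i -> A i].

Definition approximation_property (R : realType) (G : groupType) : Prop :=
  exists (J : Type) (le : J -> J -> Prop) (v : J -> G -> R[i]),
    [/\ directed le,
        (forall i, herz_schur (v i) /\ finitely_supported (v i)) &
        forall w, @predual R G w ->
          normc (w (v i) - w (fun=> 1)) @[i --> tails le] --> (0 : R)].

Section multiplier_conditions.
Context (R : realType) (G : groupType).

Definition band_finite (phi : G -> G -> R[i]) : Prop :=
  exists2 E : set G, finite_set E &
    forall s t, ~ E (t * s^-1)%g -> phi s t = 0.

Definition Nmap (u : G -> R[i]) : G -> G -> R[i] := fun s t => u (t * s^-1)%g.

End multiplier_conditions.

(* Main.v *)
Require Import Defs.
From mathcomp Require Import all_boot all_order all_algebra.
From mathcomp Require Import all_classical all_reals all_analysis.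
From mathcomp Require Import complex ring lra.

Set Implicit Arguments.
Unset Strict Implicit.
Unset Printing Implicit Defensive.

Import Order.TTheory GRing.Theory Num.Theory.
Import numFieldNormedType.Exports Normc.

Local Open Scope classical_set_scope.
Local Open Scope ring_scope.
Local Open Scope complex_scope.

(** The norms involved are norms of finite matrices: by Smith's trick, conjugation
    by diagonal matrices of translations and the predual of VN(G), each of the
    norms of [u], as a Herz-Schur multiplier, a map of the reduced algebra or a
    Schur multiplier, is controlled by [schur_le] for the Toeplitz kernel
    u(p q^-1), i.e. by the norms of the matrices (u(p q^-1) k(p, q)) over finite
    sets for contractive matrices k. The pivot of the equivalence is
    [band_approx]: these products are within e, uniformly in k, of matrices
    supported in a band p q^-1 in E with E finite and depending only on e. A
    complete compactness estimate, applied to the matrix of the operators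
    k(p, q) lambda(p q^-1), gives it because the finite dimensional range can be
    replaced by the span of finitely many translations, and so does a norm limit
    of band finite Schur multipliers. Conversely, by [band_approx] any bounded
    functional composed with v |-> (v(p q^-1) u(p q^-1) k(p, q)) lies in the
    predual of the Herz-Schur multipliers, so that (AP) and Hahn-Banach make [u]
    a norm limit of finitely supported functions. *)

(** (AP) gives weak* convergence only; norm approximation comes from convexity. The products of [u]
    with finitely supported functions form a linear space, so if it stayed at distance e from [u],
    some bounded functional would vanish on it and not at [u], and (AP) has to rule out just this
    functional. For that the norm is written as a sup norm over the set [test] of contractive finite
    matrices with pairs of vectors of norm at most 1, and Hahn-Banach is applied in the bounded
    functions on [test]. The band brings such an abstract functional into the predual: if B vanishes
    unless p q^-1 is in E, the matrix v(p q^-1) B(p, q) is the sum over r in E of v(r) times a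
    matrix independent of v, and any functional of it is a finite combination of the values v(r).
    Hence [B] may depend on [k] in an arbitrary way and only the uniformity of [E] matters. That
    uniformity is where complete compactness enters: the matrix fed to the map has the size of F, so
    one finite dimensional range must serve all matrix levels. *)

Section normc_theory.
Context (R : realType).
Implicit Types x y z : R[i].

Lemma normc_normr z : (normc z)%:C = `|z|.
Proof. by case: z. Qed.

Lemma normc_ge0 z : 0 <= normc z.
Proof. by case: z => a b; apply: sqrtr_ge0. Qed.

Lemma ler_normcD x y : normc (x + y) <= normc x + normc y.
Proof. by rewrite -lecR rmorphD /= !normc_normr ler_normD. Qed.

Lemma normc0E : normc (0 : R[i]) = 0.
Proof. exact: normc0. Qed.

Lemma normc1E : normc (1 : R[i]) = 1.
Proof. exact: normc1. Qed.

Lemma normcNE z : normc (- z) = normc z.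
Proof. by case: z => a b /=; rewrite !sqrrN. Qed.

Lemma normc_conj z : normc z^* = normc z.
Proof. by case: z => a b /=; rewrite sqrrN. Qed.

Lemma ler_normcB x y : normc (x - y) <= normc x + normc y.
Proof. by rewrite -(normcNE y) ler_normcD. Qed.

Lemma normc_eq0 z : (normc z == 0) = (z == 0).
Proof. by apply/eqP/eqP => [/eq0_normc//|->]; exact: normc0. Qed.

Lemma normc_real (r : R) : normc r%:C = `|r|.
Proof. by rewrite /= expr0n addr0 sqrtr_sqr. Qed.

Lemma mulc_conj z : z * z^* = (normc z ^+ 2)%:C.
Proof.
by rewrite normc_sqrE; case: z => a b /=; simpc; congr (_ +i* _); ring.
Qed.

Lemma normc_sum (A : Type) (F : seq A) (f : A -> R[i]) :
  normc (\sum_(x <- F) f x) <= \sum_(x <- F) normc (f x).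
Proof.
elim/big_ind2 : _ => [|x r y s xr ys|//]; first by rewrite normc0E.
by apply: le_trans (ler_normcD _ _) _; rewrite lerD.
Qed.

Lemma normc_Re z : `|complex.Re z| <= normc z.
Proof.
case: z => a b /=; rewrite -sqrtr_sqr ler_wsqrtr// lerDl; exact: sqr_ge0.
Qed.

Lemma normc_Im z : `|complex.Im z| <= normc z.
Proof.
case: z => a b /=; rewrite -sqrtr_sqr ler_wsqrtr// lerDr; exact: sqr_ge0.
Qed.

Lemma normc_le_ReIm z : normc z <= `|complex.Re z| + `|complex.Im z|.
Proof.
case: z => a b /=; rewrite -(@ler_pXn2r _ 2)// ?nnegrE ?addr_ge0 ?sqrtr_ge0//.
rewrite sqr_sqrtr ?addr_ge0 ?sqr_ge0// sqrrD !real_normK ?num_real//.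
by rewrite -addrA [_ *+ 2 + _]addrC addrA lerDl mulrn_wge0// mulr_ge0.
Qed.

Lemma unimodular z : exists2 c : R[i], normc c = 1 & c * z = (normc z)%:C.
Proof.
have [->|z0] := eqVneq z 0; first by exists 1; rewrite ?mulr0 ?normc0E ?normc1E.
have nz0 : normc z != 0 by rewrite normc_eq0.
exists (z^* / (normc z)%:C).
  rewrite normcM normc_conj normcV normc_real ger0_norm ?normc_ge0//.
  by rewrite divff.
rewrite mulrAC [z^* * z]mulrC mulc_conj -fmorphV -rmorphM /=.
by rewrite expr2 mulfK.
Qed.

End normc_theory.

(** * Finite matrices *)

Section kernels.
Context (R : realType).
Local Notation C := R[i].

Definition vnorm (A : Type) (F : seq A) (a : A -> C) : R :=
  Num.sqrt (\sum_(x <- F) normc (a x) ^+ 2).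

(** The matrix of [k] over [F], counted with multiplicity, has operator norm at
    most [M]. *)
Definition kernel_le (A : Type) (F : seq A) (k : A -> A -> C) (M : R) : Prop :=
  forall a b : A -> C,
    normc (\sum_(x <- F) \sum_(y <- F) k x y * a y * b x) <=
    M * vnorm F a * vnorm F b.

Section theory.
Variable A : Type.
Implicit Types (F : seq A) (k : A -> A -> C) (a b : A -> C).

Lemma sumsq_ge0 F a : 0 <= \sum_(x <- F) normc (a x) ^+ 2.
Proof. by apply: sumr_ge0 => x _; apply: sqr_ge0. Qed.

Lemma vnorm_ge0 F a : 0 <= vnorm F a.
Proof. exact: sqrtr_ge0. Qed.

Lemma vnorm_sqr F a : vnorm F a ^+ 2 = \sum_(x <- F) normc (a x) ^+ 2.
Proof. by rewrite sqr_sqrtr// sumsq_ge0. Qed.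

Lemma vnormZ F (c : C) a : vnorm F (fun x => c * a x) = normc c * vnorm F a.
Proof.
rewrite /vnorm; under eq_bigr do rewrite normcM exprMn.
by rewrite -mulr_sumr sqrtrM ?sqr_ge0// sqrtr_sqr ger0_norm ?normc_ge0.
Qed.

Lemma vnorm_conj F a : vnorm F (fun x => (a x)^*) = vnorm F a.
Proof. by rewrite /vnorm; under eq_bigr do rewrite normc_conj. Qed.

Lemma cauchy_schwarz F a b :
  \sum_(x <- F) normc (a x) * normc (b x) <= vnorm F a * vnorm F b.
Proof.
elim: F => [|x F IH]; first by rewrite big_nil mulr_ge0 ?vnorm_ge0.
rewrite big_cons addrC; apply: le_trans (lerD IH (lexx _)) _.
set s := vnorm F a; set t := vnorm F b.
have s0 : 0 <= s by apply: vnorm_ge0.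
have t0 : 0 <= t by apply: vnorm_ge0.
have -> : vnorm (x :: F) a = Num.sqrt (normc (a x) ^+ 2 + s ^+ 2).
  by rewrite vnorm_sqr /vnorm big_cons.
have -> : vnorm (x :: F) b = Num.sqrt (normc (b x) ^+ 2 + t ^+ 2).
  by rewrite vnorm_sqr /vnorm big_cons.
move: (normc_ge0 (a x)) (normc_ge0 (b x)); set p := normc _; set q := normc _.
clearbody s t; move=> p0 q0; rewrite -sqrtrM ?addr_ge0 ?sqr_ge0//.
rewrite -(@ger0_norm _ (s * t + p * q)) ?addr_ge0 ?mulr_ge0//.
rewrite -sqrtr_sqr; apply: ler_wsqrtr.
rewrite -subr_ge0.
suff -> : (p ^+ 2 + s ^+ 2) * (q ^+ 2 + t ^+ 2) - (s * t + p * q) ^+ 2 =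
  (p * t - s * q) ^+ 2 by apply: sqr_ge0.
by ring.
Qed.

Lemma normc_sum_mul F a b :
  normc (\sum_(x <- F) a x * b x) <= vnorm F a * vnorm F b.
Proof.
apply: le_trans (normc_sum _ _) _; under eq_bigr do rewrite normcM.
exact: cauchy_schwarz.
Qed.

Lemma kernel_le_trans F k M M' : M <= M' -> kernel_le F k M -> kernel_le F k M'.
Proof.
move=> MM' kM a b; apply: le_trans (kM a b) _.
by rewrite !ler_wpM2r// vnorm_ge0.
Qed.

Lemma eq_kernel_le F k k' M : (forall x y, k x y = k' x y) ->
  kernel_le F k M -> kernel_le F k' M.
Proof.
move=> kk' kM a b; apply: le_trans (kM a b).
by under eq_bigr do under eq_bigr do rewrite -kk'.
Qed.

Lemma kernel_leZ F k (c : C) M : kernel_le F k M ->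
  kernel_le F (fun x y => c * k x y) (normc c * M).
Proof.
move=> kM a b.
have -> : \sum_(x <- F) \sum_(y <- F) c * k x y * a y * b x =
          c * \sum_(x <- F) \sum_(y <- F) k x y * a y * b x.
  rewrite mulr_sumr; apply: eq_bigr => x _.
  by rewrite mulr_sumr; apply: eq_bigr => y _; rewrite !mulrA.
by rewrite normcM -!mulrA ler_wpM2l ?normc_ge0// mulrA.
Qed.

Lemma kernel_leD F k k' M M' : kernel_le F k M -> kernel_le F k' M' ->
  kernel_le F (fun x y => k x y + k' x y) (M + M').
Proof.
move=> kM kM' a b.
have -> : \sum_(x <- F) \sum_(y <- F) (k x y + k' x y) * a y * b x =
  \sum_(x <- F) \sum_(y <- F) k x y * a y * b x +
  \sum_(x <- F) \sum_(y <- F) k' x y * a y * b x.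
  rewrite -big_split; apply: eq_bigr => x _ /=.
  by rewrite -big_split; apply: eq_bigr => y _ /=; rewrite !mulrDl.
rewrite !mulrDl; apply: le_trans (ler_normcD _ _) _; exact: lerD.
Qed.

Lemma kernel_leN F k M : kernel_le F k M -> kernel_le F (fun x y => - k x y) M.
Proof.
move=> /(kernel_leZ (-1)); rewrite normcNE normc1E mul1r.
by apply: eq_kernel_le => x y; rewrite mulN1r.
Qed.

Lemma kernel_leB F k k' M M' : kernel_le F k M -> kernel_le F k' M' ->
  kernel_le F (fun x y => k x y - k' x y) (M + M').
Proof. by move=> kM /kernel_leN; exact: kernel_leD. Qed.

Lemma kernel_le0 F : kernel_le F (fun _ _ => 0) 0.
Proof.
by move=> a b; rewrite big1 ?normc0E ?mul0r// => x _; rewrite big1// => y _;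
  rewrite !mul0r.
Qed.

Lemma kernel_le_sum (I : Type) (r : seq I) F (k : I -> A -> A -> C)
    (M : I -> R) : (forall i, kernel_le F (k i) (M i)) ->
  kernel_le F (fun x y => \sum_(i <- r) k i x y) (\sum_(i <- r) M i).
Proof.
move=> kM; elim: r => [|i r IH].
  rewrite big_nil; apply: eq_kernel_le (kernel_le0 F) => x y.
  by rewrite big_nil.
rewrite big_cons; apply: eq_kernel_le (kernel_leD (kM i) IH) => x y.
by rewrite big_cons.
Qed.

(** Testing the form against the conjugate of the image vector returns the squared norm of that
    vector. *)
Lemma kernel_le_vnorm F k M a : 0 <= M -> kernel_le F k M ->
  vnorm F (fun x => \sum_(y <- F) k x y * a y) <= M * vnorm F a.
Proof.
move=> M0 kM; set c := fun x => _.
have := kM a (fun x => (c x)^*).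
rewrite (_ : \sum_(x <- F) _ = (vnorm F c ^+ 2)%:C); last first.
  rewrite vnorm_sqr raddf_sum; apply: eq_bigr => x _ /=.
  by rewrite -mulc_conj mulr_suml.
rewrite vnorm_conj normc_real ger0_norm ?sqr_ge0// expr2.
have [c0 _|c0] := leP (vnorm F c) 0; last by rewrite ler_pM2r.
by apply: le_trans c0 _; rewrite mulr_ge0 ?vnorm_ge0.
Qed.

End theory.

Lemma vnorm_map (A B : Type) (h : A -> B) (F : seq A) (a : B -> C) :
  vnorm (map h F) a = vnorm F (a \o h).
Proof. by rewrite /vnorm big_map. Qed.

Section subset.
Variable A : eqType.
Implicit Types (F : seq A) (k : A -> A -> C) (a b : A -> C).

Lemma eq_vnorm F a b : {in F, a =1 b} -> vnorm F a = vnorm F b.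
Proof. by move=> ab; congr Num.sqrt; apply: eq_big_seq => x /ab ->. Qed.

Lemma eq_in_kernel_le F k k' M :
  (forall x y, x \in F -> y \in F -> k x y = k' x y) ->
  kernel_le F k M -> kernel_le F k' M.
Proof.
move=> kk' kM a b; apply: le_trans (kM a b).
rewrite le_eqVlt; apply/orP; left; apply/eqP; congr normc.
by apply: eq_big_seq => x xF; apply: eq_big_seq => y yF; rewrite kk'.
Qed.

Lemma vnorm_pred0 F a x : vnorm F a = 0 -> x \in F -> a x = 0.
Proof.
move=> /eqP; rewrite sqrtr_eq0 => F0 xF.
have : \sum_(x <- F) normc (a x) ^+ 2 = 0.
  by apply/eqP; rewrite eq_le F0 sumsq_ge0.
move=> /eqP; rewrite psumr_eq0; last by move=> *; apply: sqr_ge0.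
by move=> /allP/(_ x xF); rewrite expf_eq0/= normc_eq0 => /eqP.
Qed.

Lemma big_uniq_sub (V : nmodType) F F' (f : A -> V) : uniq F -> uniq F' ->
  {subset F <= F'} -> (forall x, x \notin F -> f x = 0) ->
  \sum_(x <- F') f x = \sum_(x <- F) f x.
Proof.
move=> uF uF' sF f0; rewrite (bigID (mem F))/= [X in _ + X]big1 ?addr0; last first.
  by move=> x; exact: f0.
rewrite -big_filter; apply: perm_big; apply: uniq_perm => //.
  exact: filter_uniq.
move=> x; rewrite mem_filter /=; case: (boolP (x \in F)) => //= xF.
exact: sF.
Qed.

Lemma big_uniq_mem (V : nmodType) F F' (f : A -> V) : uniq F -> uniq F' ->
  {subset F <= F'} ->
  \sum_(x <- F') (if x \in F then f x else 0) = \sum_(x <- F) f x.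
Proof.
move=> uF uF' sF.
rewrite (@big_uniq_sub _ F)//; last by move=> x /negPf ->.
by apply: eq_big_seq => x ->.
Qed.

Lemma kernel_le_sub F F' k M : uniq F -> uniq F' -> {subset F <= F'} ->
  kernel_le F' k M -> kernel_le F k M.
Proof.
move=> uF uF' sF kM a b.
pose e (c : A -> C) x := if x \in F then c x else 0.
have eN c : vnorm F' (e c) = vnorm F c.
  congr Num.sqrt; rewrite -(big_uniq_mem _ uF uF' sF); apply: eq_bigr => x _.
  by rewrite /e; case: ifP => // _; rewrite normc0E expr0n.
have := kM (e a) (e b); rewrite !eN.
suff -> : \sum_(x <- F') \sum_(y <- F') k x y * e a y * e b x =
  \sum_(x <- F) \sum_(y <- F) k x y * a y * b x by [].
rewrite -(big_uniq_mem _ uF uF' sF); apply: eq_bigr => x _.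
rewrite /e; case: ifP => xF; last by rewrite big1// => y _; rewrite mulr0.
rewrite -(big_uniq_mem _ uF uF' sF); apply: eq_bigr => y _.
by case: ifP => // _; rewrite mulr0 mul0r.
Qed.

Lemma kernel_le_entry F k M x y : uniq F -> x \in F -> y \in F ->
  kernel_le F k M -> normc (k x y) <= M.
Proof.
move=> uF xF yF /(_ (fun z => (z == y)%:R) (fun z => (z == x)%:R)).
have S z (f : A -> C) : z \in F -> \sum_(w <- F) f w * (w == z)%:R = f z.
  move=> zF; rewrite (bigD1_seq z)//= eqxx mulr1 big1 ?addr0//.
  by move=> w /negPf ->; rewrite mulr0.
have N z : z \in F -> vnorm F (fun w => (w == z)%:R) = 1.
  move=> zF; rewrite /vnorm (bigD1_seq z)//= eqxx normc1E expr1n big1 ?addr0 ?sqrtr1//.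
  by move=> w /negPf ->; rewrite normc0E expr0n.
rewrite !N// !mulr1; under eq_bigr do rewrite -mulr_suml.
by rewrite S// S.
Qed.

Lemma sum_fibers (B : eqType) (V : nmodType) (pi : A -> B) F (f : A -> V) :
  \sum_(g <- undup (map pi F)) \sum_(x <- F | pi x == g) f x = \sum_(x <- F) f x.
Proof.
under eq_bigr do rewrite big_mkcond /=.
rewrite exchange_big; apply: eq_big_seq => x xF /=.
rewrite (bigD1_seq (pi x)) ?undup_uniq//=; last first.
  by rewrite mem_undup map_f.
by rewrite eqxx big1 ?addr0// => g /negPf; rewrite eq_sym => ->.
Qed.

End subset.

(** Injectivity is local to [F] because in [opmx_norm_twist] the map is injective on single fibres
    only. *)
Lemma kernel_le_map (A B : eqType) (h : A -> B) (F : seq A) (k : B -> B -> C) M :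
  uniq F -> {in F &, injective h} -> kernel_le (map h F) k M ->
  kernel_le F (fun x y => k (h x) (h y)) M.
Proof.
move=> uF hI kM a b.
pose push (c : A -> C) z := \sum_(x <- F | h x == z) c x.
have pushE c x : x \in F -> push c (h x) = c x.
  move=> xF; rewrite /push big_mkcond (bigD1_seq x)//= eqxx big1_seq ?addr0//.
  move=> y /andP[yx yF]; case: eqP => // /(hI _ _ yF xF) xy.
  by rewrite xy eqxx in yx.
have := kM (push a) (push b).
have vE c : vnorm (map h F) (push c) = vnorm F c.
  by rewrite /vnorm big_map; congr Num.sqrt; apply: eq_big_seq => x xF; rewrite pushE.
rewrite !vE big_map.
suff -> : \sum_(x <- F) \sum_(y <- map h F) k (h x) y * push a y * push b (h x) =
  \sum_(x <- F) \sum_(y <- F) k (h x) (h y) * a y * b x by [].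
apply: eq_big_seq => x xF; rewrite big_map; apply: eq_big_seq => y yF.
by rewrite !pushE.
Qed.

Section fibers.
Variables (A B : eqType) (pi : A -> B).
Implicit Types (F : seq A) (k : A -> A -> C) (a b : A -> C).

Lemma vnorm_fibers F a :
  \sum_(g <- undup (map pi F)) vnorm [seq x <- F | pi x == g] a ^+ 2 =
  vnorm F a ^+ 2.
Proof.
rewrite vnorm_sqr -(sum_fibers pi); apply: eq_bigr => g _.
by rewrite vnorm_sqr big_filter.
Qed.

(** The matrix is block diagonal along the fibres of [pi]; the bounds of the blocks are assembled by
    Cauchy-Schwarz for the norms of the restrictions. *)
Lemma kernel_le_fibers F k M : 0 <= M ->
  (forall g, kernel_le [seq x <- F | pi x == g] k M) ->
  kernel_le F (fun x y => if pi x == pi y then k x y else 0) M.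
Proof.
move=> M0 kM a b.
pose N c (g : B) : C := (vnorm [seq x <- F | pi x == g] c)%:C.
have NE c : vnorm (undup (map pi F)) (N c) = vnorm F c.
  rewrite -[RHS]ger0_norm ?vnorm_ge0// -sqrtr_sqr -vnorm_fibers; congr Num.sqrt.
  by apply: eq_bigr => g _; rewrite normc_real ger0_norm ?vnorm_ge0.
have -> : \sum_(x <- F) \sum_(y <- F) (if pi x == pi y then k x y else 0) * a y * b x =
  \sum_(g <- undup (map pi F)) \sum_(x <- [seq x <- F | pi x == g])
    \sum_(y <- [seq x <- F | pi x == g]) k x y * a y * b x.
  rewrite -(sum_fibers pi); apply: eq_bigr => g _; rewrite big_filter.
  apply: eq_bigr => x /eqP xg; rewrite big_filter [RHS]big_mkcond /=.
  by apply: eq_bigr => y _; rewrite xg eq_sym; case: ifP => // _; rewrite !mul0r.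
apply: le_trans (normc_sum _ _) _; rewrite -mulrA -(NE a) -(NE b).
apply: le_trans (ler_wpM2l M0 (cauchy_schwarz _ (N a) (N b))).
rewrite mulr_sumr; apply: ler_sum => g _; rewrite !normc_real !ger0_norm ?vnorm_ge0//.
by rewrite mulrA; exact: kM.
Qed.

End fibers.

(** Over a finite set entrywise convergence preserves the constant: the error of the form is at most
    the entrywise error times [S], which involves the test vectors and not the matrices. *)
Lemma kernel_le_lim (A : eqType) (F : seq A) (k : A -> A -> C) M :
  (forall e : R, 0 < e -> exists2 k', kernel_le F k' M &
     forall x y, x \in F -> y \in F -> normc (k x y - k' x y) <= e) ->
  kernel_le F k M.
Proof.
move=> H a b; apply/ler_addgt0Pr => e e0.
pose S := \sum_(x <- F) \sum_(y <- F) normc (a y) * normc (b x).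
have S0 : 0 <= S.
  by apply: sumr_ge0 => x _; apply: sumr_ge0 => y _; rewrite mulr_ge0 ?normc_ge0.
have d0 : 0 < e / (S + 1) by rewrite divr_gt0// ltr_wpDl.
have [k' k'M kk'] := H _ d0.
have -> : \sum_(x <- F) \sum_(y <- F) k x y * a y * b x =
  \sum_(x <- F) \sum_(y <- F) k' x y * a y * b x +
  \sum_(x <- F) \sum_(y <- F) (k x y - k' x y) * (a y * b x).
  rewrite -big_split; apply: eq_bigr => x _ /=.
  by rewrite -big_split; apply: eq_bigr => y _ /=; ring.
apply: le_trans (ler_normcD _ _) _; apply: lerD => //.
apply: le_trans (_ : e / (S + 1) * S <= _); last first.
  by rewrite mulrAC ler_pdivrMr ?ltr_wpDl// ler_pM2l// lerDl ler01.
apply: le_trans (normc_sum _ _) _; rewrite mulr_sumr big_seq [leRHS]big_seq.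
apply: ler_sum => x xF; apply: le_trans (normc_sum _ _) _.
rewrite mulr_sumr big_seq [leRHS]big_seq; apply: ler_sum => y yF.
by rewrite !normcM ler_wpM2r ?mulr_ge0 ?normc_ge0// kk'.
Qed.

End kernels.

(** * Unordered sums *)

Section sums.
Context (R : realType) (I : choiceType).
Local Notation C := R[i].

Lemma sum_le_esum (f : I -> R) (F : seq I) : (forall i, 0 <= f i) -> uniq F ->
  ((\sum_(i <- F) f i)%:E <= \esum_(i in [set: I]) (f i)%:E)%E.
Proof.
move=> f0 uF; apply: esum_ge; exists [set` F]; first by split => //; exact: finite_seq.
by rewrite -sumEFin fsbig_seq.
Qed.

Lemma esum_le_ub (f : I -> R) (M : R) :
  (forall F : seq I, uniq F -> \sum_(i <- F) f i <= M) ->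
  (\esum_(i in [set: I]) (f i)%:E <= M%:E)%E.
Proof.
move=> fM; apply: ge_ereal_sup => _ [A [finA _] <-].
by rewrite fsbig_finite//= sumEFin lee_fin fM// finmap.fset_uniq.
Qed.

Lemma esum_approx (f : I -> R) (M e : R) : (forall i, 0 <= f i) ->
  (forall F : seq I, uniq F -> \sum_(i <- F) f i <= M) -> 0 < e ->
  exists2 F0 : seq I, uniq F0 & forall F, uniq F -> {subset F0 <= F} ->
    `|fine (\esum_(i in [set: I]) (f i)%:E)%E - \sum_(i <- F) f i| <= e.
Proof.
move=> f0 fM e0; set S := (\esum_(i in _) _)%E.
have S0 : (0 <= S)%E by apply: esum_ge0 => i _; rewrite lee_fin.
have Sfin : S \is a fin_num.
  rewrite ge0_fin_numE//; apply: le_lt_trans (esum_le_ub fM) _; exact: ltry.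
have [_ [A [finA _] <-]] := ub_ereal_sup_adherent e0 Sfin.
rewrite fsbig_finite//= sumEFin => SA.
exists (finmap.enum_fset (fset_set A)); first exact: finmap.fset_uniq.
move=> F uF sF.
have FS := sum_le_esum f0 uF.
rewrite -/S -(fineK Sfin) lee_fin in FS.
rewrite -/(esum _ _) -/S -(fineK Sfin) -EFinD lte_fin in SA.
rewrite ger0_norm ?subr_ge0// lerBlDr.
suff : \sum_(i <- finmap.enum_fset (fset_set A)) f i <= \sum_(i <- F) f i.
  by move=> AF; rewrite -lerBlDl; apply: le_trans (ltW SA) _.
rewrite -(big_uniq_mem f _ uF sF) ?finmap.fset_uniq//; apply: ler_sum => i _.
by case: ifP.
Qed.

(** Convergence along finite sets is the form in which linearity and conjugation can be checked on
    finite sums; [csum] itself is built from positive and negative parts. *)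
Definition has_sum (f : I -> C) (l : C) : Prop :=
  forall e : R, 0 < e -> exists2 F0 : seq I, uniq F0 &
    forall F, uniq F -> {subset F0 <= F} ->
      normc (l - \sum_(i <- F) f i) <= e.

Lemma rsum_approx (f : I -> R) (M e : R) :
  (forall F : seq I, uniq F -> \sum_(i <- F) `|f i| <= M) -> 0 < e ->
  exists2 F0 : seq I, uniq F0 & forall F, uniq F -> {subset F0 <= F} ->
    `|rsum f - \sum_(i <- F) f i| <= e.
Proof.
move=> fM e0.
have e20 : 0 < e / 2 by rewrite divr_gt0.
have fp i : 0 <= f^\+ i by rewrite /funrpos le_max lexx orbT.
have fn i : 0 <= f^\- i by rewrite /funrneg le_max lexx orbT.
have fpM (F : seq I) : uniq F -> \sum_(i <- F) f^\+ i <= M.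
  move=> uF; apply: le_trans (fM F uF); apply: ler_sum => i _.
  by rewrite /funrpos ge_max ler_norm normr_ge0.
have fnM (F : seq I) : uniq F -> \sum_(i <- F) f^\- i <= M.
  move=> uF; apply: le_trans (fM F uF); apply: ler_sum => i _.
  by rewrite /funrneg ge_max -{1}normrN ler_norm normr_ge0.
have [F1 uF1 H1] := esum_approx fp fpM e20.
have [F2 uF2 H2] := esum_approx fn fnM e20.
exists (undup (F1 ++ F2)) => [|F uF sF]; first exact: undup_uniq.
have {}H1 : `|fine (\esum_(i in [set: I]) (f^\+ i)%:E)%E -
    \sum_(i <- F) f^\+ i| <= e / 2.
  by apply: H1 => // x xF; apply: sF; rewrite mem_undup mem_cat xF.
have {}H2 : `|fine (\esum_(i in [set: I]) (f^\- i)%:E)%E -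
    \sum_(i <- F) f^\- i| <= e / 2.
  by apply: H2 => // x xF; apply: sF; rewrite mem_undup mem_cat xF orbT.
have -> : \sum_(i <- F) f i = \sum_(i <- F) f^\+ i - \sum_(i <- F) f^\- i.
  rewrite -sumrB; apply: eq_bigr => i _; rewrite /funrpos /funrneg.
  rewrite /Order.max oppr_lt0; case: ltgtP => [_|_|->].
  - by rewrite opprK add0r.
  - by rewrite subr0.
  - by rewrite oppr0 subr0.
rewrite /rsum; set a := fine _; set b := fine _; set c := \sum_(i <- F) _.
set d := \sum_(i <- F) _.
have -> : a - b - (c - d) = (a - c) - (b - d) by ring.
rewrite (splitr e); apply: le_trans (ler_normB _ _) _.
apply: lerD; [apply: H1|apply: H2].
Qed.

Lemma abs_summableP (f : I -> C) : abs_summable f <->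
  exists M, forall F : seq I, uniq F -> \sum_(i <- F) normc (f i) <= M.
Proof.
split=> [fs|[M fM]]; last by apply: le_lt_trans (esum_le_ub fM) _; exact: ltry.
exists (fine (\esum_(i in [set: I]) (normc (f i))%:E)%E) => F uF.
rewrite -lee_fin fineK; last first.
  by rewrite ge0_fin_numE//; apply: esum_ge0 => i _; rewrite lee_fin normc_ge0.
by apply: sum_le_esum => // i; apply: normc_ge0.
Qed.

Lemma csumP (f : I -> C) : abs_summable f -> has_sum f (csum f).
Proof.
move=> /abs_summableP [M fM] e e0.
have e20 : 0 < e / 2 by rewrite divr_gt0.
have fr (F : seq I) : uniq F -> \sum_(i <- F) `|complex.Re (f i)| <= M.
  by move=> uF; apply: le_trans (fM F uF); apply: ler_sum => i _; exact: normc_Re.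
have fi (F : seq I) : uniq F -> \sum_(i <- F) `|complex.Im (f i)| <= M.
  by move=> uF; apply: le_trans (fM F uF); apply: ler_sum => i _; exact: normc_Im.
have [F1 uF1 H1] := rsum_approx fr e20.
have [F2 uF2 H2] := rsum_approx fi e20.
exists (undup (F1 ++ F2)) => [|F uF sF]; first exact: undup_uniq.
apply: le_trans (normc_le_ReIm _) _; rewrite (splitr e).
have -> : complex.Re (csum f - \sum_(i <- F) f i) =
  rsum (fun i => complex.Re (f i)) - \sum_(i <- F) complex.Re (f i).
  by rewrite raddfB /= raddf_sum.
have -> : complex.Im (csum f - \sum_(i <- F) f i) =
  rsum (fun i => complex.Im (f i)) - \sum_(i <- F) complex.Im (f i).
  by rewrite raddfB /= raddf_sum.
apply: lerD; [apply: H1|apply: H2] => // x xF; apply: sF;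
  by rewrite mem_undup mem_cat xF ?orbT.
Qed.

Lemma has_sum_unique (f : I -> C) l l' : has_sum f l -> has_sum f l' -> l = l'.
Proof.
move=> hl hl'; apply/eqP; rewrite -subr_eq0 -normc_eq0; apply/eqP/le_anti.
rewrite normc_ge0 andbT; apply/ler_addgt0Pr => e e0; rewrite add0r.
have e20 : 0 < e / 2 by rewrite divr_gt0.
have [F1 uF1 H1] := hl _ e20; have [F2 uF2 H2] := hl' _ e20.
set F := undup (F1 ++ F2).
have uF : uniq F by exact: undup_uniq.
have {}H1 : normc (l - \sum_(i <- F) f i) <= e / 2.
  by apply: H1 => // x xF; rewrite mem_undup mem_cat xF.
have {}H2 : normc (l' - \sum_(i <- F) f i) <= e / 2.
  by apply: H2 => // x xF; rewrite mem_undup mem_cat xF orbT.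
have -> : l - l' = (l - \sum_(i <- F) f i) - (l' - \sum_(i <- F) f i) by ring.
by rewrite (splitr e); apply: le_trans (ler_normcB _ _) _; exact: lerD.
Qed.

Lemma csum_has_sum (f : I -> C) l : abs_summable f -> has_sum f l -> csum f = l.
Proof. by move=> /csumP; exact: has_sum_unique. Qed.

Lemma has_sum_fin (f : I -> C) (F : seq I) : uniq F ->
  (forall i, i \notin F -> f i = 0) -> has_sum f (\sum_(i <- F) f i).
Proof.
move=> uF f0 e e0; exists F => // F' uF' sF.
by rewrite (big_uniq_sub uF uF' sF f0) subrr normc0E ltW.
Qed.

Lemma abs_summable_fin (f : I -> C) (F : seq I) : uniq F ->
  (forall i, i \notin F -> f i = 0) -> abs_summable f.
Proof.
move=> uF f0; apply/abs_summableP; exists (\sum_(i <- F) normc (f i)) => F' uF'.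
have sF : {subset F <= undup (F ++ F')} by move=> x xF; rewrite mem_undup mem_cat xF.
have sF' : {subset F' <= undup (F ++ F')}.
  by move=> x xF; rewrite mem_undup mem_cat xF orbT.
rewrite -(big_uniq_sub uF _ sF) ?undup_uniq//; last first.
  by move=> x /f0 ->; rewrite normc0E.
rewrite -(big_uniq_mem _ uF' _ sF') ?undup_uniq//; apply: ler_sum => i _.
by case: ifP => // _; exact: normc_ge0.
Qed.

Lemma csum_fin (f : I -> C) (F : seq I) : uniq F ->
  (forall i, i \notin F -> f i = 0) -> csum f = \sum_(i <- F) f i.
Proof.
move=> uF f0; apply: csum_has_sum; first exact: abs_summable_fin uF f0.
exact: has_sum_fin.
Qed.

Lemma csum1 (f : I -> C) i0 : (forall i, i != i0 -> f i = 0) -> csum f = f i0.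
Proof.
move=> f0; rewrite (@csum_fin _ [:: i0])// ?big_seq1// => i.
by rewrite inE; exact: f0.
Qed.

Lemma abs_summable_lin (a : C) (f g : I -> C) : abs_summable f ->
  abs_summable g -> abs_summable (fun i => a * f i + g i).
Proof.
move=> /abs_summableP [M fM] /abs_summableP [M' gM].
apply/abs_summableP; exists (normc a * M + M') => F uF.
apply: le_trans (_ : \sum_(i <- F) (normc a * normc (f i) + normc (g i)) <= _).
  by apply: ler_sum => i _; rewrite -normcM ler_normcD.
rewrite big_split -mulr_sumr /= lerD ?gM// ler_wpM2l ?normc_ge0//; exact: fM.
Qed.

Lemma csum_lin (a : C) (f g : I -> C) : abs_summable f -> abs_summable g ->
  csum (fun i => a * f i + g i) = a * csum f + csum g.
Proof.
move=> sf sg; apply: csum_has_sum; first exact: abs_summable_lin.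
move=> e e0.
have a0 : 0 < normc a + 1 by rewrite ltr_pwDr// normc_ge0.
have e1 : 0 < e / 2 / (normc a + 1) by rewrite !divr_gt0.
have e20 : 0 < e / 2 by rewrite divr_gt0.
have [F1 uF1 H1] := csumP sf e1; have [F2 uF2 H2] := csumP sg e20.
exists (undup (F1 ++ F2)) => [|F uF sF]; first exact: undup_uniq.
have {}H1 : normc (csum f - \sum_(i <- F) f i) <= e / 2 / (normc a + 1).
  by apply: H1 => // x xF; apply: sF; rewrite mem_undup mem_cat xF.
have {}H2 : normc (csum g - \sum_(i <- F) g i) <= e / 2.
  by apply: H2 => // x xF; apply: sF; rewrite mem_undup mem_cat xF orbT.
have -> : a * csum f + csum g - \sum_(i <- F) (a * f i + g i) =
  a * (csum f - \sum_(i <- F) f i) + (csum g - \sum_(i <- F) g i).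
  by rewrite big_split -mulr_sumr /=; ring.
rewrite (splitr e); apply: le_trans (ler_normcD _ _) _; apply: lerD H2.
rewrite normcM; apply: le_trans (_ : (normc a + 1) * (e / 2 / (normc a + 1)) <= _).
  by apply: ler_pM; rewrite ?normc_ge0// lerDl.
by rewrite mulrCA divff ?mulr1// gt_eqF.
Qed.

Lemma csum_conj (f : I -> C) : abs_summable f ->
  csum (fun i => (f i)^*) = (csum f)^*.
Proof.
move=> sf; apply: csum_has_sum.
  by rewrite /abs_summable; under eq_esum do rewrite normc_conj.
move=> e e0; have [F uF H] := csumP sf e0; exists F => // F' uF' sF.
have -> : (csum f)^* - \sum_(i <- F') (f i)^* = (csum f - \sum_(i <- F') f i)^*.
  by rewrite rmorphB rmorph_sum.
by rewrite normc_conj; exact: H.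
Qed.

Lemma csum_reindex (h h' : I -> I) (f : I -> C) : cancel h h' -> cancel h' h ->
  csum (f \o h) = csum f.
Proof.
move=> hK h'K.
have hb : set_bij [set: I] [set: I] h.
  by rewrite setTT_bijective; exists h'.
by rewrite /csum /rsum; congr (_ +i* _); congr (_ - _); congr fine;
  rewrite [in RHS](reindex_esum [set: I] [set: I] h).
Qed.

End sums.

(** * The Hilbert space l^2(I) *)

Section hilbert.
Context (R : realType) (I : choiceType).
Local Notation C := R[i].
Implicit Types (x y z : l2 R I) (F : seq I).

Lemma l2P x y : (forall p, x p = y p) -> x = y.
Proof. by move=> xy; apply: val_inj; apply/funext. Qed.

Lemma l2_addE x y p : (x + y) p = x p + y p.
Proof. by []. Qed.

Lemma l2_scaleE (c : C) x p : (c *: x) p = c * x p.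
Proof. by []. Qed.

Lemma l2_oppE x p : (- x) p = - x p.
Proof. by []. Qed.

Lemma l2_zeroE p : (0 : l2 R I) p = 0.
Proof. by []. Qed.

Lemma l2_sumE (A : Type) (r : seq A) (f : A -> l2 R I) p :
  (\sum_(i <- r) f i) p = \sum_(i <- r) f i p.
Proof.
by elim: r => [|i r IH]; rewrite ?big_nil// !big_cons l2_addE IH.
Qed.

Lemma sq_summableP (f : I -> C) : sq_summable f <->
  exists M, forall F, uniq F -> \sum_(i <- F) normc (f i) ^+ 2 <= M.
Proof.
split=> [fs|[M fM]]; last by apply: le_lt_trans (esum_le_ub fM) _; exact: ltry.
exists (fine (\esum_(i in [set: I]) (normc (f i) ^+ 2)%:E)%E) => F uF.
rewrite -lee_fin fineK; last first.
  by rewrite ge0_fin_numE//; apply: esum_ge0 => i _; rewrite lee_fin sqr_ge0.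
by apply: sum_le_esum => // i; apply: sqr_ge0.
Qed.

Lemma l2_sq_summable x : sq_summable x.
Proof. by have := valP x; rewrite unfold_in => /asboolP. Qed.

Lemma tol2E (f : I -> C) : sq_summable f -> tol2 f = f :> (I -> C).
Proof.
move=> sf; rewrite /tol2; apply: (@insubdK _ _ (l2 R I)).
by rewrite unfold_in; apply/asboolP.
Qed.

Lemma sqnorm_approx x (e : R) : 0 < e ->
  exists2 F0 : seq I, uniq F0 & forall F, uniq F -> {subset F0 <= F} ->
    `|sqnorm x - \sum_(i <- F) normc (x i) ^+ 2| <= e.
Proof.
have /sq_summableP [M xM] := l2_sq_summable x.
apply: (@rsum_approx _ _ _ M) => F uF.
by under eq_bigr do rewrite ger0_norm ?sqr_ge0//; exact: xM.
Qed.

Lemma sum_le_sqnorm x F : uniq F ->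
  \sum_(i <- F) normc (x i) ^+ 2 <= sqnorm x.
Proof.
move=> uF; apply/ler_addgt0Pr => e e0.
have [F0 uF0 H] := sqnorm_approx x e0.
have K : `|sqnorm x - \sum_(i <- undup (F0 ++ F)) normc (x i) ^+ 2| <= e.
  by apply: H => [|z zF]; rewrite ?undup_uniq// mem_undup mem_cat zF.
have sF : {subset F <= undup (F0 ++ F)}.
  by move=> z zF; rewrite mem_undup mem_cat zF orbT.
apply: le_trans (_ : \sum_(i <- undup (F0 ++ F)) normc (x i) ^+ 2 <= _).
  rewrite -(big_uniq_mem _ uF _ sF) ?undup_uniq//; apply: ler_sum => i _.
  by case: ifP => // _; exact: sqr_ge0.
by rewrite -lerBlDl; move: K; rewrite distrC; apply: le_trans; exact: ler_norm.
Qed.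

Lemma sqnorm_le x (M : R) :
  (forall F, uniq F -> \sum_(i <- F) normc (x i) ^+ 2 <= M) -> sqnorm x <= M.
Proof.
move=> xM; apply/ler_addgt0Pr => e e0.
have [F0 uF0 H] := sqnorm_approx x e0.
have := H F0 uF0 (fun _ => id) => /(le_trans (ler_norm _)).
by rewrite lerBlDl => /le_trans; apply; rewrite lerD2r; exact: xM.
Qed.

Lemma sqnorm_ge0 x : 0 <= sqnorm x.
Proof. by have := @sum_le_sqnorm x [::] isT; rewrite big_nil. Qed.

Definition l2norm x : R := Num.sqrt (sqnorm x).

Lemma l2norm_ge0 x : 0 <= l2norm x.
Proof. exact: sqrtr_ge0. Qed.

Lemma l2norm_sqr x : l2norm x ^+ 2 = sqnorm x.
Proof. by rewrite sqr_sqrtr// sqnorm_ge0. Qed.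

Lemma vnorm_le_l2norm x F : uniq F -> vnorm F x <= l2norm x.
Proof. by move=> uF; apply: ler_wsqrtr; exact: sum_le_sqnorm. Qed.

Lemma l2norm_le x (M : R) : 0 <= M ->
  (forall F, uniq F -> vnorm F x <= M) -> l2norm x <= M.
Proof.
move=> M0 xM; rewrite -(ger0_norm M0) -sqrtr_sqr; apply: ler_wsqrtr.
apply: sqnorm_le => F uF; rewrite -vnorm_sqr.
by rewrite ler_pXn2r// ?nnegrE ?vnorm_ge0//; exact: xM.
Qed.

Lemma normc_le_l2norm x p : normc (x p) <= l2norm x.
Proof.
apply: le_trans (@vnorm_le_l2norm x [:: p] isT).
by rewrite /vnorm big_seq1 sqrtr_sqr ger0_norm ?normc_ge0.
Qed.

Lemma l2norm_eq0 x : l2norm x = 0 -> x = 0.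
Proof.
move=> x0; apply: l2P => p; apply/eqP; rewrite -normc_eq0.
by rewrite eq_le normc_ge0 andbT -x0 normc_le_l2norm.
Qed.

Lemma l2norm0 : l2norm 0 = 0.
Proof.
apply/le_anti; rewrite l2norm_ge0 andbT; apply: l2norm_le => // F uF.
by rewrite /vnorm big1 ?sqrtr0// => i _; rewrite l2_zeroE normc0E expr0n.
Qed.

Lemma vnormD (A : Type) (F : seq A) (a b : A -> C) :
  vnorm F (fun t => a t + b t) <= vnorm F a + vnorm F b.
Proof.
rewrite -(@ler_pXn2r _ 2)// ?nnegrE ?addr_ge0 ?vnorm_ge0//.
rewrite vnorm_sqr sqrrD !vnorm_sqr.
apply: le_trans (_ : \sum_(x <- F) (normc (a x) ^+ 2 +
    normc (a x) * normc (b x) *+ 2 + normc (b x) ^+ 2) <= _).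
  apply: ler_sum => x _; rewrite -sqrrD ler_pXn2r// ?nnegrE ?addr_ge0 ?normc_ge0//.
  exact: ler_normcD.
by rewrite 2!big_split /= lerD2r lerD2l sumrMnl ler_wMn2r// cauchy_schwarz.
Qed.

Lemma l2normD x y : l2norm (x + y) <= l2norm x + l2norm y.
Proof.
apply: l2norm_le => [|F uF]; first by rewrite addr_ge0 ?l2norm_ge0.
by apply: le_trans (vnormD _ _ _) _; rewrite lerD ?vnorm_le_l2norm.
Qed.

Lemma l2norm_sum (A : Type) (r : seq A) (f : A -> l2 R I) :
  l2norm (\sum_(i <- r) f i) <= \sum_(i <- r) l2norm (f i).
Proof.
elim: r => [|i r IH]; first by rewrite !big_nil l2norm0.
by rewrite !big_cons; apply: le_trans (l2normD _ _) _; rewrite lerD2l.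
Qed.

Lemma l2normZ (c : C) x : l2norm (c *: x) = normc c * l2norm x.
Proof.
have H d y : l2norm (d *: y) <= normc d * l2norm y.
  apply: l2norm_le => [|F uF]; first by rewrite mulr_ge0 ?l2norm_ge0 ?normc_ge0.
  by rewrite (vnormZ F d y) ler_wpM2l ?normc_ge0 ?vnorm_le_l2norm.
have [->|c0] := eqVneq c 0; first by rewrite scale0r l2norm0 normc0E mul0r.
apply/le_anti; rewrite H /=.
have := ler_wpM2l (normc_ge0 c) (H c^-1 (c *: x)).
by rewrite scalerA mulVf// scale1r mulrA -normcM divff// normc1E mul1r.
Qed.

Lemma l2normN x : l2norm (- x) = l2norm x.
Proof. by rewrite -scaleN1r l2normZ normcNE normc1E mul1r. Qed.

Lemma dot_abs_summable x y : abs_summable (fun i => x i * (y i)^*).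
Proof.
apply/abs_summableP; exists (l2norm x * l2norm y) => F uF.
apply: le_trans (_ : vnorm F x * vnorm F y <= _).
  rewrite -(vnorm_conj F y); apply: le_trans (cauchy_schwarz _ _ _).
  by apply: ler_sum => i _; rewrite normcM.
by apply: ler_pM; rewrite ?vnorm_ge0 ?vnorm_le_l2norm.
Qed.

Lemma dot_lin (c : C) x y z : dot (c *: x + y) z = c * dot x z + dot y z.
Proof.
rewrite /dot -csum_lin; try exact: dot_abs_summable.
by congr csum; apply/funext => i; rewrite l2_addE l2_scaleE mulrDl mulrA.
Qed.

Lemma dot_conj x y : dot y x = (dot x y)^*.
Proof.
rewrite /dot -csum_conj; last exact: dot_abs_summable.
by congr csum; apply/funext => i; rewrite rmorphM /= conjcK mulrC.
Qed.

Lemma dotxx x : dot x x = (sqnorm x)%:C.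
Proof.
apply: csum_has_sum; first exact: dot_abs_summable.
move=> e e0; have [F uF H] := sqnorm_approx x e0; exists F => // F' uF' sF.
rewrite (_ : \sum_(i <- F') _ = (\sum_(i <- F') normc (x i) ^+ 2)%:C).
  by rewrite -rmorphB normc_real; exact: H.
by rewrite raddf_sum; apply: eq_bigr => i _; exact: mulc_conj.
Qed.

Lemma sq_summable_fin (f : I -> C) F : uniq F ->
  (forall i, i \notin F -> f i = 0) -> sq_summable f.
Proof.
move=> uF f0.
have : abs_summable (fun i => f i * f i).
  by apply: abs_summable_fin uF _ => i /f0 ->; rewrite mul0r.
by rewrite /abs_summable /sq_summable; under eq_esum do rewrite normcM.
Qed.

Lemma basisE (q p : I) : Defs.basis R q p = (p == q)%:R.
Proof.
rewrite /Defs.basis tol2E//; apply: (@sq_summable_fin _ [:: q]) => // i.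
by rewrite inE => /negPf ->.
Qed.

Lemma dot_basis x p : dot x (Defs.basis R p) = x p.
Proof.
rewrite /dot (@csum1 _ _ _ p) => [|i /negPf ip]; rewrite basisE.
  by rewrite rmorph_nat eqxx mulr1.
by rewrite rmorph_nat ip mulr0.
Qed.

Definition cutoff F x : l2 R I := \sum_(q <- F) x q *: Defs.basis R q.

Lemma cutoffE F x p : uniq F -> cutoff F x p = if p \in F then x p else 0.
Proof.
move=> uF; rewrite /cutoff l2_sumE; under eq_bigr do rewrite l2_scaleE basisE.
case: ifPn => pF.
  rewrite (bigD1_seq p)//= eqxx mulr1 big1 ?addr0// => i /negPf.
  by rewrite eq_sym => ->; rewrite mulr0.
rewrite big_seq big1// => i iF; case: eqVneq => [pi|_]; last by rewrite mulr0.
by rewrite pi iF in pF.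
Qed.

Lemma l2norm_sub_cutoff x (e : R) : 0 < e ->
  exists2 F0 : seq I, uniq F0 & forall F, uniq F -> {subset F0 <= F} ->
    l2norm (x - cutoff F x) <= e.
Proof.
move=> e0; have [F0 uF0 H] := sqnorm_approx x (exprn_gt0 2 e0).
exists F0 => // F' uF' sF'; apply: l2norm_le => [|F uF]; first exact: ltW.
rewrite -(ger0_norm (ltW e0)) -sqrtr_sqr; apply: ler_wsqrtr.
set U := undup (F' ++ F).
have uU : uniq U by exact: undup_uniq.
have s0 : {subset F' <= U} by move=> z zF; rewrite mem_undup mem_cat zF.
have s1 : {subset F <= U} by move=> z zF; rewrite mem_undup mem_cat zF orbT.
apply: le_trans (H F' uF' sF').
apply: le_trans (ler_norm _).
(* The tail vanishes on [F'], so the two sums count each coordinate of the union at most once. *)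
rewrite lerBrDr; apply: le_trans (sum_le_sqnorm x uU).
rewrite -(big_uniq_mem _ uF uU s1) -(big_uniq_mem _ uF' uU s0) -big_split /=.
apply: ler_sum => i _.
change ((if i \in F then normc (x i - cutoff F' x i) ^+ 2 else 0) +
  (if i \in F' then normc (x i) ^+ 2 else 0) <= normc (x i) ^+ 2).
rewrite cutoffE//.
case: ifP => _; case: ifP => _; rewrite ?subrr ?subr0 ?normc0E ?expr0n ?add0r ?addr0//.
exact: sqr_ge0.
Qed.

Lemma sqnorm_fin x F : uniq F -> (forall p, p \notin F -> x p = 0) ->
  sqnorm x = \sum_(p <- F) normc (x p) ^+ 2.
Proof.
move=> uF x0; apply/le_anti; rewrite sum_le_sqnorm// andbT.
apply: sqnorm_le => F' uF'; set U := undup (F ++ F').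
have uU : uniq U by exact: undup_uniq.
have s0 : {subset F <= U} by move=> z zF; rewrite mem_undup mem_cat zF.
have s1 : {subset F' <= U} by move=> z zF; rewrite mem_undup mem_cat zF orbT.
rewrite -(big_uniq_sub uF uU s0); last by move=> p /x0 ->; rewrite normc0E expr0n.
rewrite -(big_uniq_mem _ uF' uU s1); apply: ler_sum => p _.
by case: ifP => // _; exact: sqr_ge0.
Qed.

Lemma vnorm_le_sum (A : Type) (r : seq A) (a : A -> C) :
  vnorm r a <= \sum_(t <- r) normc (a t).
Proof.
elim: r => [|t r IH]; first by rewrite /vnorm !big_nil sqrtr0.
rewrite big_cons; apply: le_trans (lerD (lexx _) IH).
rewrite -(@ler_pXn2r _ 2)// ?nnegrE ?addr_ge0 ?vnorm_ge0 ?normc_ge0//.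
rewrite sqrrD !vnorm_sqr big_cons lerD2r lerDl mulrn_wge0//.
by rewrite mulr_ge0 ?vnorm_ge0 ?normc_ge0.
Qed.

End hilbert.

(** * Completeness of the complex numbers and of l^2(I) *)

Section completeness.
Context (R : realType).
Local Notation C := R[i].

Lemma real_cauchy_lim (x : nat -> R) :
  (forall e : R, 0 < e -> exists N, forall m n, (N <= m)%N -> (N <= n)%N ->
    `|x m - x n| <= e) ->
  exists l, forall e : R, 0 < e -> exists N, forall n, (N <= n)%N ->
    `|x n - l| <= e.
Proof.
move=> xc; have : cvg (x @ \oo).
  apply/cauchy_cvgP/cauchy_exP => e e0.
  have [N H] := xc _ (divr_gt0 e0 (ltr0n R 2)).
  exists (x N); exists N => // n /= Nn.
  rewrite /ball /=; apply: le_lt_trans (H _ _ (leqnn N) Nn) _.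
  by rewrite gtr_pMr// invf_lt1// ltr1n.
move=> cx; exists (lim (x @ \oo)) => e e0.
have /cvgrPdist_le/(_ e e0) [N _ H] := cx.
by exists N => n /H /=; rewrite distrC.
Qed.

Lemma complex_cauchy_lim (x : nat -> C) :
  (forall e : R, 0 < e -> exists N, forall m n, (N <= m)%N -> (N <= n)%N ->
    normc (x m - x n) <= e) ->
  exists l, forall e : R, 0 < e -> exists N, forall n, (N <= n)%N ->
    normc (x n - l) <= e.
Proof.
move=> xc.
have [e e0|a Ha] := @real_cauchy_lim (fun n => complex.Re (x n)).
  have [N H] := xc e e0; exists N => m n Nm Nn; apply: le_trans (H m n Nm Nn).
  by rewrite -raddfB normc_Re.
have [e e0|b Hb] := @real_cauchy_lim (fun n => complex.Im (x n)).
  have [N H] := xc e e0; exists N => m n Nm Nn; apply: le_trans (H m n Nm Nn).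
  by rewrite -raddfB normc_Im.
exists (a +i* b) => e e0.
have [N1 H1] := Ha _ (divr_gt0 e0 (ltr0n R 2)).
have [N2 H2] := Hb _ (divr_gt0 e0 (ltr0n R 2)).
exists (maxn N1 N2) => n; rewrite geq_max => /andP[n1 n2].
apply: le_trans (normc_le_ReIm _) _; rewrite (splitr e) !raddfB /=.
by apply: lerD; [exact: H1|exact: H2].
Qed.

(** The limit is taken coordinatewise. On a finite set of coordinates the Cauchy bound passes to the
    limit in one index, and it does not depend on the set; this gives both square summability of the
    limit and convergence in norm. *)
Lemma l2_complete (I : choiceType) (x : nat -> l2 R I) :
  (forall e : R, 0 < e -> exists N, forall m n, (N <= m)%N -> (N <= n)%N ->
    l2norm (x m - x n) <= e) ->
  exists y, forall e : R, 0 < e -> exists N, forall n, (N <= n)%N ->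
    l2norm (x n - y) <= e.
Proof.
move=> xc.
have /choice [y Hy] : forall p : I, exists l : C, forall e : R, 0 < e -> exists N,
    forall n, (N <= n)%N -> normc (x n p - l) <= e.
  move=> p; apply: complex_cauchy_lim => e e0; have [N H] := xc e e0.
  exists N => m n Nm Nn; apply: le_trans (H m n Nm Nn).
  exact: (normc_le_l2norm (x m - x n)).
have Fy (F : seq I) (e : R) : 0 < e -> exists N, forall n, (N <= n)%N ->
    vnorm F (fun p => x n p - y p) <= e.
  elim: F e => [|p F IH] e e0.
    by exists 0%N => n _; rewrite /vnorm big_nil sqrtr0 ltW.
  have e20 := divr_gt0 e0 (ltr0n R 2).
  have [N1 H1] := IH _ e20; have [N2 H2] := Hy p _ e20.
  exists (maxn N1 N2) => n; rewrite geq_max => /andP[n1 n2].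
  apply: le_trans (_ : vnorm F (fun p => x n p - y p) + normc (x n p - y p) <= _).
    rewrite -(@ler_pXn2r _ 2)// ?nnegrE ?addr_ge0 ?vnorm_ge0 ?normc_ge0//.
    rewrite sqrrD !vnorm_sqr big_cons addrC lerD2r lerDl mulrn_wge0//.
    by rewrite mulr_ge0 ?vnorm_ge0 ?normc_ge0.
  by rewrite (splitr e) lerD ?H1 ?H2.
have xyF (e : R) : 0 < e -> exists N, forall n, (N <= n)%N -> forall F, uniq F ->
    vnorm F (fun p => x n p - y p) <= e.
  move=> e0; have [N H] := xc _ e0; exists N => n Nn F uF.
  apply/ler_addgt0Pr => d d0; have [M HM] := Fy F d d0.
  have /(_ (leq_maxr _ _)) := HM (maxn N M).
  move=> hM; apply: le_trans (lerD (H n (maxn N M) Nn (leq_maxl _ _)) hM).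
  apply: le_trans (lerD (vnorm_le_l2norm _ uF) (lexx _)).
  apply: le_trans (vnormD _ _ _); rewrite le_eqVlt; apply/orP; left; apply/eqP.
  by apply: eq_vnorm => p _; rewrite l2_addE l2_oppE; ring.
have sy : sq_summable y.
  have [N H] := xyF 1 ltr01; apply/sq_summableP; exists ((1 + l2norm (x N)) ^+ 2).
  move=> F uF; rewrite -vnorm_sqr ler_pXn2r// ?nnegrE ?addr_ge0 ?l2norm_ge0 ?vnorm_ge0//.
  apply: le_trans (lerD (H N (leqnn N) F uF) (vnorm_le_l2norm (x N) uF)).
  rewrite -[X in X + _](_ : vnorm F (fun p => - 1 * (x N p - y p)) = _); last first.
    by rewrite vnormZ normcNE normc1E mul1r.
  apply: le_trans (vnormD _ _ _); rewrite le_eqVlt; apply/orP; left; apply/eqP.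
  by apply: eq_vnorm => p _; ring.
exists (tol2 y) => e e0; have [N H] := xyF e e0; exists N => n Nn.
apply: l2norm_le => [|F uF]; first exact: ltW.
apply: le_trans (H n Nn F uF); rewrite le_eqVlt; apply/orP; left; apply/eqP.
by apply: eq_vnorm => p _; rewrite l2_addE l2_oppE tol2E.
Qed.

End completeness.

(** * Bounded operators and their matrices *)

Section operators.
Context (R : realType) (I : choiceType).
Local Notation C := R[i].
Local Notation op := (op R I).
Implicit Types (T : op) (x y : l2 R I) (F : seq I).

Lemma entryE T p q : entry T p q = T (Defs.basis R q) p.
Proof. exact: dot_basis. Qed.

Definition linear_op T := linear_on [set: l2 R I] T.

Lemma linear_opP T (c : C) x y : linear_op T -> T (c *: x + y) = c *: T x + T y.
Proof. by move=> /(_ c x y Logic.I Logic.I). Qed.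

Lemma linear_op0 T : linear_op T -> T 0 = 0.
Proof.
move=> /(linear_opP 1 0 0); rewrite scaler0 !scale1r addr0 => /eqP.
by rewrite -subr_eq subrr => /eqP.
Qed.

Lemma linear_opZ T (c : C) x : linear_op T -> T (c *: x) = c *: T x.
Proof.
by move=> lT; have := linear_opP c x 0 lT; rewrite !addr0 linear_op0// addr0.
Qed.

Lemma linear_opD T x y : linear_op T -> T (x + y) = T x + T y.
Proof. by move=> lT; have := linear_opP 1 x y lT; rewrite !scale1r. Qed.

Lemma linear_opB T x y : linear_op T -> T (x - y) = T x - T y.
Proof. by move=> lT; rewrite linear_opD// -(scaleN1r y) linear_opZ// (scaleN1r (T y)). Qed.

Lemma linear_op_sum T (A : Type) (r : seq A) (f : A -> l2 R I) : linear_op T ->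
  T (\sum_(i <- r) f i) = \sum_(i <- r) T (f i).
Proof.
move=> lT; elim: r => [|i r IH]; first by rewrite !big_nil linear_op0.
by rewrite !big_cons linear_opD// IH.
Qed.

Lemma mxop_norm_ge (n : nat) (T : 'M[op]_n) (x : 'I_n -> l2 R I) :
  \sum_j sqnorm (x j) <= 1 ->
  ((Num.sqrt (\sum_i sqnorm (\sum_j T i j (x j))))%:E <= opmx_norm T)%E.
Proof. by move=> x1; apply: ereal_sup_ubound; exists x. Qed.

(** For the homogeneity the rows of [T] are only assumed to be linear. *)
Lemma opmx_norm_le_vec (n : nat) (T : 'M[op]_n) (M : R) :
  (forall i j, linear_op (T i j)) -> (opmx_norm T <= M%:E)%E ->
  forall x : 'I_n -> l2 R I,
    Num.sqrt (\sum_i sqnorm (\sum_j T i j (x j))) <=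
    M * Num.sqrt (\sum_j sqnorm (x j)).
Proof.
move=> lT TM x; set s := \sum_j sqnorm (x j).
have s0 : 0 <= s by apply: sumr_ge0 => j _; exact: sqnorm_ge0.
have [se0|sn0] := eqVneq s 0.
  rewrite se0 sqrtr0 mulr0.
  have x0 j : x j = 0.
    apply: l2norm_eq0; rewrite /l2norm; move: se0 => /eqP.
    rewrite psumr_eq0 => [|i _]; last exact: sqnorm_ge0.
    by move=> /allP/(_ j); rewrite mem_index_enum => /(_ isT)/eqP ->; rewrite sqrtr0.
  rewrite big1 ?sqrtr0// => i _; rewrite big1 => [|j _]; last first.
    by rewrite x0 linear_op0.
  by rewrite -l2norm_sqr l2norm0 expr0n.
set t := Num.sqrt s; have t0 : 0 < t by rewrite sqrtr_gt0 lt0r sn0.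
have tV : 0 <= t^-1 by rewrite invr_ge0 ltW.
have sqZ (y : l2 R I) : sqnorm ((t^-1)%:C *: y) = t^-1 ^+ 2 * sqnorm y.
  by rewrite -!l2norm_sqr l2normZ normc_real ger0_norm// exprMn.
have : \sum_j sqnorm ((t^-1)%:C *: x j) <= 1.
  under eq_bigr do rewrite sqZ.
  by rewrite -mulr_sumr exprVn sqr_sqrtr// mulVf.
move=> /(mxop_norm_ge T)/le_trans/(_ TM); rewrite lee_fin.
under eq_bigr => i _.
  under eq_bigr do rewrite linear_opZ//.
  rewrite -scaler_sumr sqZ; over.
rewrite -mulr_sumr sqrtrM ?sqr_ge0// sqrtr_sqr ger0_norm//.
by rewrite ler_pdivrMl// mulrC.
Qed.

(** The scalar matrix of [T] on the sum of n copies of l^2(I), through which [opmx_norm] becomes a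
    statement about [kernel_le]. *)
Definition blocks (n : nat) (T : 'M[op]_n) (x y : 'I_n * I) : C :=
  entry (T x.1 y.1) x.2 y.2.

Lemma bounded_opP T : bounded_op T <-> linear_op T /\
  exists2 M : R, 0 <= M & forall x, l2norm (T x) <= M * l2norm x.
Proof.
have E (x : 'I_1 -> l2 R I) :
    Num.sqrt (\sum_i sqnorm (\sum_j (const_mx T : 'M[op]_1) i j (x j))) =
    l2norm (T (x ord0)).
  by rewrite !big_ord1 mxE.
split=> [[lT Tfin]|[lT [M M0 TM]]].
  split=> //; have T0 : (0 <= opnorm T)%E.
    have := @mxop_norm_ge 1 (const_mx T) (fun=> 0).
    rewrite big_ord1 -l2norm_sqr l2norm0 expr0n => /(_ ler01).
    by apply: le_trans; rewrite lee_fin sqrtr_ge0.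
  have Tf : opnorm T \is a fin_num by rewrite ge0_fin_numE.
  exists (fine (opnorm T)); first exact: fine_ge0.
  move=> x; have := @opmx_norm_le_vec 1 (const_mx T) (fine (opnorm T)) _ _ (fun=> x).
  by rewrite !big_ord1 mxE; apply=> [i j|]; rewrite ?mxE// fineK.
split=> //; apply: (@le_lt_trans _ _ M%:E); last exact: ltry.
apply: ge_ereal_sup => _ [x /= x1 <-]; rewrite E lee_fin.
apply: le_trans (TM _) _; rewrite ler_piMr// /l2norm -sqrtr1.
by apply: ler_wsqrtr; rewrite big_ord1 in x1.
Qed.

Lemma bounded_op_linear T : bounded_op T -> linear_op T.
Proof. by case. Qed.


Lemma sum_pairs n (V : nmodType) (F : seq ('I_n * I)) (f : 'I_n * I -> V) : uniq F ->
  \sum_(x <- F) f x = \sum_i \sum_(p <- undup (map snd F))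
    if (i, p) \in F then f (i, p) else 0.
Proof.
move=> uF; rewrite -(big_uniq_mem f uF
  (_ : uniq [seq (i, p) | i <- index_enum 'I_n, p <- undup (map snd F)])).
- by rewrite big_allpairs.
- apply: allpairs_uniq => [||[i p] [j q] _ _ /= [-> ->]//]; last exact: undup_uniq.
  exact: index_enum_uniq.
- move=> [i p] ipF; apply/allpairsP; exists (i, p); split=> //=.
    exact: mem_index_enum.
  by rewrite mem_undup; apply/mapP; exists (i, p).
Qed.

Lemma kernel_le_blocks n (T : 'M[op]_n) (M : R) (F : seq ('I_n * I)) :
  (forall i j, linear_op (T i j)) -> (opmx_norm T <= M%:E)%E -> uniq F ->
  kernel_le F (blocks T) M.
Proof.
move=> lT TM uF a b.
pose x j : l2 R I := \sum_(y <- F) (a y * (y.1 == j)%:R) *: Defs.basis R y.2.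
have xE j p : x j p = if (j, p) \in F then a (j, p) else 0.
  rewrite /x l2_sumE; under eq_bigr do rewrite l2_scaleE basisE -mulrA.
  case: ifPn => jpF.
    rewrite (bigD1_seq (j, p))//= !eqxx !mulr1 big1 ?addr0// => -[i q] /= ij.
    case: eqVneq => [ijE|_]; last by rewrite mul0r mulr0.
    case: eqVneq => [pq|_]; last by rewrite mulr0 mulr0.
    by rewrite ijE pq eqxx in ij.
  rewrite big_seq big1// => -[i q] /= iqF.
  case: eqVneq => [ij|_]; last by rewrite mul0r mulr0.
  case: eqVneq => [pq|_]; last by rewrite mulr0 mulr0.
  by rewrite -ij pq iqF in jpF.
pose P := undup (map snd F).
have uP : uniq P by exact: undup_uniq.
have xN : \sum_j sqnorm (x j) = vnorm F a ^+ 2.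
  rewrite vnorm_sqr sum_pairs//; apply: eq_bigr => j _.
  rewrite (sqnorm_fin uP) => [|p]; last first.
    rewrite mem_undup xE; case: ifPn => // jpF /negP[].
    by apply/mapP; exists (j, p).
  by apply: eq_bigr => p _; rewrite xE; case: ifP => // _; rewrite normc0E expr0n.
pose w i := \sum_j T i j (x j).
have wE i p : w i p = \sum_(y <- F) blocks T (i, p) y * a y.
  rewrite /w l2_sumE; under eq_bigr => j _.
    rewrite linear_op_sum// l2_sumE.
    under eq_bigr do rewrite linear_opZ// l2_scaleE -entryE.
    over.
  rewrite exchange_big; apply: eq_bigr => -[j q] _ /=.
  rewrite (bigD1 j)//= eqxx mulr1 [X in _ + X]big1 => [|i' /negPf ij]; last first.
    by rewrite eq_sym ij mulr0 mul0r.
  by rewrite addr0 mulrC /blocks.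
have -> : \sum_(x <- F) \sum_(y <- F) blocks T x y * a y * b x =
    \sum_(x <- F) w x.1 x.2 * b x.
  by apply: eq_bigr => -[i p] _; rewrite -mulr_suml wE.
apply: le_trans (normc_sum_mul _ _ _) _; rewrite ler_wpM2r ?vnorm_ge0//.
have := opmx_norm_le_vec lT TM x; rewrite xN sqrtr_sqr ger0_norm ?vnorm_ge0//.
apply: le_trans; apply: ler_wsqrtr; rewrite sum_pairs//; apply: ler_sum => i _.
apply: le_trans (sum_le_sqnorm _ uP); apply: ler_sum => p _.
by case: ifP => // _; exact: sqr_ge0.
Qed.

(** Serves to choose one finite set that truncates finitely many vectors or sums at once. *)
Lemma uniq_cover (A : Type) (r : seq A) (H : A -> seq I -> Prop) :
  (forall t, exists2 F0 : seq I, uniq F0 &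
     forall F, uniq F -> {subset F0 <= F} -> H t F) ->
  forall F1 : seq I, exists2 F, uniq F /\ {subset F1 <= F} &
    forall F', uniq F' -> {subset F <= F'} -> forall t, List.In t r -> H t F'.
Proof.
move=> hH F1; elim: r => [|t r [F [uF s1] HF]].
  by exists (undup F1) => //; split=> [|x]; rewrite ?undup_uniq ?mem_undup.
have [F0 uF0 H0] := hH t; exists (undup (F0 ++ F)).
  by split=> [|x /s1 xF]; rewrite ?undup_uniq ?mem_undup ?mem_cat ?xF ?orbT.
move=> F' uF' s' t' [<-|t'r].
  by apply: H0 => // x xF; apply: s'; rewrite mem_undup mem_cat xF.
by apply: HF => // x xF; apply: s'; rewrite mem_undup mem_cat xF orbT.
Qed.

Lemma List_inP (A : eqType) (r : seq A) t : t \in r -> List.In t r.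
Proof.
by elim: r => [|s r IH]//=; rewrite inE => /orP[/eqP ->|/IH]; [left|right].
Qed.

(** Boundedness of the entries, with whatever bounds, makes the truncation of the vectors harmless;
    [S] collects these crude bounds. The constant [M] then comes from the finite matrices alone. *)
Lemma opmx_norm_le n (T : 'M[op]_n) (M : R) : 0 <= M ->
  (forall i j, bounded_op (T i j)) ->
  (forall F : seq ('I_n * I), uniq F -> kernel_le F (blocks T) M) ->
  (opmx_norm T <= M%:E)%E.
Proof.
move=> M0 bT TM; apply: ge_ereal_sup => _ [x /= x1 <-]; rewrite lee_fin.
have lT i j := bounded_op_linear (bT i j).
have /choice [B HB] : forall ij : 'I_n * 'I_n, exists M : R,
    0 <= M /\ forall x, l2norm (T ij.1 ij.2 x) <= M * l2norm x.
  by move=> ij; have [_ [K K0 HK]] := (bounded_opP _).1 (bT ij.1 ij.2); exists K.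
pose w i := \sum_j T i j (x j); rewrite -/(w _).
have vB (Q : seq I) (K := [seq (i, p) | i <- index_enum 'I_n, p <- Q])
    (v : 'I_n -> l2 R I) : uniq Q ->
    vnorm K (fun t => v t.1 t.2) ^+ 2 = \sum_i \sum_(p <- Q) normc (v i p) ^+ 2.
  by move=> uQ; rewrite vnorm_sqr big_allpairs.
have wQ (Q : seq I) : uniq Q -> \sum_i \sum_(p <- Q) normc (w i p) ^+ 2 <= M ^+ 2.
  move=> uQ; pose K Q' := [seq (i, p) | i <- index_enum 'I_n, p <- (Q' : seq I)].
  have uK Q' : uniq Q' -> uniq (K Q').
    move=> uQ'; apply: allpairs_uniq => [||[i p] [j q] _ _ /= [-> ->]//] => //.
    exact: index_enum_uniq.
  rewrite -vB// -/(K Q) ler_pXn2r// ?nnegrE ?vnorm_ge0//.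
  pose S := \sum_i \sum_j B (i, j).
  have S0 : 0 <= S by apply: sumr_ge0 => i _; apply: sumr_ge0 => j _; case: (HB (i, j)).
  apply/ler_addgt0Pr => e e0.
  have d0 : 0 < e / (S + 1) by rewrite divr_gt0// ltr_wpDl.
  have [Q' [uQ' sQ'] HQ'] := @uniq_cover 'I_n (index_enum 'I_n)
    (fun j F => l2norm (x j - cutoff F (x j)) <= e / (S + 1))
    (fun j => l2norm_sub_cutoff (x j) d0) Q.
  have {}HQ' j : l2norm (x j - cutoff Q' (x j)) <= e / (S + 1).
    by apply: HQ' => //; apply: List_inP; exact: mem_index_enum.
  apply: le_trans (_ : vnorm (K Q') (fun t => w t.1 t.2) <= _).
    apply: ler_wsqrtr; rewrite !big_allpairs /=; apply: ler_sum => i _.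
    rewrite -(big_uniq_mem _ uQ uQ' sQ'); apply: ler_sum => p _.
    by case: ifP => // _; exact: sqr_ge0.
  pose w' i := \sum_j T i j (cutoff Q' (x j)).
  have -> : (fun t : 'I_n * I => w t.1 t.2) =
      (fun t => w' t.1 t.2 + (w t.1 - w' t.1) t.2).
    by apply/funext => t; rewrite l2_addE l2_oppE; ring.
  apply: le_trans (vnormD _ _ _) _; apply: lerD.
    have -> : (fun t : 'I_n * I => w' t.1 t.2) =
        (fun t => \sum_(y <- K Q') blocks T t y * x y.1 y.2).
      apply/funext => t; rewrite /w' l2_sumE big_allpairs; apply: eq_bigr => j _.
      rewrite /cutoff linear_op_sum// l2_sumE; apply: eq_bigr => q _.
      by rewrite linear_opZ// l2_scaleE mulrC -entryE.
    apply: le_trans (kernel_le_vnorm _ M0 (TM _ (uK _ uQ'))) _.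
    rewrite ler_piMr// -sqrtr1; apply: ler_wsqrtr; rewrite big_allpairs /=.
    by apply: le_trans x1; apply: ler_sum => j _; exact: sum_le_sqnorm.
  apply: le_trans (_ : \sum_i l2norm (w i - w' i) <= _).
    rewrite -(@ler_pXn2r _ 2)// ?nnegrE ?vnorm_ge0//; last first.
      by apply: sumr_ge0 => i _; exact: l2norm_ge0.
    rewrite (vB _ (fun i => w i - w' i))//.
    apply: le_trans (_ : \sum_i l2norm (w i - w' i) ^+ 2 <= _).
      by apply: ler_sum => i _; rewrite l2norm_sqr; exact: sum_le_sqnorm.
    have h0 i : 0 <= l2norm (w i - w' i) by exact: l2norm_ge0.
    elim: (index_enum 'I_n) => [|i r IH]; first by rewrite !big_nil expr0n.
    rewrite !big_cons sqrrD -addrA lerD2l; apply: le_trans IH _.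
    by rewrite lerDr mulrn_wge0// mulr_ge0// sumr_ge0.
  apply: le_trans (_ : S * (e / (S + 1)) <= _); last first.
    rewrite mulrCA ler_piMr//; first exact: ltW.
    by rewrite ler_pdivrMr ?mul1r ?lerDl// ltr_wpDl.
  rewrite mulr_suml; apply: ler_sum => i _; rewrite mulr_suml /w /w' -sumrB.
  apply: le_trans (_ : \sum_j l2norm (T i j (x j) - T i j (cutoff Q' (x j))) <= _).
    exact: l2norm_sum.
  apply: ler_sum => j _; rewrite -linear_opB//.
  have [Bij0 HBij] := HB (i, j).
  by apply: le_trans (HBij _) _; rewrite ler_wpM2l.
rewrite -(ger0_norm M0) -sqrtr_sqr; apply: ler_wsqrtr.
apply/ler_addgt0Pr => e e0.
have d0 : 0 < e / (n%:R + 1) by rewrite divr_gt0// ltr_wpDl.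
have [Q [uQ _] HQ] := @uniq_cover 'I_n (index_enum 'I_n)
  (fun i F => `|sqnorm (w i) - \sum_(p <- F) normc (w i p) ^+ 2| <= e / (n%:R + 1))
  (fun i => sqnorm_approx (w i) d0) [::].
apply: le_trans (_ : \sum_i (\sum_(p <- Q) normc (w i p) ^+ 2 + e / (n%:R + 1)) <= _).
  apply: ler_sum => i _; rewrite -lerBlDl; apply: le_trans (ler_norm _) _.
  by apply: HQ => //; apply: List_inP; exact: mem_index_enum.
rewrite big_split /=; apply: lerD; first exact: wQ.
rewrite sumr_const card_ord -[X in X <= _]mulr_natl mulrCA ler_piMr//; first exact: ltW.
by rewrite ler_pdivrMr ?mul1r ?lerDl// ltr_wpDl.
Qed.

End operators.

(** * Entries of bounded operators, and operators given by a kernel *)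

Section bounded_operators.
Context (R : realType) (I : choiceType).
Local Notation C := R[i].
Local Notation op := (op R I).
Implicit Types (T : op) (x y : l2 R I) (F : seq I).

Lemma kernel_le_opnorm T (M : R) F : bounded_op T -> (opnorm T <= M%:E)%E ->
  uniq F -> kernel_le F (entry T) M.
Proof.
move=> bT TM uF.
have /kernel_le_blocks/(_ TM) H : forall i j, linear_op ((const_mx T : 'M[op]_1) i j).
  by move=> i j; rewrite mxE; exact: bounded_op_linear.
have uF' : uniq (map (fun p : I => (ord0 : 'I_1, p)) F).
  by rewrite map_inj_uniq// => p q [].
have h : kernel_le F (fun p q => blocks (const_mx T : 'M[op]_1) (ord0, p) (ord0, q)) M.
  by apply: (kernel_le_map uF) (H _ uF') => p q _ _ [].
by apply: eq_kernel_le h => p q; rewrite /blocks mxE.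
Qed.

Lemma opnorm_le T (M : R) : 0 <= M -> bounded_op T ->
  (forall F, uniq F -> kernel_le F (entry T) M) -> (opnorm T <= M%:E)%E.
Proof.
move=> M0 bT TM; apply: (opmx_norm_le M0) => [i j|F uF]; first by rewrite mxE.
have E : F = map (fun p : I => (ord0 : 'I_1, p)) (map snd F).
  rewrite -map_comp -[LHS]map_id; apply: eq_map => -[i p] /=.
  by rewrite (ord1 i).
have uF' : uniq (map snd F).
  by move: uF; rewrite {1}E => /map_uniq.
rewrite E => a b; rewrite !vnorm_map big_map.
under eq_bigr do rewrite big_map.
have := TM _ uF' (fun p => a (ord0, p)) (fun p => b (ord0, p)).
rewrite !vnorm_map => h; apply: le_trans h.
rewrite le_eqVlt; apply/orP; left; apply/eqP; congr normc.
by apply: eq_bigr => p _; apply: eq_bigr => q _; rewrite /blocks mxE.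
Qed.

Lemma opnorm_le_l2norm T (M : R) : 0 <= M ->
  (forall x, l2norm (T x) <= M * l2norm x) -> (opnorm T <= M%:E)%E.
Proof.
move=> M0 TM; apply: ge_ereal_sup => _ [x /= x1 <-]; rewrite !big_ord1 mxE lee_fin.
apply: le_trans (TM _) _; rewrite ler_piMr// /l2norm -sqrtr1.
by apply: ler_wsqrtr; rewrite big_ord1 in x1.
Qed.

Lemma opnorm_ge0 T : (0 <= opnorm T)%E.
Proof.
have := @mxop_norm_ge R I 1 (const_mx T) (fun=> 0).
rewrite big_ord1 -l2norm_sqr l2norm0 expr0n => /(_ ler01).
by apply: le_trans; rewrite lee_fin sqrtr_ge0.
Qed.

Lemma bounded_op_kernel T : bounded_op T ->
  exists2 M : R, 0 <= M & forall F, uniq F -> kernel_le F (entry T) M.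
Proof.
move=> bT; exists (fine (opnorm T)); first by rewrite fine_ge0// opnorm_ge0.
move=> F; apply: kernel_le_opnorm => //; rewrite fineK// ge0_fin_numE ?opnorm_ge0//.
by case: bT.
Qed.

Lemma bounded_op_eq T T' : bounded_op T -> bounded_op T' ->
  (forall p q, entry T p q = entry T' p q) -> T = T'.
Proof.
move=> /bounded_opP [lT [M M0 TM]] /bounded_opP [lT' [M' M'0 TM']] TT'.
apply/funext => x; apply/eqP; rewrite -subr_eq0; apply/eqP/l2norm_eq0/le_anti.
rewrite l2norm_ge0 andbT; apply/ler_addgt0Pr => e e0; rewrite add0r.
have MM0 : 0 <= M + M' by rewrite addr_ge0.
have d0 : 0 < e / (M + M' + 1) by rewrite divr_gt0// ltr_wpDl.
have [F uF HF] := l2norm_sub_cutoff x d0.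
have {}HF := HF F uF (fun _ => id).
have E : T (cutoff F x) = T' (cutoff F x).
  rewrite /cutoff !linear_op_sum//; apply: eq_bigr => q _.
  rewrite !linear_opZ//; congr (_ *: _); apply: l2P => p.
  by rewrite -!entryE TT'.
have -> : T x - T' x = T (x - cutoff F x) - T' (x - cutoff F x).
  rewrite (linear_opB _ _ lT) (linear_opB _ _ lT') E.
  by rewrite opprB addrA subrK.
apply: le_trans (l2normD _ _) _; rewrite l2normN.
apply: le_trans (lerD (TM _) (TM' _)) _; rewrite -mulrDl.
apply: le_trans (ler_wpM2l MM0 HF) _.
rewrite mulrCA ler_piMr//; first exact: ltW.
by rewrite ler_pdivrMr ?mul1r ?lerDl// ltr_wpDl.
Qed.

Lemma kernel_le_row F (k : I -> I -> C) (M : R) p : uniq F -> p \in F ->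
  kernel_le F k M -> vnorm F (k p) <= M.
Proof.
move=> uF pF kM.
have M0 : 0 <= M by apply: le_trans (kernel_le_entry uF pF pF kM); exact: normc_ge0.
have := kM (fun q => (k p q)^*) (fun q => (q == p)%:R).
rewrite (bigD1_seq p)//= [X in _ + X]big1 ?addr0; last first.
  by move=> q /negPf ->; rewrite big1// => z _; rewrite mulr0.
have -> : \sum_(y <- F) k p y * (k p y)^* * (p == p)%:R = (vnorm F (k p) ^+ 2)%:C.
  rewrite vnorm_sqr raddf_sum; apply: eq_bigr => q _.
  by rewrite eqxx mulr1 mulc_conj.
have -> : vnorm F (fun q => (q == p)%:R : C) = 1.
  rewrite /vnorm (bigD1_seq p)//= eqxx normc1E expr1n big1 ?addr0 ?sqrtr1//.
  by move=> w /negPf ->; rewrite normc0E expr0n.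
rewrite vnorm_conj mulr1 normc_real ger0_norm ?sqr_ge0// expr2.
have [c0 _|c0] := leP (vnorm F (k p)) 0; last by rewrite ler_pM2r.
exact: le_trans c0 _.
Qed.

Lemma kernel_abs_summable (k : I -> I -> C) (M : R) x p :
  (forall F, uniq F -> kernel_le F k M) -> abs_summable (fun q => k p q * x q).
Proof.
move=> kM; apply/abs_summableP; exists (M * l2norm x) => F uF.
set U := undup (p :: F).
have uU : uniq U by exact: undup_uniq.
have pU : p \in U by rewrite mem_undup mem_head.
have sU : {subset F <= U} by move=> z zF; rewrite mem_undup inE zF orbT.
apply: le_trans (_ : \sum_(q <- U) normc (k p q) * normc (x q) <= _).
  rewrite -(big_uniq_mem _ uF uU sU); apply: ler_sum => q _.
  by case: ifP => _; rewrite ?normcM// mulr_ge0 ?normc_ge0.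
apply: le_trans (cauchy_schwarz _ _ _) _; apply: ler_pM; rewrite ?vnorm_ge0//.
  exact: kernel_le_row pU (kM _ uU).
exact: vnorm_le_l2norm.
Qed.

(** When the finite submatrices of [k] are uniformly bounded, the sums converge absolutely and the
    result is square summable, so the defaults of [csum] and [tol2] are not reached. *)
Definition kernel_op (k : I -> I -> C) : op :=
  fun x => tol2 (fun p => csum (fun q => k p q * x q)).

Section kernel_op.
Variables (k : I -> I -> C) (M : R).
Hypotheses (M0 : 0 <= M) (kM : forall F, uniq F -> kernel_le F k M).

Let kernel_op_vnorm x F : uniq F ->
  vnorm F (fun p => csum (fun q => k p q * x q)) <= M * l2norm x.
Proof.
move=> uF; apply/ler_addgt0Pr => e e0.
have d0 : 0 < e / ((size F)%:R + 1) by rewrite divr_gt0// ltr_wpDl.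
have [Q [uQ sQ] HQ] := @uniq_cover I I F
  (fun p F' => normc (csum (fun q => k p q * x q) -
     \sum_(q <- F') k p q * x q) <= e / ((size F)%:R + 1))
  (fun p => csumP (kernel_abs_summable x p kM) d0) F.
have -> : (fun p => csum (fun q => k p q * x q)) =
    (fun p => \sum_(q <- Q) k p q * x q +
      (csum (fun q => k p q * x q) - \sum_(q <- Q) k p q * x q)).
  by apply/funext => p; ring.
apply: le_trans (vnormD _ _ _) _; apply: lerD.
  apply: le_trans (_ : vnorm Q (fun p => \sum_(q <- Q) k p q * x q) <= _).
    apply: ler_wsqrtr; rewrite -(big_uniq_mem _ uF uQ sQ); apply: ler_sum => p _.
    by case: ifP => // _; exact: sqr_ge0.
  apply: le_trans (kernel_le_vnorm _ M0 (kM uQ)) _.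
  by rewrite ler_wpM2l// vnorm_le_l2norm.
apply: le_trans (vnorm_le_sum _ _) _.
apply: le_trans (_ : \sum_(p <- F) e / ((size F)%:R + 1) <= _).
  rewrite !big_seq; apply: ler_sum => p pF.
  by apply: HQ => //; exact: List_inP.
rewrite big_const_seq count_predT iter_addr_0 -[X in X <= _]mulr_natl mulrCA ler_piMr//.
  exact: ltW.
by rewrite ler_pdivrMr ?mul1r ?lerDl// ltr_wpDl.
Qed.

Lemma kernel_opE x p : kernel_op k x p = csum (fun q => k p q * x q).
Proof.
rewrite /kernel_op tol2E//; apply/sq_summableP; exists ((M * l2norm x) ^+ 2) => F uF.
rewrite -vnorm_sqr ler_pXn2r ?nnegrE ?vnorm_ge0 ?mulr_ge0 ?l2norm_ge0//.
exact: kernel_op_vnorm.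
Qed.

Lemma bounded_kernel_op : bounded_op (kernel_op k).
Proof.
apply/bounded_opP; split.
  move=> c x y _ _; apply: l2P => p; rewrite l2_addE l2_scaleE !kernel_opE.
  rewrite -csum_lin; try exact: (kernel_abs_summable _ _ kM).
  by congr csum; apply/funext => q; rewrite l2_addE l2_scaleE; ring.
exists M => // x; apply: l2norm_le => [|F uF]; first by rewrite mulr_ge0 ?l2norm_ge0.
apply: le_trans (kernel_op_vnorm x uF); rewrite le_eqVlt; apply/orP; left; apply/eqP.
by apply: eq_vnorm => p _; rewrite kernel_opE.
Qed.

Lemma entry_kernel_op p q : entry (kernel_op k) p q = k p q.
Proof.
rewrite entryE kernel_opE (@csum1 _ _ _ q) => [|r /negPf rq]; rewrite basisE.
  by rewrite eqxx mulr1.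
by rewrite rq mulr0.
Qed.

End kernel_op.

Lemma bounded_op_lin (c : C) T T' : bounded_op T -> bounded_op T' ->
  bounded_op (c *: T + T').
Proof.
move=> /bounded_opP [lT [M M0 TM]] /bounded_opP [lT' [M' M'0 TM']].
apply/bounded_opP; split.
  move=> d x y _ _; have := linear_opP d x y lT; have := linear_opP d x y lT'.
  move=> E E'; change (c *: T (d *: x + y) + T' (d *: x + y) =
    d *: (c *: T x + T' x) + (c *: T y + T' y)).
  by rewrite E E' !scalerDr !scalerA [d * c]mulrC; rewrite -!addrA; congr (_ + _);
    rewrite addrCA.
exists (normc c * M + M') => [|x]; first by rewrite addr_ge0 ?mulr_ge0 ?normc_ge0.
change (l2norm (c *: T x + T' x) <= (normc c * M + M') * l2norm x).
have := l2normD (c *: T x) (T' x); rewrite l2normZ => /le_trans; apply.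
by rewrite mulrDl -mulrA lerD ?ler_wpM2l ?normc_ge0.
Qed.

Lemma entry_lin (c : C) T T' p q :
  entry (c *: T + T') p q = c * entry T p q + entry T' p q.
Proof. by rewrite !entryE. Qed.

Lemma entryB T T' p q : entry (T - T') p q = entry T p q - entry T' p q.
Proof. by rewrite !entryE. Qed.

Lemma bounded_opB T T' : bounded_op T -> bounded_op T' -> bounded_op (T - T').
Proof.
by move=> bT bT'; rewrite addrC -scaleN1r; exact: bounded_op_lin.
Qed.

Lemma bounded_op0 : bounded_op (0 : op).
Proof.
apply/bounded_opP; split=> [c x y _ _|]; first by rewrite [RHS]addr0 scaler0.
by exists 0 => // x; rewrite mul0r l2norm0.
Qed.

Lemma bounded_opZ (c : C) T : bounded_op T -> bounded_op (c *: T).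
Proof.
by move=> bT; rewrite -[_ *: _]addr0; exact: bounded_op_lin bT bounded_op0.
Qed.

Lemma entryZ (c : C) T p q : entry (c *: T) p q = c * entry T p q.
Proof. by rewrite !entryE. Qed.

End bounded_operators.

(** * Schur multipliers *)

Section schur.
Context (R : realType).
Local Notation C := R[i].

(** Here phi(p, q) multiplies the entry (p, q), whereas [schur_map] uses phi(q, p); the two
    conventions meet in [Nmap u q p] being [toeplitz u p q]. *)
Definition schur_le (I : eqType) (phi : I -> I -> C) (M : R) : Prop :=
  forall (F : seq I) (k : I -> I -> C), uniq F -> kernel_le F k 1 ->
    kernel_le F (fun p q => phi p q * k p q) M.

Section theory.
Variable I : eqType.
Implicit Types (phi psi : I -> I -> C) (F : seq I) (k : I -> I -> C).

Lemma schur_leZ phi M F k K : 0 <= K -> uniq F -> schur_le phi M ->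
  kernel_le F k K -> kernel_le F (fun p q => phi p q * k p q) (M * K).
Proof.
move=> K0 uF phiM kK; have [K00|Kn0] := eqVneq K 0.
  rewrite K00 mulr0; apply: eq_in_kernel_le (kernel_le0 F) => x y xF yF.
  have /eqP := kernel_le_entry uF xF yF kK; rewrite K00 => k0.
  have -> : k x y = 0 by apply/eqP; rewrite -normc_eq0 eq_le normc_ge0 andbT; apply/eqP.
  by rewrite mulr0.
have Kp : 0 < K by rewrite lt0r Kn0.
have nK : normc K%:C = K by rewrite normc_real ger0_norm.
have := kernel_leZ (K%:C)^-1 kK; rewrite normcV nK mulVf// => /(phiM _ _ uF).
move=> /(kernel_leZ K%:C); rewrite nK mulrC; apply: eq_kernel_le => x y.
by rewrite mulrCA mulVKf// -normc_eq0 nK.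
Qed.

Lemma schur_le_ge0 phi M (i0 : I) : schur_le phi M -> 0 <= M.
Proof.
move=> phiM; have /(phiM [:: i0] (fun _ _ => 0) isT) : kernel_le [:: i0] (fun _ _ : I => 0 : C) 1.
  by apply: kernel_le_trans (kernel_le0 _).
move=> h; have := kernel_le_entry (isT : uniq [:: i0]) (mem_head _ _) (mem_head _ _) h.
by rewrite mulr0 normc0E.
Qed.

Lemma eq_schur_le phi psi M : (forall p q, phi p q = psi p q) ->
  schur_le phi M -> schur_le psi M.
Proof.
move=> E phiM F k uF kM; apply: eq_kernel_le (phiM F k uF kM) => x y.
by rewrite E.
Qed.

Lemma schur_le_trans phi M M' : M <= M' -> schur_le phi M -> schur_le phi M'.
Proof.
by move=> MM' phiM F k uF kM; apply: kernel_le_trans MM' _; exact: phiM.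
Qed.

Lemma schur_leB phi psi M M' : schur_le phi M -> schur_le psi M' ->
  schur_le (fun p q => phi p q - psi p q) (M + M').
Proof.
move=> phiM psiM F k uF kM.
apply: eq_kernel_le (kernel_leB (phiM F k uF kM) (psiM F k uF kM)) => x y.
by rewrite mulrBl.
Qed.

Lemma schur_leD phi psi M M' : schur_le phi M -> schur_le psi M' ->
  schur_le (fun p q => phi p q + psi p q) (M + M').
Proof.
move=> phiM psiM F k uF kM.
apply: eq_kernel_le (kernel_leD (phiM F k uF kM) (psiM F k uF kM)) => x y.
by rewrite mulrDl.
Qed.

Lemma schur_le_entry phi M p q : schur_le phi M -> normc (phi p q) <= M.
Proof.
move=> phiM; pose F := undup [:: p; q].
have uF : uniq F by exact: undup_uniq.
have pF : p \in F by rewrite mem_undup mem_head.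
have qF : q \in F by rewrite mem_undup !inE eqxx orbT.
pose k (x y : I) : C := if (x == p) && (y == q) then 1 else 0.
have k1 : kernel_le F k 1.
  move=> a b; rewrite mul1r.
  have -> : \sum_(x <- F) \sum_(y <- F) k x y * a y * b x = a q * b p.
    rewrite (bigD1_seq p)//= (bigD1_seq q)//= /k !eqxx mul1r.
    rewrite big1 ?addr0 => [|y /negPf ->]; last by rewrite !mul0r.
    by rewrite big1 ?addr0// => x /negPf ->; rewrite big1// => y _; rewrite !mul0r.
  rewrite normcM; apply: ler_pM; rewrite ?normc_ge0// -[leLHS]ger0_norm ?normc_ge0//;
    rewrite -sqrtr_sqr; apply: ler_wsqrtr.
    by rewrite (bigD1_seq q)//= lerDl sumr_ge0// => *; exact: sqr_ge0.
  by rewrite (bigD1_seq p)//= lerDl sumr_ge0// => *; exact: sqr_ge0.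
have := kernel_le_entry uF pF qF (phiM F k uF k1).
by rewrite /k !eqxx mulr1.
Qed.

(** Smith's trick: test vectors of the amplified form are normalised on each
    fibre of [pi], which compresses the amplified kernel to a scalar one of no
    larger norm. Hence norm and cb norm of a Schur multiplier coincide. *)
Lemma schur_le_amplify (A : eqType) (pi : A -> I) phi M (F : seq A)
    (k : A -> A -> C) K :
  0 <= K -> uniq F -> schur_le phi M -> kernel_le F k K ->
  kernel_le F (fun x y => phi (pi x) (pi y) * k x y) (M * K).
Proof.
move=> K0 uF phiM kK a b.
pose F' := undup (map pi F).
pose N (c : A -> C) g : C := (vnorm [seq x <- F | pi x == g] c)%:C.
pose u (c : A -> C) x : C := c x / N c (pi x).
have NE c : vnorm F' (N c) = vnorm F c.
  rewrite -[RHS]ger0_norm ?vnorm_ge0// -sqrtr_sqr -(vnorm_fibers pi).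
  congr Num.sqrt; apply: eq_bigr => g _.
  by rewrite normc_real ger0_norm ?vnorm_ge0.
(* A vanishing fibre norm forces [c] to vanish on the fibre, so the division by 0 in [u] is
   harmless. *)
have uE c x : x \in F -> u c x * N c (pi x) = c x.
  move=> xF; have [N0|N0] := eqVneq (N c (pi x)) 0; last by rewrite divfK.
  rewrite N0 mulr0; apply/esym.
  apply: (@vnorm_pred0 _ _ [seq y <- F | pi y == pi x]); last by rewrite mem_filter eqxx.
  by move: N0 => /eqP; rewrite /N -normc_eq0 normc_real normr_eq0 => /eqP.
pose T g h := \sum_(x <- F | pi x == g) \sum_(y <- F | pi y == h) k x y * u a y * u b x.
have TE (s : I -> I -> C) c d :
    \sum_(g <- F') \sum_(h <- F') s g h * T g h * c h * d g =
    \sum_(x <- F) \sum_(y <- F)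
      s (pi x) (pi y) * k x y * (u a y * c (pi y)) * (u b x * d (pi x)).
  rewrite -(sum_fibers pi) -/F'; apply: eq_bigr => g _.
  transitivity (\sum_(h <- F') \sum_(x <- F | pi x == g) \sum_(y <- F | pi y == h)
     s (pi x) (pi y) * k x y * (u a y * c (pi y)) * (u b x * d (pi x))).
    apply: eq_bigr => h _; rewrite /T mulr_sumr !mulr_suml; apply: eq_bigr => x /eqP xg.
    rewrite mulr_sumr !mulr_suml; apply: eq_bigr => y /eqP yh.
    by rewrite xg yh; ring.
  rewrite exchange_big; apply: eq_bigr => x _ /=.
  by rewrite sum_fibers.
have uN (w : A -> C) c : vnorm F (fun x => u w x * c (pi x)) <= vnorm F' c.
  apply: ler_wsqrtr; rewrite -(sum_fibers pi) -/F'; apply: ler_sum => g _.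
  apply: le_trans (_ : (normc (c g) / normc (N w g)) ^+ 2 *
    \sum_(x <- F | pi x == g) normc (w x) ^+ 2 <= _).
    rewrite mulr_sumr; apply: ler_sum => x /eqP xg.
    by rewrite /u xg !normcM normcV -exprMn le_eqVlt; apply/orP; left; apply/eqP; ring.
  rewrite -big_filter -vnorm_sqr.
  have -> : vnorm [seq x <- F | pi x == g] w = normc (N w g).
    by rewrite normc_real ger0_norm ?vnorm_ge0.
  have [->|N0] := eqVneq (normc (N w g)) 0.
    by rewrite [X in _ * X]expr0n mulr0 sqr_ge0.
  by rewrite -exprMn divfK.
have TK : kernel_le F' T K.
  move=> c d; have := TE (fun _ _ => 1) c d.
  under eq_bigr do under eq_bigr do rewrite mul1r.
  move=> ->; under eq_bigr do under eq_bigr do rewrite mul1r.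
  apply: le_trans (kK _ _) _; rewrite -!mulrA ler_wpM2l//.
  by apply: ler_pM; rewrite ?vnorm_ge0.
have := schur_leZ K0 (undup_uniq _) phiM TK (N a) (N b).
rewrite TE !NE.
suff -> : \sum_(x <- F) \sum_(y <- F) phi (pi x) (pi y) * k x y *
    (u a y * N a (pi y)) * (u b x * N b (pi x)) =
  \sum_(x <- F) \sum_(y <- F) phi (pi x) (pi y) * k x y * a y * b x by [].
by apply: eq_big_seq => x xF; apply: eq_big_seq => y yF; rewrite !uE.
Qed.

End theory.

End schur.

(** * Toeplitz kernels and coefficients of the regular representation *)

Section group_kernels.
Context (R : realType) (G : groupType).
Local Notation C := R[i].
Implicit Types (u f : G -> C) (x y : l2 R G) (F : seq G).

Definition toeplitz u (p q : G) : C := u (p * q^-1)%g.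

Lemma sq_summable_shift x (s : G) : sq_summable (fun t => x (s^-1 * t)%g).
Proof.
apply/sq_summableP; exists (sqnorm x) => F uF.
have := @sum_le_sqnorm _ _ x (map (fun t => s^-1 * t)%g F).
by rewrite map_inj_uniq ?big_map; [apply|exact: mulgI].
Qed.

Lemma lregE (s : G) x t : lreg s x t = x (s^-1 * t)%g.
Proof. by rewrite /lreg tol2E//; exact: sq_summable_shift. Qed.

Lemma l2norm_lreg_le (s : G) x : l2norm (lreg s x) <= l2norm x.
Proof.
apply: l2norm_le => [|F uF]; first exact: l2norm_ge0.
have := @vnorm_le_l2norm _ _ x (map (fun t => s^-1 * t)%g F).
rewrite map_inj_uniq ?vnorm_map; last exact: mulgI.
move=> /(_ uF); apply: le_trans; rewrite le_eqVlt; apply/orP; left; apply/eqP.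
by apply: eq_vnorm => p _; rewrite lregE.
Qed.

Lemma bounded_lreg (s : G) : bounded_op (lreg s : op R G).
Proof.
apply/bounded_opP; split.
  move=> c x y _ _; apply: l2P => p.
  by rewrite l2_addE l2_scaleE !lregE l2_addE l2_scaleE.
by exists 1 => // x; rewrite mul1r l2norm_lreg_le.
Qed.

Lemma entry_lreg (s p q : G) : entry (lreg s : op R G) p q = (s == p * q^-1)%g%:R.
Proof.
rewrite entryE lregE basisE; congr (_%:R); congr nat_of_bool.
apply/eqP/eqP => [<-|->]; last by rewrite invgF mulgVK.
by apply/esym/eqP; rewrite divg_eq mulVKg.
Qed.

(** Shifting the summation variable by [p] separates [p] from [q]: each r contributes a rank one
    kernel. *)
Lemma coeffE x y (p q : G) :
  coeff x y (p * q^-1)%g = csum (fun r => x (q * r)%g * (y (p * r)%g)^*).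
Proof.
rewrite /coeff /dot; set f := fun i => _.
rewrite -(@csum_reindex _ _ (fun r => p * r)%g (fun r => p^-1 * r)%g f).
- by congr csum; apply/funext => r; rewrite /f /= lregE invgF divgKA.
- exact: mulKg.
- exact: mulVKg.
Qed.

(** By [coeffE] the Schur product is a sum over r of copies of [k] multiplied on both sides by the
    diagonals x(q r) and the conjugate of y(p r). Cauchy-Schwarz in r bounds it, since p -> p r and
    r -> p r only permute the coordinates; the sum is truncated to a finite [Q] and [kernel_le_lim]
    removes the truncation. *)
Lemma schur_le_coeff x y : schur_le (toeplitz (coeff x y)) (l2norm x * l2norm y).
Proof.
move=> F k uF k1; apply: kernel_le_lim => e e0.
pose f (p q r : G) := x (q * r)%g * (y (p * r)%g)^*.
have fs p q : abs_summable (f p q).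
  have -> : f p q = (fun r => lreg q^-1%g x r * (lreg p^-1%g y r)^*).
    by apply/funext => r; rewrite !lregE !invgK.
  exact: dot_abs_summable.
have [Q [uQ _] HQ] := @uniq_cover G (G * G)%type [seq (p, q) | p <- F, q <- F]
  (fun pq Q => normc (csum (f pq.1 pq.2) - \sum_(r <- Q) f pq.1 pq.2 r) <= e)
  (fun pq => csumP (fs pq.1 pq.2) e0) [::].
exists (fun p q => (\sum_(r <- Q) f p q r) * k p q); last first.
  move=> p q pF qF; rewrite -mulrBl normcM -[leRHS]mulr1; apply: ler_pM;
    rewrite ?normc_ge0//; last exact: kernel_le_entry k1.
  rewrite /toeplitz coeffE; apply: (HQ Q uQ (fun _ => id) (p, q)).
  by apply: List_inP; apply/allpairsP; exists (p, q).
move=> a b.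
have -> : \sum_(p <- F) \sum_(q <- F) (\sum_(r <- Q) f p q r) * k p q * a q * b p =
  \sum_(r <- Q) \sum_(p <- F) \sum_(q <- F)
    k p q * (x (q * r)%g * a q) * ((y (p * r)%g)^* * b p).
  rewrite [RHS]exchange_big; apply: eq_bigr => p _ /=.
  rewrite [RHS]exchange_big; apply: eq_bigr => q _ /=.
  by rewrite !mulr_suml; apply: eq_bigr => r _; rewrite /f; ring.
pose V (z : l2 R G) (c : G -> C) r : C := (vnorm F (fun p => z (p * r)%g * c p))%:C.
have VE z c : vnorm Q (V z c) <= l2norm z * vnorm F c.
  rewrite -(@ler_pXn2r _ 2) ?nnegrE ?mulr_ge0 ?vnorm_ge0 ?l2norm_ge0//.
  rewrite exprMn l2norm_sqr !vnorm_sqr.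
  under eq_bigr do rewrite normc_real ger0_norm ?vnorm_ge0// vnorm_sqr.
  rewrite exchange_big mulr_sumr; apply: ler_sum => p _ /=.
  under eq_bigr do rewrite normcM exprMn.
  rewrite -mulr_suml ler_wpM2r ?sqr_ge0//.
  have := @sum_le_sqnorm _ _ z (map (fun t => p * t)%g Q).
  by rewrite map_inj_uniq ?big_map; [apply|exact: mulgI].
apply: le_trans (normc_sum _ _) _.
apply: le_trans (_ : \sum_(r <- Q) normc (V x a r) * normc (V y b r) <= _).
  apply: ler_sum => r _; apply: le_trans (k1 _ _) _.
  rewrite mul1r !normc_real !ger0_norm ?vnorm_ge0//.
  apply: ler_pM; rewrite ?vnorm_ge0// le_eqVlt; apply/orP; left; apply/eqP.
  by congr Num.sqrt; apply: eq_bigr => p _; rewrite !normcM normc_conj.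
apply: le_trans (cauchy_schwarz _ _ _) _.
apply: le_trans (ler_pM (vnorm_ge0 _ _) (vnorm_ge0 _ _) (VE _ _) (VE _ _)) _.
by rewrite mulrACA mulrA.
Qed.

End group_kernels.

Lemma kernel_le_unmap (R : realType) (A B : Type) (h : A -> B) (F : seq A)
    (k : B -> B -> R[i]) (M : R) :
  kernel_le F (fun x y => k (h x) (h y)) M -> kernel_le (map h F) k M.
Proof.
move=> kM a b; rewrite !vnorm_map big_map.
by under eq_bigr do rewrite big_map; exact: (kM (a \o h) (b \o h)).
Qed.

Section schur_op.
Context (R : realType) (I : choiceType).
Local Notation C := R[i].
Local Notation op := (op R I).
Implicit Types (T : op) (phi : I -> I -> C).

Definition schur_op phi T : op := kernel_op (fun p q => phi p q * entry T p q).

Lemma schur_opP phi M T : schur_le phi M -> 0 <= M -> bounded_op T ->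
  bounded_op (schur_op phi T) /\
  forall p q, entry (schur_op phi T) p q = phi p q * entry T p q.
Proof.
move=> phiM M0 /bounded_op_kernel [K K0 TK].
have H F : uniq F -> kernel_le F (fun p q => phi p q * entry T p q) (M * K).
  by move=> uF; apply: schur_leZ => //; exact: TK.
by split=> [|p q]; [apply: (bounded_kernel_op _ H)|rewrite (entry_kernel_op _ H)];
  rewrite // mulr_ge0.
Qed.

(** Amplification along the second projection of the pairs (i, p). [Y] is any matrix with the
    multiplied entries, so that one bound serves [Smap], [schur_map] and their differences. *)
Lemma opmx_norm_schur (phi : I -> I -> C) (M : R) n (X Y : 'M[op]_n) :
  schur_le phi M -> 0 <= M ->
  (forall i j, bounded_op (X i j)) -> (forall i j, bounded_op (Y i j)) ->
  (forall i j p q, entry (Y i j) p q = phi p q * entry (X i j) p q) ->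
  (opmx_norm X <= 1%:E)%E -> (opmx_norm Y <= M%:E)%E.
Proof.
move=> phiM M0 bX bY XY X1; apply: opmx_norm_le => // F uF.
have lX i j := bounded_op_linear (bX i j).
have := @schur_le_amplify _ _ _ (fun x : 'I_n * I => x.2) _ _ _ _ _ ler01 uF phiM
  (kernel_le_blocks lX X1 uF).
by rewrite mulr1; apply: eq_kernel_le => x y; rewrite /blocks XY.
Qed.

End schur_op.

(** * Multipliers of the reduced group algebra *)

Section reduced.
Context (R : realType) (G : groupType).
Local Notation C := R[i].
Local Notation op := (op R G).
Local Notation Cr := (Cr R G).
Implicit Types (u w f : G -> C) (T : op) (F : seq G).

Lemma kernel_le_lreg (s : G) F : uniq F ->
  kernel_le F (fun p q => (s == p * q^-1)%g%:R : C) 1.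
Proof.
move=> uF.
have h : kernel_le F (entry (lreg s : op)) 1.
  apply: kernel_le_opnorm => //; first exact: bounded_lreg.
  by apply: opnorm_le_l2norm => // x; rewrite mul1r l2norm_lreg_le.
by apply: eq_kernel_le h => p q; rewrite entry_lreg.
Qed.

(** Only finitely many quotients p q^-1 occur over [F], so the kernel is a finite combination of the
    contractive matrices of translations. *)
Lemma kernel_le_toeplitz f (K : R) F :
  (forall F, uniq F -> \sum_(s <- F) normc (f s) <= K) ->
  uniq F -> kernel_le F (toeplitz f) K.
Proof.
move=> fK uF; pose S := undup [seq (p * q^-1)%g | p <- F, q <- F].
have := @kernel_le_sum _ _ _ S F (fun s p q => f s * (s == p * q^-1)%g%:R)
   (fun s => normc (f s) * 1) (fun s => kernel_leZ (f s) (kernel_le_lreg s uF)).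
under [X in kernel_le _ _ X]eq_bigr do rewrite mulr1.
move=> /(kernel_le_trans (fK S (undup_uniq _))).
apply: eq_in_kernel_le => p q pF qF.
have sS : (p * q^-1)%g \in S by rewrite mem_undup; apply/allpairsP; exists (p, q).
rewrite (bigD1_seq (p * q^-1)%g) ?undup_uniq//= eqxx mulr1 big1 ?addr0//.
by move=> s /negPf ->; rewrite mulr0.
Qed.

Lemma lreg_l1E f : lreg_l1 f = kernel_op (toeplitz f) :> op.
Proof.
apply/funext => x; congr tol2; apply/funext => p.
rewrite -(@csum_reindex _ _ (fun q => p * q^-1)%g (fun s => s^-1 * p)%g
  (fun s => f s * x (s^-1 * p)%g)).
- by congr csum; apply/funext => q; rewrite /toeplitz /= invgF mulgVK.
- by move=> q; rewrite invgF mulgVK.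
- by move=> s; apply/eqP; rewrite divg_eq mulVKg.
Qed.

Lemma lreg_l1P f : abs_summable f ->
  bounded_op (lreg_l1 f : op) /\
  forall p q, entry (lreg_l1 f : op) p q = toeplitz f p q.
Proof.
move=> /abs_summableP [K fK]; rewrite lreg_l1E.
have K0 : 0 <= K by have := fK [::] isT; rewrite big_nil.
have H F (uF : uniq F) := kernel_le_toeplitz fK uF.
by split=> [|p q]; [exact: (bounded_kernel_op K0 H)|exact: (entry_kernel_op K0 H)].
Qed.

Lemma bounded_lreg_l1 f : abs_summable f -> bounded_op (lreg_l1 f : op).
Proof. by case/lreg_l1P. Qed.

Lemma entry_lreg_l1 f p q : abs_summable f ->
  entry (lreg_l1 f : op) p q = f (p * q^-1)%g.
Proof. by case/lreg_l1P. Qed.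

Definition Cr_dom T := @mn_dom R Cr T.

Lemma Cr_domP T : Cr_dom T <-> bounded_op T /\ forall e : R, 0 < e ->
  exists2 f, abs_summable f &
    forall F, uniq F -> kernel_le F (fun p q => entry T p q - toeplitz f p q) e.
Proof.
split=> -[bT H]; split=> // e e0.
  have [f sf Tf] := H e e0; exists f => // F uF.
  have [bf ef] := lreg_l1P sf.
  have := kernel_le_opnorm (bounded_opB bT bf) (ltW Tf) uF.
  by apply: eq_kernel_le => p q; rewrite entryB ef.
(* Half of [e], because kernel bounds are not strict and the distance in [Cr] is. *)
have [f sf Tf] := H _ (divr_gt0 e0 (ltr0n R 2)); exists f => //.
have [bf ef] := lreg_l1P sf.
apply: (@le_lt_trans _ _ (e / 2)%:E); last first.
  by rewrite lte_fin ltr_pdivrMr// ltr_pMr// ltr1n.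
apply: opnorm_le; [by rewrite divr_ge0// ltW|exact: bounded_opB|].
move=> F /Tf; apply: eq_kernel_le => p q.
by rewrite (entryB T (lreg_l1 f)) ef.
Qed.

Lemma Cr_bounded T : Cr_dom T -> bounded_op T.
Proof. by case. Qed.

Lemma Cr_lreg_l1 f : abs_summable f -> Cr_dom (lreg_l1 f : op).
Proof.
move=> sf; have [bf ef] := lreg_l1P sf; apply/Cr_domP; split=> // e e0.
exists f => // F uF; apply: kernel_le_trans (ltW e0) _.
by apply: eq_kernel_le (kernel_le0 F) => p q; rewrite ef subrr.
Qed.

Lemma Cr_lin (c : C) T T' : Cr_dom T -> Cr_dom T' -> Cr_dom (c *: T + T').
Proof.
move=> /Cr_domP [bT HT] /Cr_domP [bT' HT']; apply/Cr_domP; split.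
  exact: bounded_op_lin.
move=> e e0; have c0 : 0 < normc c + 1 by rewrite ltr_wpDl ?normc_ge0.
have [f sf Hf] := HT _ (divr_gt0 (divr_gt0 e0 (ltr0n R 2)) c0).
have [g sg Hg] := HT' _ (divr_gt0 e0 (ltr0n R 2)).
exists (fun s => c * f s + g s); first exact: abs_summable_lin.
move=> F uF.
have h := kernel_leD (kernel_leZ c (Hf F uF)) (Hg F uF).
apply: (@kernel_le_trans _ _ _ _ _ e) (eq_kernel_le _ h).
  rewrite [leRHS](splitr e) lerD2r mulrA ler_pdivrMr// mulrC ler_wpM2l ?lerDl//.
  by rewrite divr_ge0// ltW.
by move=> p q; rewrite entry_lin /toeplitz; ring.
Qed.

Lemma Cr_0 : Cr_dom (0 : op).
Proof.
apply/Cr_domP; split=> [|e e0]; first exact: bounded_op0.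
exists (fun=> 0) => [|F uF].
  by apply/abs_summableP; exists 0 => F _; rewrite big1// => s _; rewrite normc0E.
apply: kernel_le_trans (ltW e0) _.
by apply: eq_kernel_le (kernel_le0 F) => p q; rewrite entryE subrr.
Qed.

Lemma Cr_Z (c : C) T : Cr_dom T -> Cr_dom (c *: T).
Proof. by move=> /(Cr_lin c)/(_ Cr_0); rewrite addr0. Qed.

Lemma Cr_lreg (s : G) : Cr_dom (lreg s : op).
Proof.
have sf : abs_summable (fun t : G => (s == t)%:R : C).
  by apply: (@abs_summable_fin _ _ _ [:: s]) => // t; rewrite inE eq_sym => /negPf ->.
have [bf ef] := lreg_l1P sf.
have E p q : entry (lreg s : op) p q =
    entry (lreg_l1 (fun t : G => (s == t)%:R : C) : op) p q.
  by rewrite ef entry_lreg.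
by rewrite (bounded_op_eq (bounded_lreg R s) bf E); exact: Cr_lreg_l1.
Qed.

(** [Psi] acts on the matrix entries of the elements of the reduced algebra as
    multiplication by [w]; this determines [Psi] on the algebra. *)
Definition implements w (Psi : Cr -> Cr) : Prop :=
  forall T, Cr_dom T -> bounded_op (Psi T) /\
    forall p q, entry (Psi T) p q = w (p * q^-1)%g * entry T p q.

Section twist.
Variables (F : seq G) (k : G -> G -> C).
Hypotheses (uF : uniq F) (k1 : kernel_le F k 1).
Let s := tnth (in_tuple F).

(** A map implementing w multiplies the block (i, j) by the scalar w(s_i s_j^-1), since this block
    is a multiple of one translation; the Schur product of [toeplitz w] with [k] can be read off the
    image. *)
Definition twist : 'M[op]_(size F) :=
  \matrix_(i, j) (k (s i) (s j) *: lreg (s i * (s j)^-1)%g).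

Let s_inj : injective s.
Proof.
move=> i j; rewrite /s !(tnth_nth 1%g) => /eqP; rewrite nth_uniq// => /eqP.
exact: val_inj.
Qed.

Lemma bounded_twist i j : bounded_op (twist i j).
Proof. by rewrite mxE; apply: bounded_opZ; exact: bounded_lreg. Qed.

Lemma Cr_twist i j : Cr_dom (twist i j).
Proof. by rewrite mxE; apply: Cr_Z; exact: Cr_lreg. Qed.

Lemma entry_twist i j p q :
  entry (twist i j) p q = k (s i) (s j) * (s i * (s j)^-1 == p * q^-1)%g%:R.
Proof. by rewrite mxE entryZ entry_lreg. Qed.

(** Conjugating [k (x) 1] by the diagonal of the [lreg (s i)]. *)
Lemma opmx_norm_twist : (opmx_norm twist <= 1%:E)%E.
Proof.
apply: opmx_norm_le => // [i j|L uL]; first exact: bounded_twist.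
(* The entry between (i, p) and (j, q) vanishes unless s_i^-1 p = s_j^-1 q, so the fibres of [pi]
   carry the diagonal blocks, each of them a submatrix of [k]. *)
pose pi (x : 'I_(size F) * G) := ((s x.1)^-1 * x.2)%g.
have := @kernel_le_fibers _ _ _ pi L (fun x y => k (s x.1) (s y.1)) 1 ler01.
move=> H; apply: eq_kernel_le (H _) => [x y|g].
  rewrite /blocks entry_twist /pi.
  have -> : ((s x.1)^-1 * x.2 == (s y.1)^-1 * y.2)%g =
    (s x.1 * (s y.1)^-1 == x.2 * y.2^-1)%g.
    apply/eqP/eqP => [h|/esym/eqP].
      by apply/esym/eqP; rewrite divg_eq -mulgA -h mulVKg.
    by rewrite divg_eq -mulgA => /eqP ->; rewrite mulKg.
  by case: ifP => _; rewrite ?mulr1 ?mulr0.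
have inj : {in [seq x <- L | pi x == g] &, injective (fun x => s x.1)}.
  move=> [i p] [j q]; rewrite !mem_filter /pi /= => /andP[/eqP pg _] /andP[/eqP qg _].
  move=> /s_inj ij; rewrite ij; congr pair; rewrite ij in pg.
  have := congr1 (fun z => s j * z)%g (etrans pg (esym qg)).
  by rewrite !mulVKg.
apply: (kernel_le_map _ inj); first exact: filter_uniq.
apply: kernel_le_sub uF _ k1; first by rewrite map_inj_in_uniq// filter_uniq.
by move=> _ /mapP [x _ ->]; exact: mem_tnth.
Qed.

(** The indices (i, s i) lie in the fibre of the unit in the block decomposition of [twist], where
    [k] sits unchanged. *)
Lemma kernel_le_untwist (phi : G -> G -> C) (M : R)
    (k' : 'I_(size F) * G -> 'I_(size F) * G -> C) :
  (forall L, uniq L -> kernel_le L k' M) ->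
  (forall i j, k' (i, s i) (j, s j) = phi (s i) (s j)) -> kernel_le F phi M.
Proof.
move=> k'M k'phi.
have EF : F = map s (enum 'I_(size F)).
  by have := map_tnth_enum (in_tuple F); rewrite /s => ->.
rewrite EF; apply: kernel_le_unmap.
have /k'M : uniq (map (fun i => (i, s i)) (enum 'I_(size F))).
  by rewrite map_inj_uniq ?enum_uniq// => i j [].
move=> /(kernel_le_map (enum_uniq _)) H.
by apply: eq_kernel_le (H _) => [i j|i j _ _ []].
Qed.

End twist.

Lemma cb_normP (Psi : Cr -> Cr) (M : R) n (X : 'M[op]_n) :
  (cb_norm Psi <= M%:E)%E -> (forall i j, Cr_dom (X i j)) ->
  (opmx_norm X <= 1%:E)%E -> (opmx_norm (map_mx Psi X) <= M%:E)%E.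
Proof.
move=> PM XC X1; apply: le_trans PM; apply: ereal_sup_ubound.
by exists n, X; split.
Qed.

(** [twist] is a contractive matrix over the reduced algebra, of the size of [F]; the cb norm is
    what controls its image for all [F] at once. *)
Lemma schur_le_cb_norm w (Psi : Cr -> Cr) (M : R) :
  implements w Psi -> (cb_norm Psi <= M%:E)%E -> schur_le (toeplitz w) M.
Proof.
move=> wPsi PM F k uF k1.
have := cb_normP PM (@Cr_twist F k) (opmx_norm_twist uF k1).
set Y := map_mx _ _ => Y1.
have lY i j : linear_op (Y i j).
  rewrite mxE; apply: bounded_op_linear.
  by case: (wPsi _ (Cr_twist k i j)).
have H L (uL : uniq L) := kernel_le_blocks lY Y1 uL.
apply: (kernel_le_untwist H) => i j; rewrite /blocks /= mxE.
have [_ ->] := wPsi _ (Cr_twist k i j).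
by rewrite entry_twist eqxx mulr1.
Qed.

Lemma cb_norm_schur_le w (Psi : Cr -> Cr) (M : R) : implements w Psi ->
  0 <= M -> schur_le (toeplitz w) M -> (cb_norm Psi <= M%:E)%E.
Proof.
move=> wPsi M0 wM; apply: ge_ereal_sup => _ [n [X [XC X1 ->]]].
apply: (opmx_norm_schur wM M0 (X := X)) => // [i j|i j|i j p q].
- exact: Cr_bounded (XC i j).
- by rewrite mxE; case: (wPsi _ (XC i j)).
- by rewrite mxE; case: (wPsi _ (XC i j)).
Qed.

Definition Smap_spec w (Psi : Cr -> Cr) : Prop := completely_bounded Psi /\
  forall f, abs_summable f -> Psi (lreg_l1 f) = lreg_l1 (w \* f).

Lemma opnorm0 : (opnorm (0 : op) <= 1%:E)%E.
Proof.
apply: (opnorm_le ler01 (bounded_op0 _ _)) => L uL.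
apply: kernel_le_trans ler01 _; apply: eq_kernel_le (kernel_le0 L) => x y.
by rewrite entryE.
Qed.

Lemma cb_norm_ge0 (Psi : Cr -> Cr) : (0 <= cb_norm Psi)%E.
Proof.
apply: le_trans (opnorm_ge0 (Psi 0)) _; apply: ereal_sup_ubound.
exists 1%N, (const_mx 0); split=> [i j||]; first by rewrite mxE; exact: Cr_0.
  exact: opnorm0.
by rewrite map_const_mx.
Qed.

(** Both sides are norm continuous in [T] and agree on the image of l^1. Continuity of the
    right-hand side needs [w] to be bounded, which follows by applying [Psi] to point masses. *)
Lemma Smap_spec_implements w (Psi : Cr -> Cr) : Smap_spec w Psi -> implements w Psi.
Proof.
move=> [[lP dP cP] Pf] T TC; split=> [|p q]; first exact/Cr_bounded/dP.
have P0 : Psi 0 = 0.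
  have := lP 1 0 0 Cr_0 Cr_0; rewrite scaler0 !scale1r addr0 => /eqP.
  by rewrite -subr_eq subrr => /eqP.
have PZ c S : Cr_dom S -> Psi (c *: S) = c *: Psi S.
  by move=> SC; have := lP c S 0 SC Cr_0; rewrite P0 !addr0.
have cb0 := cb_norm_ge0 Psi.
have [M M0 HM] : exists2 M : R, 0 <= M & (cb_norm Psi <= M%:E)%E.
  exists (fine (cb_norm Psi)); first exact: fine_ge0.
  by rewrite fineK// ge0_fin_numE.
(* The cb norm only speaks of the unit ball; rescaling by [t] extends the bound, at matrix level
   1. *)
have PM S (t : R) : 0 < t -> Cr_dom S -> (opnorm S <= t%:E)%E ->
    forall p q, normc (entry (Psi S) p q) <= M * t.
  move=> t0 SC St x y.
  have nt : normc t%:C = t by rewrite normc_real gtr0_norm.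
  have SC' : Cr_dom ((t%:C)^-1 *: S) by exact: Cr_Z.
  have : (opmx_norm (map_mx Psi (const_mx ((t%:C)^-1 *: S) : 'M[op]_1)) <= M%:E)%E.
    apply: (cb_normP HM) => [i j|]; first by rewrite mxE.
    apply: (opnorm_le ler01); first exact: Cr_bounded.
    move=> F uF; have := kernel_leZ (t%:C)^-1 (kernel_le_opnorm (Cr_bounded SC) St uF).
    rewrite normcV nt mulVf ?gt_eqF//.
    by apply: eq_kernel_le => a b; rewrite (entryZ _ S).
  rewrite map_const_mx PZ// => h.
  have bS := bounded_opZ (t%:C)^-1 (Cr_bounded (dP _ SC)).
  have uU := undup_uniq [:: x; y].
  have xU : x \in undup [:: x; y] by rewrite mem_undup mem_head.
  have yU : y \in undup [:: x; y] by rewrite mem_undup !inE eqxx orbT.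
  have := kernel_le_entry uU xU yU (kernel_le_opnorm bS h uU).
  rewrite (entryZ _ (Psi S)) normcM normcV nt.
  by rewrite ler_pdivrMl// mulrC.
have wM s : normc (w s) <= M.
  have sf : abs_summable (fun t : G => (s == t)%:R : C).
    by apply: (@abs_summable_fin _ _ _ [:: s]) => // t; rewrite inE eq_sym => /negPf ->.
  have swf : abs_summable (w \* (fun t : G => (s == t)%:R : C)).
    apply: (@abs_summable_fin _ _ _ [:: s]) => // t; rewrite inE eq_sym => /negPf /= ->.
    by rewrite mulr0.
  have s1 : (opnorm (lreg_l1 (fun t : G => (s == t)%:R : C) : op) <= 1%:E)%E.
    apply: (opnorm_le ler01); first exact: bounded_lreg_l1.
    move=> F uF; apply: eq_kernel_le (kernel_le_lreg s uF) => a b.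
    by rewrite entry_lreg_l1.
  have := PM _ 1 ltr01 (Cr_lreg_l1 sf) s1 s 1%g.
  by rewrite Pf// entry_lreg_l1//= divg1 eqxx !mulr1.
apply/eqP; rewrite -subr_eq0 -normc_eq0; apply/eqP/le_anti; rewrite normc_ge0 andbT.
apply/ler_addgt0Pr => e e0; rewrite add0r.
set W := normc (w (p * q^-1)%g); have W0 : 0 <= W by exact: normc_ge0.
have d0 : 0 < e / (M + W + 1) by rewrite divr_gt0// ltr_wpDl// addr_ge0.
have [bT /(_ _ d0) [f sf Tf]] := TC.
have fC := Cr_lreg_l1 sf.
have DC : Cr_dom (T - lreg_l1 f).
  by rewrite addrC -scaleN1r; exact: Cr_lin.
have TE : T = 1 *: (T - lreg_l1 f) + lreg_l1 f by rewrite scale1r subrK.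
have wf : abs_summable (w \* f).
  move/abs_summableP : sf => [K HK]; apply/abs_summableP; exists (M * K) => F uF.
  apply: le_trans (ler_wpM2l M0 (HK F uF)); rewrite mulr_sumr.
  by apply: ler_sum => r _; rewrite normcM ler_wpM2r ?normc_ge0.
have -> : entry (Psi T) p q - w (p * q^-1)%g * entry T p q =
    entry (Psi (T - lreg_l1 f)) p q -
    w (p * q^-1)%g * entry (T - lreg_l1 f) p q.
  have := lP 1 (T - lreg_l1 f) (lreg_l1 f) DC fC.
  rewrite -TE (Pf f sf) => ->.
  rewrite (entry_lin 1 (Psi (T - lreg_l1 f)) (lreg_l1 (w \* f))).
  rewrite (entryB T (lreg_l1 f)) (entry_lreg_l1 p q wf) (entry_lreg_l1 p q sf) /=.
  by rewrite mul1r mulrBr opprB addrA.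
apply: le_trans (ler_normcB _ _) _; rewrite normcM -/W.
have uU := undup_uniq [:: p; q].
have pU : p \in undup [:: p; q] by rewrite mem_undup mem_head.
have qU : q \in undup [:: p; q] by rewrite mem_undup !inE eqxx orbT.
have := kernel_le_entry uU pU qU (kernel_le_opnorm (Cr_bounded DC) (ltW Tf) uU).
move=> /(ler_wpM2l W0) h2; have h1 := PM _ _ d0 DC (ltW Tf) p q.
apply: le_trans (lerD h1 h2) _; rewrite -mulrDl.
rewrite mulrCA ler_piMr//; first exact: ltW.
by rewrite ler_pdivrMr ?mul1r ?lerDl// ltr_wpDl// addr_ge0.
Qed.

End reduced.

(** * Extension of multipliers to the reduced algebra *)

Lemma entrywise_linear (R : realType) (I : choiceType) (phi : I -> I -> R[i])
    (c : R[i]) (T T' A B D : op R I) :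
  bounded_op A -> bounded_op B -> bounded_op D ->
  (forall p q, entry A p q = phi p q * entry T p q) ->
  (forall p q, entry B p q = phi p q * entry T' p q) ->
  (forall p q, entry D p q = phi p q * entry (c *: T + T') p q) ->
  D = c *: A + B.
Proof.
move=> bA bB bD eA eB eD; apply: (bounded_op_eq bD (bounded_op_lin c bA bB)) => p q.
by rewrite eD !entry_lin eA eB mulrDr mulrCA.
Qed.

Section extension.
Context (R : realType) (G : groupType).
Local Notation C := R[i].
Local Notation op := (op R G).
Local Notation Cr := (Cr R G).
Implicit Types (u v w f : G -> C) (T : op) (F : seq G).

Lemma abs_summable_mul w f (M : R) : (forall s, normc (w s) <= M) ->
  abs_summable f -> abs_summable (w \* f).
Proof.
move=> wM /abs_summableP [K HK]; apply/abs_summableP; exists (M * K) => F uF.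
have M0 : 0 <= M by exact: le_trans (normc_ge0 _) (wM 1%g).
apply: le_trans (ler_wpM2l M0 (HK F uF)); rewrite mulr_sumr.
by apply: ler_sum => r _; rewrite normcM ler_wpM2r ?normc_ge0.
Qed.

Lemma schur_le_toeplitz_entry w (M : R) s :
  schur_le (toeplitz w) M -> normc (w s) <= M.
Proof.
by move=> /(@schur_le_entry _ _ _ _ s 1%g); rewrite /toeplitz divg1.
Qed.

(** Provides the existence behind the choice made in [Smap]. *)
Lemma Smap_spec_schur_op w (M : R) : schur_le (toeplitz w) M ->
  Smap_spec w (schur_op (toeplitz w) : Cr -> Cr).
Proof.
move=> wM; have M0 := schur_le_ge0 1%g wM.
have imp : implements w (schur_op (toeplitz w)).
  by move=> T /Cr_bounded bT; exact: (schur_opP wM M0 bT).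
have wf f (sf : abs_summable f) : abs_summable (w \* f).
  by apply: abs_summable_mul sf => s; exact: schur_le_toeplitz_entry wM.
split; last first.
  move=> f sf; have [b1 e1] := imp _ (Cr_lreg_l1 sf).
  apply: (bounded_op_eq b1 (bounded_lreg_l1 (wf _ sf))) => p q.
  by rewrite e1 (entry_lreg_l1 p q sf) (entry_lreg_l1 p q (wf _ sf)).
split; last first.
- exact: le_lt_trans (cb_norm_schur_le imp M0 wM) (ltry _).
- move=> T TC; have [b1 e1] := imp T TC.
  have [_ HT] := (Cr_domP T).1 TC; apply/Cr_domP; split=> // e e0.
  have M1 : 0 < M + 1 by rewrite ltr_wpDl.
  have [f sf Hf] := HT _ (divr_gt0 e0 M1).
  (* Schur multiplication by [w] amplifies the error of [f] by at most [M], so the image stays in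
     the closure of l^1. *)
  exists (w \* f) => [|F uF]; first exact: wf.
  have := schur_leZ (ltW (divr_gt0 e0 M1)) uF wM (Hf F uF).
  move=> h; apply: (@kernel_le_trans _ _ _ _ _ e) (eq_kernel_le _ h).
    rewrite mulrCA ler_piMr//; first exact: ltW.
    by rewrite ler_pdivrMr ?mul1r ?lerDl.
  by move=> p q; rewrite e1 /toeplitz /= mulrBr.
- move=> c T T' TC TC'.
  have [b1 e1] := imp T TC; have [b2 e2] := imp T' TC'.
  have [b3 e3] := imp _ (Cr_lin c TC TC').
  exact: (entrywise_linear b1 b2 b3 e1 e2 e3).
Qed.

Lemma Smap_schur_spec w (M : R) : schur_le (toeplitz w) M ->
  Smap_spec w (Smap w : Cr -> Cr).
Proof.
move=> wM; rewrite /Smap.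
exact: (@xgetPex _ (fun=> 0) [set Psi : Cr -> Cr | completely_bounded Psi /\
    forall f, abs_summable f -> Psi (lreg_l1 f) = lreg_l1 (w \* f)]
  (ex_intro _ _ (Smap_spec_schur_op wM))).
Qed.

Lemma Smap_implements w (M : R) : schur_le (toeplitz w) M ->
  implements w (Smap w : Cr -> Cr).
Proof. by move=> /Smap_schur_spec; exact: Smap_spec_implements. Qed.

Lemma m_norm_le w (M : R) : schur_le (toeplitz w) M ->
  (m_norm w <= M%:E)%E.
Proof.
move=> wM; apply: (cb_norm_schur_le (Smap_implements wM)) => //.
exact: (schur_le_ge0 1%g wM).
Qed.

Lemma implementsB u v (Psi Phi : Cr -> Cr) : implements u Psi ->
  implements v Phi -> implements (u - v) (Psi \- Phi).
Proof.
move=> uP vP T TC; have [b1 e1] := uP T TC; have [b2 e2] := vP T TC.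
split=> [|p q]; first exact: (bounded_opB b1 b2).
by rewrite (entryB (Psi T) (Phi T)) e1 e2 -mulrBl.
Qed.

End extension.

(** * Schur multipliers on B(l^2(I)) *)

Section schur_multipliers.
Context (R : realType) (I : choiceType).
Local Notation C := R[i].
Local Notation op := (op R I).
Implicit Types (T : op) (F : seq I) (phi psi : I -> I -> C).

Lemma kernel_le_indicator F (k : I -> I -> C) (M : R) F' : 0 <= M -> uniq F ->
  uniq F' -> kernel_le F k M ->
  kernel_le F' (fun p q => if (p \in F) && (q \in F) then k p q else 0) M.
Proof.
move=> M0 uF uF' kM a b.
pose F2 := [seq p <- F' | p \in F].
have uF2 : uniq F2 by exact: filter_uniq.
have s2 : {subset F2 <= F} by move=> p; rewrite mem_filter => /andP[].
have k2 := kernel_le_sub uF2 uF s2 kM.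
have -> : \sum_(p <- F') \sum_(q <- F')
    (if (p \in F) && (q \in F) then k p q else 0) * a q * b p =
    \sum_(p <- F2) \sum_(q <- F2) k p q * a q * b p.
  rewrite big_filter [RHS]big_mkcond; apply: eq_bigr => p _ /=.
  case: ifP => pF; last by rewrite big1// => q _; rewrite !mul0r.
  rewrite big_filter [RHS]big_mkcond; apply: eq_bigr => q _ /=.
  by case: ifP => // _; rewrite !mul0r.
apply: le_trans (k2 a b) _.
have vN c : vnorm F2 c <= vnorm F' c.
  apply: ler_wsqrtr; rewrite big_filter big_mkcond; apply: ler_sum => p _.
  by case: ifP => // _; exact: sqr_ge0.
rewrite -!mulrA ler_wpM2l//.
by apply: ler_pM; rewrite ?vnorm_ge0 ?vN.
Qed.

(** A finite contraction extended by zero is a contraction on l^2(I), so the norm at matrix level 1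
    already controls all finite sections. With [schur_le_amplify] this makes the plain norm in (iii)
    as strong as a cb norm. *)
Lemma schur_le_op_norm psi (D : Bl2 R I -> Bl2 R I) (M : R) :
  (forall T, bounded_op T -> bounded_op (D T) /\
     forall p q, entry (D T) p q = psi p q * entry T p q) ->
  (op_norm D <= M%:E)%E -> schur_le psi M.
Proof.
move=> Dpsi DM F k uF k1.
pose kF p q : C := if (p \in F) && (q \in F) then k p q else 0.
have k1' F' : uniq F' -> kernel_le F' kF 1.
  by move=> uF'; exact: kernel_le_indicator.
have bk := bounded_kernel_op ler01 k1'.
have [bD eD] := Dpsi _ bk.
have Tk : (opnorm (kernel_op kF) <= 1%:E)%E.
  apply: (opnorm_le ler01 bk) => F' /k1'; apply: eq_kernel_le => p q.
  by rewrite (entry_kernel_op ler01 k1').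
have DT : (opnorm (D (kernel_op kF)) <= M%:E)%E.
  apply: le_trans DM; apply: ereal_sup_ubound; exists (kernel_op kF).
    by split; [exact: bk|exact: Tk].
  exact: erefl.
apply: eq_in_kernel_le (kernel_le_opnorm bD DT uF) => p q pF qF.
by rewrite eD (entry_kernel_op ler01 k1') /kF pF qF.
Qed.

Lemma op_norm_schur_le psi (D : Bl2 R I -> Bl2 R I) (M : R) :
  (forall T, bounded_op T -> bounded_op (D T) /\
     forall p q, entry (D T) p q = psi p q * entry T p q) ->
  0 <= M -> schur_le psi M -> (op_norm D <= M%:E)%E.
Proof.
move=> Dpsi M0 psiM; apply: ge_ereal_sup => _ [T [bT T1] <-].
have [bD eD] := Dpsi T bT.
apply: (@opmx_norm_schur R I psi M 1 (const_mx T) (const_mx (D T)) psiM M0 _ _ _ T1)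
  => [i j|i j|i j p q].
- rewrite mxE; exact: bT.
- rewrite mxE; exact: bD.
- rewrite !mxE; exact: eD.
Qed.

Lemma schur_mapP phi T : schur_multiplier phi -> bounded_op T ->
  bounded_op (schur_map phi T) /\
  forall p q, entry (schur_map phi T) p q = phi q p * entry T p q.
Proof.
move=> [ex _] bT; have [T' bT' eT'] := ex T bT; rewrite /schur_map.
exact: (@xgetPex _ 0 [set T' | bounded_op T' /\
  forall p q, entry T' p q = phi q p * entry T p q]
  (ex_intro _ _ (conj bT' eT'))).
Qed.

Lemma schur_multiplier_schur_le phi (M : R) : 0 <= M ->
  schur_le (fun p q => phi q p) M -> schur_multiplier phi.
Proof.
move=> M0 phiM.
have H T (bT : bounded_op T) := schur_opP phiM M0 bT.
have Hm T (bT : bounded_op T) : bounded_op (schur_map phi T) /\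
    forall p q, entry (schur_map phi T) p q = phi q p * entry T p q.
  rewrite /schur_map.
  exact: (@xgetPex _ 0 [set T' | bounded_op T' /\
    forall p q, entry T' p q = phi q p * entry T p q] (ex_intro _ _ (H T bT))).
split=> [T bT|]; first by have [b1 e1] := H T bT; eexists; [exact: b1|exact: e1].
split.
- move=> c T T' bT bT'.
  have [b1 e1] := Hm T bT; have [b2 e2] := Hm T' bT'.
  have [b3 e3] := Hm _ (bounded_op_lin c bT bT').
  exact: (entrywise_linear b1 b2 b3 e1 e2 e3).
- by move=> T bT; case: (Hm T bT).
- apply: (@le_lt_trans _ _ M%:E); last exact: ltry.
  apply: ge_ereal_sup => _ [n [X [XC X1 ->]]].
  apply: (@opmx_norm_schur R I _ M n X (map_mx (schur_map phi) X) phiM M0 XC _ _ X1)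
    => [i j|i j p q].
  + by rewrite mxE; case: (Hm _ (XC i j)).
  + by rewrite mxE; case: (Hm _ (XC i j)).
Qed.

End schur_multipliers.

(** * Normal functionals on VN(G) and Herz-Schur multipliers *)

Section projection.
Context (R : realType) (E : lmodType R[i]).
Local Notation C := R[i].
Variables (ip : E -> E -> C) (sq : E -> R).
Hypothesis ip_lin : forall c x y z, ip (c *: x + y) z = c * ip x z + ip y z.
Hypothesis ip_conj : forall x y, ip y x = (ip x y)^*.
Hypothesis ip_sq : forall x, ip x x = (sq x)%:C.
Hypothesis sq_ge0 : forall x, 0 <= sq x.
Hypothesis sq_eq0 : forall x, sq x = 0 -> x = 0.
Hypothesis complete : forall x : nat -> E,
  (forall e : R, 0 < e -> exists N, forall m n, (N <= m)%N -> (N <= n)%N ->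
    sq (x m - x n) <= e) ->
  exists y, forall e : R, 0 < e -> exists N, forall n, (N <= n)%N ->
    sq (x n - y) <= e.
Variable K : set E.
Hypothesis K0 : K 0.
Hypothesis K_lin : forall c x y, K x -> K y -> K (c *: x + y).
Hypothesis K_closed : forall (x : nat -> E) y, (forall n, K (x n)) ->
  (forall e : R, 0 < e -> exists N, forall n, (N <= n)%N -> sq (x n - y) <= e) ->
  K y.

Lemma ip_linr c x y z : ip z (c *: x + y) = c^* * ip z x + ip z y.
Proof.
by rewrite (ip_conj (c *: x + y)) (ip_conj x) (ip_conj y) ip_lin rmorphD rmorphM.
Qed.

Lemma ipD x y z : ip (x + y) z = ip x z + ip y z.
Proof. by rewrite -[x]scale1r ip_lin mul1r scale1r. Qed.

Lemma ipDr x y z : ip z (x + y) = ip z x + ip z y.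
Proof. by rewrite (ip_conj (x + y)) (ip_conj x) (ip_conj y) ipD rmorphD. Qed.

Lemma ip0 z : ip 0 z = 0.
Proof.
have := ipD 0 0 z; rewrite addr0 => /eqP.
by rewrite -subr_eq subrr => /eqP.
Qed.

Lemma ipZ c x z : ip (c *: x) z = c * ip x z.
Proof. by rewrite -[c *: x]addr0 ip_lin ip0 addr0. Qed.

Lemma ipN x z : ip (- x) z = - ip x z.
Proof. by rewrite -scaleN1r ipZ mulN1r. Qed.

Lemma ipNr x z : ip z (- x) = - ip z x.
Proof. by rewrite (ip_conj (- x)) (ip_conj x) ipN rmorphN. Qed.

Lemma sqZ c x : sq (c *: x) = normc c ^+ 2 * sq x.
Proof.
suff : (sq (c *: x))%:C = (normc c ^+ 2 * sq x)%:C by case.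
rewrite -ip_sq ipZ (ip_conj (c *: x)) ipZ ip_sq rmorphM rmorphM /= -mulc_conj.
by case: c => ? ?; simpc; congr (_ +i* _); ring.
Qed.

(** Subtracting nearly the projection of [a] on [b]: the denominator sq b + 1 in place of sq b
    avoids the case b = 0 and keeps enough of the decrease. *)
Lemma bessel a b : sq (a - ((sq b + 1)^-1%:C * ip a b) *: b) <=
  sq a - normc (ip a b) ^+ 2 / (sq b + 1).
Proof.
set s := (sq b + 1)^-1; set p := ip a b.
have b1 : 0 < sq b + 1 by rewrite ltr_wpDl.
have E1 : (sq (a - (s%:C * p) *: b))%:C =
    (sq a - 2 * (s * normc p ^+ 2) + s ^+ 2 * normc p ^+ 2 * sq b)%:C.
  rewrite -ip_sq addrC -scaleNr ip_lin !ip_linr -/p ip_sq (ip_conj a b) -/p ip_sq.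
  rewrite normc_sqrE; case: p => p1 p2 /=.
  by simpc; congr (_ +i* _); ring.
have {E1} -> : sq (a - (s%:C * p) *: b) =
    sq a - 2 * (s * normc p ^+ 2) + s ^+ 2 * normc p ^+ 2 * sq b.
  by case: E1.
have s0 : 0 < s by rewrite invr_gt0.
have sb : s * sq b <= 1 by rewrite /s ler_pdivrMl ?mulr1 ?lerDl.
rewrite -/s -subr_ge0.
have -> : sq a - normc p ^+ 2 * s - (sq a - 2 * (s * normc p ^+ 2) +
    s ^+ 2 * normc p ^+ 2 * sq b) = s * normc p ^+ 2 * (1 - s * sq b) by ring.
by apply: mulr_ge0; [apply: mulr_ge0; [exact: ltW|exact: sqr_ge0]|rewrite subr_ge0].
Qed.

(** A weak Cauchy-Schwarz inequality, sufficient for the continuity of [ip]. *)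
Lemma ip_sqr_le a b : normc (ip a b) ^+ 2 <= sq a * (sq b + 1).
Proof.
have b1 : 0 < sq b + 1 by rewrite ltr_wpDl.
by rewrite -ler_pdivrMr// -subr_ge0; apply: le_trans (bessel a b).
Qed.

Lemma parallelogram a b : sq (a + b) + sq (a - b) = 2 * sq a + 2 * sq b.
Proof.
suff : (sq (a + b) + sq (a - b))%:C = (2 * sq a + 2 * sq b)%:C by case.
rewrite rmorphD /= -!ip_sq !ipD !ipDr !ipN !ipNr !ip_sq.
move: (ip a b) (ip b a) => [p1 p2] [q1 q2].
by simpc; congr (_ +i* _); ring.
Qed.

(** A minimising sequence for the distance to [K] is Cauchy by the parallelogram law, and its limit
    inherits the orthogonality that holds asymptotically along the sequence. *)
Lemma projection z : exists2 k, K k & forall k', K k' -> ip (z - k) k' = 0.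
Proof.
pose S := [set sq (z - k) | k in K].
have S0 : S !=set0 by exists (sq (z - 0)), 0.
have lbS : lbound S 0 by move=> _ [k _ <-].
have infS : has_inf S by split=> //; exists 0.
have dS k : K k -> inf S <= sq (z - k) by move=> Kk; apply: ge_inf; [exists 0|exists k].
have /choice [x Hx] : forall n : nat, exists k, K k /\ sq (z - k) <= inf S + n.+1%:R^-1.
  move=> n; have n0 : 0 < n.+1%:R^-1 :> R by rewrite invr_gt0.
  by have [_ [k Kk <-] h] := inf_adherent n0 infS; exists k; split=> //; exact: ltW.
have KB a b : K a -> K b -> K (a - b).
  by move=> Ka Kb; rewrite addrC -scaleN1r; exact: K_lin.
(* Moving [x n] along k' stays in [K], so the decrease of the squared distance given by [bessel]
   cannot exceed the gap 1/(n+1) to the infimum. *)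
have near k' n : K k' -> normc (ip (z - x n) k') ^+ 2 <= (sq k' + 1) / n.+1%:R.
  move=> Kk'; have b1 : 0 < sq k' + 1 by rewrite ltr_wpDl.
  have [Kx xd] := Hx n.
  set c := ((sq k' + 1)^-1)%:C * ip (z - x n) k'.
  have := dS (c *: k' + x n) (K_lin c Kk' Kx).
  have -> : z - (c *: k' + x n) = z - x n - c *: k' by rewrite opprD addrA addrAC.
  move=> /le_trans/(_ (bessel (z - x n) k')).
  move: xd; set A := sq _; set q := _ / _; set r := _^-1 => xd h.
  have : q <= r by lra.
  by rewrite /q /r ler_pdivrMr// mulrC.
have xc (e : R) : 0 < e -> exists N, forall m n, (N <= m)%N -> (N <= n)%N ->
    sq (x m - x n) <= e.
  (* The parallelogram law leaves 2/(m+1) + 2/(n+1), at most e for this threshold. *)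
  move=> e0; have [N HN] : exists N : nat, N.+1%:R^-1 <= e / 4.
    have e4 : 0 < e / 4 by rewrite divr_gt0.
    have [N _ HN] := near_infty_natSinv_lt (PosNum e4).
    by exists N; apply: ltW; apply: HN => /=.
  exists N => m n Nm Nn.
  have [Km dm] := Hx m; have [Kn dn] := Hx n.
  have inv r : (N <= r)%N -> r.+1%:R^-1 <= e / 4.
    by move=> Nr; apply: le_trans HN; rewrite lef_pV2 ?posrE ?ltr0n// ler_nat.
  have := parallelogram (z - x n) (z - x m).
  have -> : z - x n - (z - x m) = x m - x n by rewrite opprB addrC addrA subrK.
  (* The midpoint lies in [K], so its squared distance to [z] is at least the infimum. *)
  set h := (2^-1)%:C *: (x n + x m).
  have Kh : K h.
    have K2 : K (x n + x m) by rewrite -[x n]scale1r; exact: K_lin.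
    by rewrite /h -[_ *: _]addr0; exact: K_lin.
  have -> : z - x n + (z - x m) = 2%:R *: (z - h).
    rewrite scalerBr /h scalerA.
    have -> : 2%:R * (2^-1)%:C = 1 :> C.
      by rewrite -(rmorph_nat (real_complex R)) -rmorphM /= mulfV.
    by rewrite scale1r scaler_nat mulr2n opprD addrACA.
  have -> : sq (2%:R *: (z - h)) = 4 * sq (z - h).
    rewrite sqZ -(rmorph_nat (real_complex R)) normc_real normr_nat.
    by congr (_ * _); ring.
  move=> hp; have hd := dS h Kh; have im := inv m Nm; have i_n := inv n Nn.
  move: hp hd im i_n dm dn; move: (sq (z - h)) (sq (x m - x n)) (sq (z - x n)) (sq (z - x m)).
  move: (inf S) (m.+1%:R^-1) (n.+1%:R^-1) => I1 r1 r2 q1 q2 q3 q4 *; lra.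
have [y Hy] := complete xc.
exists y; first by apply: K_closed Hy => n; case: (Hx n).
move=> k' Kk'; apply/eqP; rewrite -normc_eq0; apply/eqP/le_anti; rewrite normc_ge0 andbT.
apply/ler_addgt0Pr => e e0; rewrite add0r.
have b1 : 0 < sq k' + 1 by rewrite ltr_wpDl.
have d0 : 0 < (e / 2) ^+ 2 / (sq k' + 1) by rewrite divr_gt0// exprn_gt0// divr_gt0.
have [N1 H1] := Hy _ d0.
have [N2 _ H2] := near_infty_natSinv_lt (PosNum d0).
pose n := maxn N1 N2.
have -> : ip (z - y) k' = ip (z - x n) k' + ip (x n - y) k'.
  by rewrite -ipD addrA subrK.
have e2 : 0 <= e / 2 by rewrite divr_ge0// ltW.
rewrite [leRHS](splitr e); apply: le_trans (ler_normcD _ _) _; apply: lerD.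
  rewrite -(@ler_pXn2r _ 2) ?nnegrE ?normc_ge0//; apply: le_trans (near k' n Kk') _.
  have /= := H2 n (leq_maxr _ _); rewrite ltr_pdivlMr// => /ltW.
  by rewrite mulrC.
rewrite -(@ler_pXn2r _ 2) ?nnegrE ?normc_ge0//; apply: le_trans (ip_sqr_le _ _) _.
by rewrite -ler_pdivlMr//; apply: H1; exact: leq_maxl.
Qed.

(** In the last clause [V] is the adjoint of [U]: invariance of [K] under both makes the orthogonal
    complement invariant under [U], hence [K] reduces [U]. *)
Lemma orthogonal_projection : exists P : E -> E,
  [/\ forall z, K (P z), forall z, K z -> P z = z,
      forall c a b, P (c *: a + b) = c *: P a + P b, forall z, sq (P z) <= sq z &
      forall U V : E -> E, (forall a b, ip (U a) b = ip a (V b)) ->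
        (forall a b, U (a - b) = U a - U b) -> (forall a, K a -> K (U a)) ->
        (forall a, K a -> K (V a)) -> forall z, P (U z) = U (P z)].
Proof.
have /choice [P HP] : forall z, exists k, K k /\ forall k', K k' -> ip (z - k) k' = 0.
  by move=> z; have [k Kk h] := projection z; exists k.
have PK z : K (P z) by case: (HP z).
have Pp z k : K k -> ip (z - P z) k = 0 by case: (HP z) => _; apply.
have Pu z k : K k -> (forall k', K k' -> ip (z - k) k' = 0) -> P z = k.
  move=> Kk kp; apply/eqP; rewrite -subr_eq0; apply/eqP/sq_eq0.
  have Kd : K (P z - k) by rewrite addrC -scaleN1r; exact: K_lin.
  suff : (sq (P z - k))%:C = (0 : R)%:C by case.
  rewrite -ip_sq; move: (kp _ Kd) (Pp z _ Kd); set d := P z - k => h1 h2.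
  have dE : d = (z - k) - (z - P z) by rewrite opprB [RHS]addrC addrA subrK.
  by rewrite {1}dE ipD ipN h1 h2 subrr.
exists P; split=> [//|z Kz|c a b|z|U V UV UB KU KV z].
- by apply: Pu => // k _; rewrite subrr ip0.
- apply: Pu => [|k Kk]; first exact: K_lin.
  have -> : c *: a + b - (c *: P a + P b) = c *: (a - P a) + (b - P b).
    by rewrite scalerBr opprD addrACA.
  by rewrite ip_lin !Pp// mulr0 addr0.
- have h1 := Pp z _ (PK z).
  have h2 : ip (P z) (z - P z) = 0 by rewrite ip_conj h1 conjc0.
  have h : (sq z)%:C = (sq (z - P z) + sq (P z))%:C.
    rewrite rmorphD /= -!ip_sq; have {1 2}-> : z = (z - P z) + P z by rewrite subrK.
    by rewrite ipD [in LHS]ipDr h1 [ip (P z) _]ipDr h2 addr0 add0r.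
  by case: h => ->; rewrite lerDr.
- apply: Pu => [|k Kk]; first exact/KU/PK.
  by rewrite -UB UV Pp//; exact: KV.
Qed.

End projection.

(** * The group von Neumann algebra and its normal functionals *)

Section group_von_neumann.
Context (R : realType) (G : groupType).
Local Notation C := R[i].
Local Notation op := (op R G).
Local Notation E := (l2 R G * l2 R G)%type.
Implicit Types (x y : l2 R G) (s : G) (a b z : E).

Definition VN_dom (T : op) := @mn_dom R (VN R G) T.

Lemma dot_lreg s x y : dot (lreg s x) y = dot x (lreg s^-1%g y).
Proof.
rewrite /dot -(@csum_reindex _ _ (fun r => s * r)%g (fun r => s^-1 * r)%g).
- by congr csum; apply/funext => r; rewrite /= !lregE mulKg invgK.
- exact: mulKg.
- exact: mulVKg.
Qed.

Let ip a b : C := dot a.1 b.1 + dot a.2 b.2.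
Let sq a : R := sqnorm a.1 + sqnorm a.2.

Let ip_lin c a b z : ip (c *: a + b) z = c * ip a z + ip b z.
Proof. by rewrite /ip /= !dot_lin; ring. Qed.

Let ip_conj a b : ip b a = (ip a b)^*.
Proof. by rewrite /ip rmorphD (dot_conj a.1) (dot_conj a.2). Qed.

Let ip_sq a : ip a a = (sq a)%:C.
Proof. by rewrite /ip /sq !dotxx [RHS]rmorphD. Qed.

Let sq_ge0 a : 0 <= sq a.
Proof. by rewrite addr_ge0 ?sqnorm_ge0. Qed.

Let sq_eq0 a : sq a = 0 -> a = 0.
Proof.
move=> /eqP; rewrite paddr_eq0 ?sqnorm_ge0// => /andP[/eqP a1 /eqP a2].
case: a a1 a2 => a1 a2 /= h1 h2.
have e (x : l2 R G) : sqnorm x = 0 -> x = 0.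
  by move=> h; apply: l2norm_eq0; rewrite /l2norm h sqrtr0.
by rewrite (e _ h1) (e _ h2).
Qed.

Let sq_complete (a : nat -> E) :
  (forall e : R, 0 < e -> exists N, forall m n, (N <= m)%N -> (N <= n)%N ->
    sq (a m - a n) <= e) ->
  exists b : E, forall e : R, 0 < e -> exists N, forall n, (N <= n)%N ->
    sq (a n - b) <= e.
Proof.
move=> ac.
have aux (pr : E -> l2 R G) : (forall a b, pr (a - b) = pr a - pr b) ->
    (forall z, sqnorm (pr z) <= sq z) ->
    exists y, forall e : R, 0 < e -> exists N, forall n, (N <= n)%N ->
    l2norm (pr (a n) - y) <= e.
  move=> prB prs; apply: l2_complete => e e0.
  have [N HN] := ac _ (exprn_gt0 2 e0); exists N => m n Nm Nn.
  rewrite -prB -(@ler_pXn2r _ 2) ?nnegrE ?l2norm_ge0 ?(ltW e0)// l2norm_sqr.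
  exact: le_trans (prs _) (HN m n Nm Nn).
have [|z|y1 H1] := aux fst => //; first by rewrite lerDl sqnorm_ge0.
have [|z|y2 H2] := aux snd => //; first by rewrite lerDr sqnorm_ge0.
exists (y1, y2) => e e0.
have d0 : 0 < Num.sqrt (e / 2) by rewrite sqrtr_gt0 divr_gt0.
have [N1 K1] := H1 _ d0; have [N2 K2] := H2 _ d0.
exists (maxn N1 N2) => n; rewrite geq_max => /andP[n1 n2].
have e2 : 0 <= e / 2 by rewrite divr_ge0// ltW.
rewrite [leRHS](splitr e) /sq /= -!l2norm_sqr -(sqr_sqrtr e2).
apply: lerD; rewrite ler_pXn2r ?nnegrE ?l2norm_ge0 ?sqrtr_ge0//.
  exact: K1.
exact: K2.
Qed.

Section invariant_projection.
Variable eta : E.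
Let U s a : E := (lreg s a.1, lreg s a.2).
Let K : set E := [set a | forall s, ip a (U s eta) = 0].

Let U_lin s c a b : U s (c *: a + b) = c *: U s a + U s b.
Proof.
have L x y : lreg s (c *: x + y) = c *: lreg s x + lreg s y.
  exact: (linear_opP c x y (bounded_op_linear (bounded_lreg R s))).
by rewrite /U /= !L.
Qed.

Let K0 : K 0.
Proof. by move=> s; exact: ip0 ip_lin _. Qed.

Let K_lin c a b : K a -> K b -> K (c *: a + b).
Proof. by move=> Ka Kb s; rewrite ip_lin Ka Kb mulr0 addr0. Qed.

Let K_closed (a : nat -> E) b : (forall n, K (a n)) ->
  (forall e : R, 0 < e -> exists N, forall n, (N <= n)%N -> sq (a n - b) <= e) ->
  K b.
Proof.
move=> Ka ab s; apply/eqP; rewrite -normc_eq0 -sqrf_eq0; apply/eqP/le_anti.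
rewrite sqr_ge0 andbT; apply/ler_addgt0Pr => e e0; rewrite add0r.
set h := U s eta; have h0 : 0 < sq h + 1 by rewrite ltr_wpDl.
have [N HN] := ab _ (divr_gt0 e0 h0).
have -> : normc (ip b h) = normc (ip (a N - b) h).
  by rewrite (ipD ip_lin) (ipN ip_lin) Ka add0r normcNE.
apply: le_trans (ip_sqr_le ip_lin ip_conj ip_sq sq_ge0 _ _) _.
by rewrite -ler_pdivlMr//; exact: HN.
Qed.

Let inj (j : bool) x : E := if j then (x, 0) else (0, x).
Let prj (j : bool) a := if j then a.1 else a.2.

(** [K] is the orthogonal complement of an orbit, so its projection commutes with the diagonal
    translations and its four blocks commute with each translation. An element of VN(G) therefore
    commutes with the blocks, and its diagonal copy preserves [K]. *)
Let P_blocks : exists (P : E -> E) (B : bool -> bool -> op),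
  [/\ forall z, K (P z), forall z, K z -> P z = z,
      forall i j, commutant (range (@lreg R G)) (B i j) &
      forall i a, prj i (P a) = B i true a.1 + B i false a.2].
Proof.
have [P [PK Pid P_lin P_sq P_U]] := orthogonal_projection ip_lin ip_conj ip_sq
  sq_ge0 sq_eq0 sq_complete K0 K_lin K_closed.
exists P, (fun i j x => prj i (P (inj j x))); split=> // [i j|i a]; last first.
  have aE : a = 1 *: inj true a.1 + inj false a.2.
    by case: a => a1 a2; rewrite scale1r /inj /=; congr pair; rewrite ?addr0 ?add0r.
  by rewrite {1}aE P_lin scale1r /prj; case: i.
have injE c x y : inj j (c *: x + y) = c *: inj j x + inj j y.
  by rewrite /inj; case: j; congr pair; rewrite /= ?scaler0 ?addr0.
have injU s x : inj j (lreg s x) = U s (inj j x).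
  have l0 : lreg s (0 : l2 R G) = 0 by apply: l2P => p; rewrite lregE.
  by rewrite /inj /U; case: (j) => /=; rewrite l0.
have ipU a b t : ip (U t a) b = ip a (U t^-1%g b) by rewrite /ip /U /= !dot_lreg.
have UU t r a : U t (U r a) = U (t * r)%g a.
  by rewrite /U /=; congr pair; apply: l2P => p; rewrite !lregE invgM mulgA.
have KU t a : K a -> K (U t a) by move=> Ka r; rewrite ipU UU.
have UB s a b : U s (a - b) = U s a - U s b.
  by have := U_lin s (-1) b a; rewrite !scaleN1r [- b + a]addrC => ->; rewrite addrC.
have PU s z : P (U s z) = U s (P z).
  apply: (P_U (U s) (U s^-1%g)) => [a b|a b|a|a]; first exact: ipU.
  - exact: UB.
  - exact: KU.
  - exact: KU.
split; last first.
  move=> _ [s _ <-]; apply/funext => x /=.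
  by rewrite injU PU /prj /U; case: i.
apply/bounded_opP; split=> [c x y _ _|]; first by rewrite injE P_lin /prj; case: i.
exists 1 => // x; rewrite mul1r; apply: ler_wsqrtr.
apply: le_trans (_ : sq (P (inj j x)) <= _).
  by rewrite /prj /sq; case: i; rewrite ?lerDl ?lerDr sqnorm_ge0.
apply: le_trans (P_sq _) _; rewrite /inj /sq.
have s0 : sqnorm (0 : l2 R G) = 0 by rewrite -l2norm_sqr l2norm0 expr0n.
by case: (j); rewrite /= s0 ?addr0 ?add0r.
Qed.

Lemma VN_invariant (T : op) a : VN_dom T -> (forall s, ip a (U s eta) = 0) ->
  ip (T a.1, T a.2) eta = 0.
Proof.
move=> [bT TC] Ka; have lT := bounded_op_linear bT.
have [P [B [PK Pid BC PB]]] := P_blocks.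
have TB i j x : B i j (T x) = T (B i j x).
  by have /(congr1 (fun f : op => f x)) := TC _ (BC i j).
have PT i : prj i (P (T a.1, T a.2)) = T (prj i (P a)).
  refine (etrans (PB i (T a.1, T a.2)) (etrans (congr2 +%R (TB i true a.1) (TB i false a.2)) _)).
  refine (etrans (esym (linear_opD _ _ lT)) (congr1 T (esym (PB i a)))).
have PTa : P (T a.1, T a.2) = (T a.1, T a.2).
  have := PT true; have := PT false; rewrite (Pid a Ka) /prj.
  by case: (P _) => x y /= -> ->.
(* Membership in [K] is orthogonality to the whole orbit; the unit of the group picks [eta]
   itself. *)
have := PK (T a.1, T a.2); rewrite PTa => /(_ 1%g).
have -> : U 1%g eta = eta.
  case: (eta) => x y; rewrite /U /=; congr pair; apply: l2P => p;
  by rewrite lregE invg1 mul1g.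
by [].
Qed.

End invariant_projection.

(** Double commutant argument on [l2 (+) l2]: the annihilator of the orbit of
    [(y, - y')] is invariant under [T (+) T]. *)
Lemma VN_pairing_unique (T : op) x y x' y' : VN_dom T ->
  coeff x y = coeff x' y' -> dot (T x) y = dot (T x') y'.
Proof.
move=> TV xy.
have dN (u v : l2 R G) : dot u (- v) = - dot u v.
  rewrite (dot_conj (- v)) (dot_conj v) -scaleN1r -[-1 *: v]addr0 dot_lin.
  have -> : dot (0 : l2 R G) u = 0.
    by rewrite /dot (@csum1 _ _ _ 1%g) => [|i _]; rewrite l2_zeroE mul0r.
  by rewrite addr0 mulN1r rmorphN.
have := @VN_invariant (y, - y') T (x, x') TV.
rewrite /ip /= dN => H; apply/eqP; rewrite -subr_eq0; apply/eqP; apply: H => s.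
have -> : lreg s (- y') = - lreg s y'.
  by apply: l2P => p; rewrite !lregE !l2_oppE lregE.
rewrite dN; have := congr1 (fun f => f s^-1%g) xy; rewrite /coeff !dot_lreg invgK => ->.
by rewrite subrr.
Qed.

End group_von_neumann.

Lemma kernel_le_unit (R : realType) (A : eqType) (F : seq A) (k : A -> A -> R[i])
    (M : R) : 0 <= M ->
  (forall a, vnorm F a <= 1 -> vnorm F (fun x => \sum_(y <- F) k x y * a y) <= M) ->
  kernel_le F k M.
Proof.
move=> M0 H a b.
have -> : \sum_(x <- F) \sum_(y <- F) k x y * a y * b x =
    \sum_(x <- F) (\sum_(y <- F) k x y * a y) * b x.
  by apply: eq_bigr => x _; rewrite mulr_suml.
apply: le_trans (normc_sum_mul _ _ _) _; rewrite ler_wpM2r ?vnorm_ge0//.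
set t := vnorm F a; have t0 : 0 <= t by exact: vnorm_ge0.
have [te0|tn0] := eqVneq t 0.
  rewrite te0 mulr0 le_eqVlt; apply/orP; left; apply/eqP.
  rewrite /vnorm big_seq big1 ?sqrtr0// => x _.
  rewrite big_seq big1 ?normc0E ?expr0n// => y yF.
  by rewrite (vnorm_pred0 te0 yF) mulr0.
have nt : normc (t%:C)^-1 = t^-1 by rewrite normcV normc_real ger0_norm.
have := H (fun y => (t%:C)^-1 * a y).
rewrite vnormZ nt mulVf// => /(_ (lexx _)).
have -> : (fun x => \sum_(y <- F) k x y * ((t%:C)^-1 * a y)) =
    (fun x => (t%:C)^-1 * \sum_(y <- F) k x y * a y).
  by apply/funext => x; rewrite mulr_sumr; apply: eq_bigr => y _; rewrite mulrCA.
by rewrite vnormZ nt ler_pdivrMl ?lt0r ?tn0// mulrC.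
Qed.

Lemma lty_real_ub (R : realType) (x : \bar R) : (x < +oo)%E ->
  exists2 M : R, 0 <= M & (x <= M%:E)%E.
Proof.
case: x => [r _|//|_]; last by exists 0; rewrite ?leNye.
by exists `|r|; rewrite ?normr_ge0// lee_fin ler_norm.
Qed.

(** * Herz-Schur multipliers of the Fourier algebra *)

Section herz_schur.
Context (R : realType) (G : groupType).
Local Notation C := R[i].
Local Notation op := (op R G).
Implicit Types (u v : G -> C) (F : seq G) (x y : l2 R G).

Lemma VN_lreg (c : C) (s : G) : VN_dom (c *: lreg s : op).
Proof.
split; first exact: bounded_opZ (bounded_lreg R s).
move=> S [bS Sc]; apply/funext => x.
have := Sc (lreg s) (ex_intro2 _ _ s Logic.I erefl).
move=> /(congr1 (fun f : op => f x)) /= E.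
change (c *: lreg s (S x) = S (c *: lreg s x)).
by rewrite (linear_opZ _ _ (bounded_op_linear bS)) E.
Qed.

Lemma vn_pairing_coeff (T : op) x y : VN_dom T ->
  vn_pairing (coeff x y) T = dot (T x) y.
Proof.
move=> TV; rewrite /vn_pairing /=; set xy := xget _ _.
have xyE : coeff x y = coeff xy.1 xy.2.
  by apply: (@xgetPex _ (0, 0) [set xy | coeff x y = coeff xy.1 xy.2]); exists (x, y).
by apply/esym; exact: VN_pairing_unique.
Qed.

Lemma vn_pairing_lreg v (c : C) (s : G) : in_fourier v ->
  vn_pairing v (c *: lreg s) = c * v s.
Proof.
move=> [x [y vxy]]; rewrite /vn_pairing /=; set xy := xget _ _.
have xyE : v = coeff xy.1 xy.2.
  by apply: (@xgetPex _ (0, 0) [set xy | v = coeff xy.1 xy.2]); exists (x, y).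
rewrite [in RHS]xyE /coeff.
have := dot_lin c (lreg s xy.1) 0 xy.2; rewrite addr0 => E.
apply: (etrans E); rewrite (_ : dot 0 xy.2 = 0) ?addr0//.
by rewrite /dot (@csum1 _ _ _ 1%g) => [|i _]; rewrite l2_zeroE mul0r.
Qed.

Section test_matrix.
Variables (F : seq G).
Hypothesis uF : uniq F.
Local Notation n := (size F).
Let s := tnth (in_tuple F).

(** Under the pairing with VN(G) it sends [T] to its corner over [F]. *)
Definition corner : 'M[fourier R G]_n :=
  \matrix_(i, j) coeff (Defs.basis R (s j)) (Defs.basis R (s i)).

Lemma corner_dom : mx_dom (@mn_dom R (fourier R G)) corner.
Proof. by move=> i j; rewrite mxE; eexists; eexists. Qed.

Lemma corner_lreg i j (t : G) : corner i j t = (t == s i * (s j)^-1)%g%:R.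
Proof. by rewrite mxE /coeff -/(entry (lreg t) (s i) (s j)) entry_lreg. Qed.

Let s_inj : injective s.
Proof.
move=> i j; rewrite /s !(tnth_nth 1%g) => /eqP; rewrite nth_uniq// => /eqP.
exact: val_inj.
Qed.

(** Pairing with a matrix [X] over VN(G) gives the submatrix of [blocks X] on the indices (k, s i),
    and compression does not increase norms. *)
Lemma corner_norm : (mn_norm corner <= 1%:E)%E.
Proof.
apply: ge_ereal_sup => _ [m [X [XV X1 ->]]].
apply: ge_ereal_sup => _ [x /= x1 <-]; rewrite lee_fin.
pose L : seq ('I_m * 'I_n) := [seq (k, i) | k <- index_enum 'I_m, i <- index_enum 'I_n].
have uL : uniq L.
  by apply: allpairs_uniq => [||[i p] [j q] _ _ /= [-> ->]//]; exact: index_enum_uniq.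
pose h (z : 'I_m * 'I_n) := (z.1, s z.2).
have hI : injective h by move=> [i p] [j q] [-> /s_inj ->].
have bX i j : bounded_op (X i j) by case: (XV i j).
have uhL : uniq (map h L) by rewrite map_inj_uniq.
have := kernel_le_blocks (fun i j => bounded_op_linear (bX i j)) X1 uhL.
move=> /(kernel_le_map uL (fun a b _ _ => @hI a b)) HL.
have := kernel_le_vnorm (fun z => x z.1 z.2 ord0) ler01 HL.
have sqE (y : 'I_m -> 'cV[C]_n) : vnorm L (fun z => y z.1 z.2 ord0) =
    Num.sqrt (\sum_i \sum_p normc (y i p ord0) ^+ 2).
  by rewrite /vnorm big_allpairs.
rewrite sqE mul1r => H.
apply: le_trans (_ : Num.sqrt (\sum_i \sum_p normc (x i p ord0) ^+ 2) <= _); last first.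
  by rewrite -[leRHS]sqrtr1; exact: ler_wsqrtr.
apply: le_trans H; rewrite -sqE le_eqVlt; apply/orP; left; apply/eqP.
congr Num.sqrt; rewrite !big_allpairs /=; apply: eq_bigr => k _; apply: eq_bigr => i _.
congr (normc _ ^+ 2); rewrite big_allpairs summxE; apply: eq_bigr => l _.
rewrite !mxE; apply: eq_bigr => j _; rewrite !mxE.
by rewrite vn_pairing_coeff; last exact: XV.
Qed.

End test_matrix.

(** [corner] is contractive over A(G) and [twist] over VN(G). The image of [corner] under the
    multiplier, paired with [twist], has at the diagonal indices (i, i), (j, j) the entry u(s_i
    s_j^-1) k(s_i, s_j), so the cb bound on A(G) yields the Schur bound. *)
Lemma herz_schur_schur_le u : herz_schur u ->
  exists2 M : R, 0 <= M & schur_le (toeplitz u) M.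
Proof.
move=> [umul [_ _ /lty_real_ub [M M0 uM]]]; exists M => // F k uF k1.
have uW : (mn_norm (map_mx (fun v : fourier R G => (u \* v)%R : fourier R G) (corner F))
    <= M%:E)%E.
  apply: le_trans uM; apply: ereal_sup_ubound; exists (size F), (corner F).
  by split=> //; [exact: corner_dom|exact: corner_norm].
pose s := tnth (in_tuple F).
set W := map_mx _ _ in uW.
pose Psi (T : op) : 'M[C]_(size F) := \matrix_(i, j) vn_pairing (W i j) T.
have XV : mx_dom (@mn_dom R (VN R G)) (twist F k).
  by move=> i j; rewrite mxE; exact: VN_lreg.
have := le_trans (ereal_sup_ubound (ex_intro _ (size F)
  (ex_intro _ (twist F k) (And3 XV (opmx_norm_twist uF k1) erefl)))) uW.
move=> PsiM.
have EF : F = map s (enum 'I_(size F)).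
  by have := map_tnth_enum (in_tuple F); rewrite /s => ->.
rewrite [in kernel_le F]EF; apply: kernel_le_unmap.
apply: kernel_le_unit => // a a1.
(* The copy l carries a multiple of its basis vector l: these vectors compress the paired matrix to
   its diagonal indices. *)
pose x (l : 'I_(size F)) : 'cV[C]_(size F) := \col_i (a l * (i == l)%:R).
have x1 : \sum_l \sum_p normc (x l p ord0) ^+ 2 <= 1.
  rewrite -(ler_sqrt _ ler01) sqrtr1; apply: le_trans a1.
  rewrite /vnorm -big_enum /= enumT; apply: ler_wsqrtr; apply: ler_sum => l _.
  rewrite (bigD1 l)//= !mxE eqxx mulr1 big1 ?addr0// => i /negPf il.
  by rewrite !mxE il mulr0 normc0E expr0n.
have := le_trans (ereal_sup_ubound (ex_intro2 _ _ x x1 erefl)) PsiM.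
rewrite lee_fin; apply: le_trans; apply: ler_wsqrtr.
rewrite -big_enum /= enumT; apply: ler_sum => i _.
rewrite [leRHS](bigD1 i)//= -[leLHS]addr0; apply: lerD; last first.
  by apply: sumr_ge0 => *; exact: sqr_ge0.
rewrite le_eqVlt; apply/orP; left; apply/eqP; congr (normc _ ^+ 2).
rewrite summxE -big_enum /= enumT; apply: eq_bigr => j _.
rewrite !mxE (bigD1 j)//= !mxE eqxx mulr1 big1 ?addr0 => [|l /negPf lj]; last first.
  by rewrite !mxE lj !mulr0.
rewrite vn_pairing_lreg; last by apply: umul; eexists; eexists.
have := @corner_lreg F i j (s i * (s j)^-1)%g; rewrite mxE eqxx => /= ->.
by rewrite mulr1 [in RHS](mulrC (k _ _)).
Qed.

End herz_schur.

(** * The Hahn-Banach theorem *)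

Section sublinear.
Context (R : realType) (V : lmodType R) (D : set V).
Hypothesis D0 : D 0.
Hypothesis DD : forall x y, D x -> D y -> D (x + y).
Hypothesis DZ : forall (t : R) x, D x -> D (t *: x).
Implicit Types (p q : V -> R) (x y z : V) (t : R).

(** Homogeneity is stated as an inequality for positive scalars, the part that survives infima;
    equality follows by scaling back. Everything is relative to [D], the bounded functions in the
    application, because the distances used there are finite only on them. *)
Definition sublinear p : Prop :=
  (forall x y, D x -> D y -> p (x + y) <= p x + p y) /\
  (forall t x, 0 < t -> D x -> p (t *: x) <= t * p x).

Definition le_on p q : Prop := forall x, D x -> p x <= q x.

Let DN x : D x -> D (- x).
Proof. by move=> Dx; rewrite -scaleN1r; exact: DZ. Qed.

Lemma sublinear0 p : sublinear p -> p 0 = 0.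
Proof.
move=> [pD pZ]; have := pD 0 0 D0 D0; rewrite addr0 => h1.
have h : 0 < 2^-1 :> R by rewrite invr_gt0.
have := pZ _ 0 h D0; rewrite scaler0 => h2.
have : p 0 <= 2^-1 * p 0 by [].
by apply: contra_leP; lra.
Qed.

Lemma sublinearZ p t x : sublinear p -> 0 <= t -> D x -> p (t *: x) = t * p x.
Proof.
move=> sp; rewrite le_eqVlt => /orP[/eqP <- Dx|t0 Dx].
  by rewrite scale0r sublinear0// mul0r.
have [pD pZ] := sp; apply/le_anti; rewrite pZ//= -ler_pdivlMl//.
have tV : 0 < t^-1 by rewrite invr_gt0.
have := pZ _ _ tV (DZ t Dx).
by rewrite scalerA mulVf ?gt_eqF// scale1r.
Qed.

(** The lower bound by [p] alone that makes the infimum over a chain finite. *)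
Lemma sublinear_lb p q x : sublinear q -> le_on q p -> D x -> - p (- x) <= q x.
Proof.
move=> sq qp Dx; have [qD _] := sq.
have := qD x (- x) Dx (DN Dx); rewrite subrr sublinear0// => h.
by have := qp _ (DN Dx); lra.
Qed.

Section shift.
Variables (p : V -> R) (x : V).
Hypotheses (sp : sublinear p) (Dx : D x).

Let S y : set R := [set p (y + t *: x) - t * p x | t in [set t : R | 0 <= t]].

(** The classical lowering of [p] along the ray of [x]. It stays sublinear and below [p], and
    evaluation with t = 1 compares p(y + x) with p(y) + p(x) from below once [p] cannot be lowered
    any more. *)
Definition shift y : R := inf (S y).

Let S_lb y : D y -> lbound (S y) (- p (- y)).
Proof.
move=> Dy _ [t /= t0 <-]; have [pD _] := sp.
have := pD (y + t *: x) (- y) (DD Dy (DZ t Dx)) (DN Dy).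
by rewrite addrAC subrr add0r sublinearZ//; lra.
Qed.

Let S_inf y : D y -> has_inf (S y).
Proof.
move=> Dy; split; last by exists (- p (- y)); exact: S_lb.
by exists (p (y + 0 *: x) - 0 * p x), 0 => //=.
Qed.

Lemma shift_le y t : D y -> 0 <= t -> shift y <= p (y + t *: x) - t * p x.
Proof. by move=> Dy t0; apply: ge_inf; [case: (S_inf Dy)|exists t]. Qed.

Let shift_ge y c : D y -> (forall t, 0 <= t -> c <= p (y + t *: x) - t * p x) ->
  c <= shift y.
Proof.
move=> Dy H; apply: lb_le_inf; first by case: (S_inf Dy).
by move=> _ [t t0 <-]; exact: H.
Qed.

Lemma shift_le_self : le_on shift p.
Proof.
by move=> y Dy; have := shift_le Dy (lexx 0); rewrite scale0r addr0 mul0r subr0.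
Qed.

Lemma sublinear_shift : sublinear shift.
Proof.
have [pD pZ] := sp; split=> [y z Dy Dz|c y c0 Dy].
  rewrite -lerBlDr; apply: shift_ge => // t t0.
  rewrite lerBlDr -lerBlDl; apply: shift_ge => // s s0.
  have := shift_le (DD Dy Dz) (addr_ge0 t0 s0).
  have := pD (y + t *: x) (z + s *: x) (DD Dy (DZ t Dx)) (DD Dz (DZ s Dx)).
  rewrite addrACA -scalerDl mulrDl; lra.
rewrite -ler_pdivrMl//; apply: shift_ge => // t t0.
rewrite ler_pdivrMl//.
have := shift_le (DZ c Dy) (mulr_ge0 (ltW c0) t0).
have Dyt : D (y + t *: x) by exact: DD Dy (DZ t Dx).
by rewrite -scalerA -scalerDr (sublinearZ sp (ltW c0) Dyt) mulrBr mulrA.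
Qed.

End shift.

Lemma sublinear_chain p (A : set (V -> R)) : sublinear p -> A !=set0 ->
  (forall q, A q -> sublinear q /\ le_on q p) ->
  (forall q r, A q -> A r -> le_on q r \/ le_on r q) ->
  exists q, [/\ sublinear q, le_on q p & forall r, A r -> le_on q r].
Proof.
move=> sp [q0 Aq0] AH Atot.
pose S x := [set r x | r in A].
have S0 x : S x !=set0 by exists (q0 x), q0.
have Slb x : D x -> lbound (S x) (- p (- x)).
  by move=> Dx _ [r Ar <-]; have [sr rp] := AH r Ar; exact: sublinear_lb.
have Sinf x : D x -> has_inf (S x).
  by move=> Dx; split=> //; exists (- p (- x)); exact: Slb.
have qle r x : D x -> A r -> inf (S x) <= r x.
  by move=> Dx Ar; apply: ge_inf; [case: (Sinf x Dx)|exists r].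
exists (fun x => inf (S x)); split; last first.
- by move=> r Ar x Dx; exact: qle.
- by move=> x Dx; apply: le_trans (qle q0 x Dx Aq0) _; case: (AH q0 Aq0) => _; apply.
- split=> [x y Dx Dy|t x t0 Dx]; last first.
    rewrite -ler_pdivrMl//; apply: lb_le_inf => // _ [r Ar <-].
    rewrite ler_pdivrMl//; apply: le_trans (qle r _ (DZ t Dx) Ar) _.
    by have [[_ rZ] _] := AH r Ar; exact: rZ.
  apply/ler_addgt0Pr => e e0; have e2 : 0 < e / 2 by rewrite divr_gt0.
  have [_ [r Ar <-] rx] := inf_adherent e2 (Sinf x Dx).
  have [_ [s As <-] sy] := inf_adherent e2 (Sinf y Dy).
  (* Totality of the chain yields one member that is almost minimal at both points. *)
  wlog rs : r s Ar As rx sy / le_on r s.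
    move=> W; have [rs|sr] := Atot r s Ar As; first exact: (W r s).
    have := W s s As As _ sy (fun x _ => lexx (s x)); apply.
    by apply: le_lt_trans rx; exact: sr.
  have ry := le_lt_trans (rs y Dy) sy.
  have [[rD _] _] := AH r Ar.
  apply: le_trans (qle r _ (DD Dx Dy) Ar) _; apply: le_trans (rD _ _ Dx Dy) _.
  by move: rx ry; lra.
Qed.

(** Hahn-Banach: a minimal sublinear functional below [p] is linear, because it
    coincides with its own shifts. *)
Lemma hahn_banach p x0 : sublinear p -> D x0 -> exists f : V -> R,
  [/\ forall x y, D x -> D y -> f (x + y) = f x + f y,
      forall t x, D x -> f (t *: x) = t * f x, le_on f p & p x0 <= f x0].
Proof.
(* Starting from the shift in the direction [x0], which is at most - p x0 at - x0, ensures that any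
   linear functional below it is at least p x0 at [x0]. *)
move=> sp Dx0; pose p' := shift p x0.
have sp' : sublinear p' by exact: sublinear_shift.
have p'p : le_on p' p by exact: shift_le_self.
pose T := {q : V -> R | sublinear q /\ le_on q p'}.
pose t0 : T := exist _ p' (conj sp' (fun x _ => lexx (p' x))).
(* The order is reversed, so that a maximal element for Zorn's lemma is a minimal functional. *)
pose rel (a b : T) : bool := `[< le_on (sval b) (sval a) >].
have [|a b c /asboolP ab /asboolP bc|A Atot|[m [sm mp']] mmin] := @ZL_preorder T t0 rel.
- by move=> a; apply/asboolP => x _.
- by apply/asboolP => x Dx; apply: le_trans (bc x Dx) (ab x Dx).
- have [A0|/set0P[a0 Aa0]] := eqVneq A set0.
    by exists t0 => s; rewrite A0.
  have [||q r|q [sq qp' qA]] := @sublinear_chain p' [set sval a | a in A] sp'.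
  + by exists (sval a0), a0.
  + by move=> _ [a _ <-]; exact: svalP a.
  + move=> [a Aa <-] [b Ab <-].
    by have [/asboolP h|/asboolP h] := Atot a b Aa Ab; [right|left].
  exists (exist _ q (conj sq qp')) => s As; apply/asboolP => /=.
  by apply: qA; exists s.
have mle q : sublinear q -> le_on q m -> le_on m q.
  move=> sq qm.
  have qp' : le_on q p' by move=> x Dx; apply: le_trans (qm x Dx) (mp' x Dx).
  have /mmin : rel (exist _ m (conj sm mp')) (exist _ q (conj sq qp')).
    by apply/asboolP.
  by move=> /asboolP.
have mD x y : D x -> D y -> m (x + y) = m x + m y.
  move=> Dx Dy; apply/le_anti/andP; split; first by have [h _] := sm; exact: h.
  have := mle _ (sublinear_shift sm Dx) (shift_le_self sm Dx) y Dy.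
  have := shift_le sm Dx Dy ler01; rewrite scale1r mul1r addrC => h1 h2.
  by have := le_trans h2 h1; rewrite [y + x]addrC; lra.
have mN x : D x -> m (- x) = - m x.
  move=> Dx; have := mD x (- x) Dx (DN Dx); rewrite subrr sublinear0//; lra.
exists m; split=> //.
- move=> t x Dx; have [t0'|t0'] := leP 0 t; first exact: sublinearZ.
  have := @sublinearZ m (- t) x sm _ Dx; rewrite oppr_ge0 ltW// => /(_ isT).
  by rewrite scaleNr mN ?mulNr; [move=> /oppr_inj|exact: DZ].
- by move=> x Dx; apply: le_trans (mp' x Dx) (p'p x Dx).
- have := mp' _ (DN Dx0); rewrite mN//.
  have := shift_le sp Dx0 (DN Dx0) ler01.
  by rewrite scale1r addNr sublinear0// mul1r -/p'; lra.
Qed.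

End sublinear.

(** * Separation from a subspace in the sup norm *)

Section separation.
Context (R : realType) (W : Type).
Local Notation V := (W -> R^o).
Implicit Types (g h : V) (M : set V).

Definition sup_bounded g : Prop := exists c : R, forall w, `|g w| <= c.

(** The values of [f] on unbounded functions are irrelevant. *)
Definition sup_functional (f : V -> R) : Prop :=
  [/\ forall g h, sup_bounded g -> sup_bounded h -> f (g + h) = f g + f h,
      forall t g, sup_bounded g -> f (t *: g) = t * f g &
      forall g (c : R), 0 <= c -> (forall w, `|g w| <= c) -> `|f g| <= c].

Lemma sup_boundedZ (t : R) g : sup_bounded g -> sup_bounded (t *: g).
Proof.
move=> [a ga]; exists (`|t| * a) => w.
by rewrite [X in `|X|](_ : _ = t * g w)// normrM ler_wpM2l.
Qed.

Lemma sup_boundedD g h : sup_bounded g -> sup_bounded h -> sup_bounded (g + h).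
Proof.
move=> [a ga] [b hb]; exists (a + b) => w.
by apply: le_trans (ler_normD _ _) _; exact: lerD.
Qed.

Lemma sup_bounded_lin (t : R) (g h : W -> R) : sup_bounded g -> sup_bounded h ->
  sup_bounded (fun w => t * g w + h w).
Proof. by move=> bg bh; exact: sup_boundedD (sup_boundedZ t bg) bh. Qed.

Lemma sup_functional_lin (f : V -> R) (t : R) (g h : W -> R) : sup_functional f ->
  sup_bounded g -> sup_bounded h -> f (fun w => t * g w + h w) = t * f g + f h.
Proof.
move=> [fD fZ _] bg bh; rewrite -fZ//.
exact: (fD (t *: (g : V)) h (sup_boundedZ t bg) bh).
Qed.

Lemma separation M g1 (d : R) : 0 < d -> sup_bounded g1 ->
  (forall h, M h -> sup_bounded h) -> M 0 ->
  (forall h k, M h -> M k -> M (h + k)) -> (forall (t : R) h, M h -> M (t *: h)) ->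
  (forall h, M h -> exists w, d <= `|g1 w - h w|) ->
  exists f : V -> R, [/\ sup_functional f, forall h, M h -> f h = 0 & 0 < f g1].
Proof.
move=> d0 bg1 Mb M0 MD MZ Md.
have b0 : sup_bounded 0 by exists 0 => w; rewrite normr0.
have bD := sup_boundedD; have bZ := sup_boundedZ.
(* The infimum of [S g] is the sup norm distance from [g] to [M]. A functional below this quotient
   seminorm vanishes on [M] and is bounded by the sup norm. *)
pose S g : set R := [set c | 0 <= c /\ exists2 h, M h & forall w, `|g w - h w| <= c].
have S0 g : sup_bounded g -> S g !=set0.
  move=> [c gc]; exists `|c|; split=> //; exists 0 => // w.
  by rewrite subr0; apply: le_trans (gc w) (ler_norm c).
have Slb g : lbound (S g) 0 by move=> c [].
have Sinf g : sup_bounded g -> has_inf (S g).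
  by move=> bg; split; [exact: S0|exists 0; exact: Slb].
pose p g := inf (S g).
have p_le g c : S g c -> p g <= c.
  by move=> Sc; apply: ge_inf => //; exists 0; exact: Slb.
have sp : sublinear sup_bounded p.
  split=> [g h bg bh|t g t0 bg].
    apply/ler_addgt0Pr => e e0; have e2 : 0 < e / 2 by rewrite divr_gt0.
    have [a [a0 [x Mx gx]] ga] := inf_adherent e2 (Sinf g bg).
    have [b [b0' [y My hy]] hb] := inf_adherent e2 (Sinf h bh).
    apply: (@le_trans _ _ (a + b)); last first.
      by move: ga hb; rewrite -/(p g) -/(p h); lra.
    apply: p_le; split; first exact: addr_ge0.
    exists (x + y) => [|w]; first exact: MD.
    rewrite [X in `|X|](_ : _ = (g w - x w) + (h w - y w)); last first.
      by change (g w + h w - (x w + y w) = (g w - x w) + (h w - y w)); ring.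
    by apply: le_trans (ler_normD _ _) _; exact: lerD.
  rewrite -ler_pdivrMl//; apply: lb_le_inf; first exact: S0.
  move=> c [c0 [x Mx gx]]; rewrite ler_pdivrMl//; apply: p_le.
  split; first by rewrite mulr_ge0// ltW.
  exists (t *: x) => [|w]; first exact: MZ.
  rewrite [X in `|X|](_ : _ = t * (g w - x w)); last first.
    by change (t * g w - t * x w = t * (g w - x w)); ring.
  by rewrite normrM (gtr0_norm t0) ler_wpM2l// ltW.
have [f [fD fZ fp fg1]] := hahn_banach b0 bD bZ sp bg1.
have fN g : sup_bounded g -> f (- g) = - f g.
  by move=> bg; rewrite -scaleN1r fZ// mulN1r.
have bN g : sup_bounded g -> sup_bounded (- g).
  by move=> bg; rewrite -scaleN1r; exact: bZ.
exists f; split=> [|h Mh|].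
- split=> // g c c0 gc; have bg : sup_bounded g by exists c.
  rewrite ler_norml; apply/andP; split.
    rewrite lerNl -fN//; apply: le_trans (fp _ (bN _ bg)) _; apply: p_le; split=> //.
    by exists 0 => // w; rewrite subr0 normrN.
  apply: le_trans (fp _ bg) _; apply: p_le; split=> //.
  by exists 0 => // w; rewrite subr0.
- have pM k : M k -> f k <= 0.
    move=> Mk; apply: le_trans (fp _ (Mb _ Mk)) _; apply: p_le; split=> //.
    by exists k => // w; rewrite subrr normr0.
  have := pM h Mh; have : f (- h) <= 0.
    by apply: pM; rewrite -scaleN1r; exact: MZ.
  by rewrite fN ?oppr_le0 => [h1 h2|]; [apply/le_anti/andP; split|exact: Mb].
- apply: lt_le_trans fg1; apply: lt_le_trans d0 _; apply: lb_le_inf; first exact: S0.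
  move=> c [c0 [x Mx gx]]; have [w dw] := Md x Mx.
  exact: le_trans dw (gx w).
Qed.

End separation.

Lemma kernel_le_unit2 (R : realType) (A : eqType) (F : seq A)
    (k : A -> A -> R[i]) (M : R) : 0 <= M ->
  (forall a b, vnorm F a <= 1 -> vnorm F b <= 1 ->
     normc (\sum_(x <- F) \sum_(y <- F) k x y * a y * b x) <= M) ->
  kernel_le F k M.
Proof.
move=> M0 H; apply: kernel_le_unit => // a a1.
set w := fun x => _; set t := vnorm F w; have t0 : 0 <= t by exact: vnorm_ge0.
have [->//|tn0] := eqVneq t 0.
have nt : normc (t%:C)^-1 = t^-1 by rewrite normcV normc_real ger0_norm.
have := H a (fun x => (t%:C)^-1 * (w x)^*) a1.
rewrite vnormZ vnorm_conj nt mulVf// => /(_ (lexx _)).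
have -> : \sum_(x <- F) \sum_(y <- F) k x y * a y * ((t%:C)^-1 * (w x)^*) =
    (t%:C)^-1 * (t ^+ 2)%:C.
  rewrite /t vnorm_sqr raddf_sum mulr_sumr; apply: eq_bigr => x _ /=.
  by rewrite -mulc_conj -mulr_suml -/(w x); ring.
by rewrite normcM nt normc_real ger0_norm ?sqr_ge0// expr2 mulKf.
Qed.

(** * The approximation property *)

Section finite_support.
Context (R : realType) (G : groupType).
Local Notation C := R[i].
Implicit Types (u v : G -> C).

Lemma finitely_supportedP v : finitely_supported v <->
  exists2 S : seq G, uniq S & forall s, s \notin S -> v s = 0.
Proof.
split=> [/finite_seqP [S vS]|[S uS vS]].
  exists (undup S) => [|s]; first exact: undup_uniq.
  rewrite mem_undup => sS; apply/eqP; apply: contraNT sS => vs0.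
  by have : [set s | v s != 0] s by []; rewrite vS.
apply: (@sub_finite_set _ _ [set` S]); last exact: finite_seq.
by move=> s /= vs0; apply: contraNT vs0 => /vS ->.
Qed.

Lemma finitely_supported_mul v u : finitely_supported v ->
  finitely_supported (v \* u).
Proof.
move=> /finitely_supportedP [S uS vS]; apply/finitely_supportedP; exists S => //.
by move=> s /vS /= ->; rewrite mul0r.
Qed.

Lemma finitely_supported_fourier v : finitely_supported v -> in_fourier v.
Proof.
move=> /finitely_supportedP [S uS vS].
(* Translation by t carries the basis vector of the unit to that of t; the conjugates compensate the
   conjugate linearity of [dot] in its second argument. *)
exists (Defs.basis R 1%g), (\sum_(s <- S) (v s)^* *: Defs.basis R s).
apply/funext => t; rewrite /coeff.
have -> : lreg t (Defs.basis R 1%g) = Defs.basis R t.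
  apply: l2P => p; rewrite lregE !basisE; congr (_%:R); congr nat_of_bool.
  by rewrite -(inj_eq (@mulgI _ t)) mulVKg mulg1.
rewrite dot_conj dot_basis l2_sumE.
under eq_bigr do rewrite l2_scaleE basisE.
have [tS|tS] := boolP (t \in S).
  rewrite (bigD1_seq t)//= eqxx mulr1 big1 ?addr0 ?conjcK// => s /negPf.
  by rewrite eq_sym => ->; rewrite mulr0.
rewrite big_seq big1 ?conjc0 ?vS// => s sS; case: eqVneq => [ts|_]; last by rewrite mulr0.
by rewrite ts sS in tS.
Qed.

Lemma fourier_schur_le v : in_fourier v ->
  exists2 M : R, 0 <= M & schur_le (toeplitz v) M.
Proof.
move=> [x [y ->]]; exists (l2norm x * l2norm y); last exact: schur_le_coeff.
by rewrite mulr_ge0 ?l2norm_ge0.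
Qed.

End finite_support.

Section tails.
Context (R : realType) (J : Type) (le : J -> J -> Prop).
Hypothesis dir : directed le.

Lemma tails_cvg_real (h : J -> R) : h i @[i --> tails le] --> (0 : R) ->
  forall e : R, 0 < e -> exists i, `|h i| < e.
Proof.
move=> hc e e0; have /hc : nbhs (0 : R) (ball (0 : R) e) by exact: nbhsx_ballx.
case=> i0 Hi; exists i0; have [_ refl _ _] := dir.
by have := Hi _ (refl i0); rewrite /ball /= sub0r normrN.
Qed.

Lemma tails_cvg_ereal (h : J -> \bar R) : h i @[i --> tails le] --> 0%E ->
  forall e : R, 0 < e -> exists i0, forall i, le i0 i -> (h i < e%:E)%E.
Proof.
move=> hc e e0.
have /hc : nbhs (0%E : \bar R) [set x | (x < e%:E)%E].
  apply: open_nbhs_nbhs; split; last by rewrite /= lte_fin.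
  exact: open_ereal_lt_ereal.
by case=> i0 Hi; exists i0 => i /Hi.
Qed.

Lemma cvg_tails_ereal (h : J -> \bar R) : (forall i, (0 <= h i)%E) ->
  (forall e : R, 0 < e -> exists i0, forall i, le i0 i -> (h i <= e%:E)%E) ->
  h i @[i --> tails le] --> 0%E.
Proof.
move=> h0 H A /= [e /= e0 eA].
have [i0 Hi] := H _ (divr_gt0 e0 (ltr0n R 2)).
exists i0 => i /Hi hi; change (A (h i)); move: (h0 i) hi.
case: (h i) => [r|//|//]; rewrite !lee_fin => r0 re.
apply: eA; rewrite /= sub0r normrN ger0_norm//; apply: le_lt_trans re _.
by rewrite ltr_pdivrMr// ltr_pMr// ltr1n.
Qed.

End tails.

(** * From the approximation property to norm approximation *)

Section approximation.
Context (R : realType) (G : groupType).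
Local Notation C := R[i].
Implicit Types (u v : G -> C) (F : seq G) (k : G -> G -> C).

Definition band_approx u : Prop := forall e : R, 0 < e -> exists E : seq G,
  forall F k, uniq F -> kernel_le F k 1 -> exists B : G -> G -> C,
    (forall p q, (p * q^-1)%g \notin E -> B p q = 0) /\
    kernel_le F (fun p q => toeplitz u p q * k p q - B p q) e.

Record test := Test { test_dom : seq G; test_ker : G -> G -> C;
  test_a : G -> C; test_b : G -> C; test_uniq : uniq test_dom;
  test_ker1 : kernel_le test_dom test_ker 1;
  test_a1 : vnorm test_dom test_a <= 1; test_b1 : vnorm test_dom test_b <= 1 }.

Definition test_form (k : G -> G -> C) (t : test) : C :=
  \sum_(p <- test_dom t) \sum_(q <- test_dom t) k p q * test_a t q * test_b t p.

Lemma test_form_le k t M : 0 <= M -> kernel_le (test_dom t) k M ->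
  normc (test_form k t) <= M.
Proof.
move=> M0 kM; apply: le_trans (kM _ _) _; rewrite -mulrA ler_piMr//.
by rewrite mulr_ile1 ?vnorm_ge0 ?test_a1 ?test_b1.
Qed.

Lemma test_form_lin (c : C) k k' t :
  test_form (fun p q => c * k p q + k' p q) t = c * test_form k t + test_form k' t.
Proof.
rewrite /test_form mulr_sumr -big_split; apply: eq_bigr => p _ /=.
by rewrite mulr_sumr -big_split; apply: eq_bigr => q _ /=; ring.
Qed.

Section functional.
Variable f : (test -> R) -> R.
Hypothesis fP : sup_functional f.

(** The complex linear extension of the real functional [f]. *)
Definition complexify (h : test -> C) : C :=
  f (fun w => complex.Re (h w)) +i* f (fun w => complex.Im (h w)).

Definition bounded_cfun (h : test -> C) : Prop :=
  exists c : R, forall w, normc (h w) <= c.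

Lemma sup_bounded_Re h : bounded_cfun h -> sup_bounded (fun w => complex.Re (h w)).
Proof. by move=> [a ha]; exists a => w; apply: le_trans (normc_Re _) (ha w). Qed.

Lemma sup_bounded_Im h : bounded_cfun h -> sup_bounded (fun w => complex.Im (h w)).
Proof. by move=> [a ha]; exists a => w; apply: le_trans (normc_Im _) (ha w). Qed.

Lemma bounded_cfun_lin (c : C) g h : bounded_cfun g -> bounded_cfun h ->
  bounded_cfun (fun w => c * g w + h w).
Proof.
move=> [a ga] [b hb]; exists (normc c * a + b) => w.
apply: le_trans (ler_normcD _ _) _; apply: lerD => //.
by rewrite normcM ler_wpM2l ?normc_ge0.
Qed.

Lemma complexify_lin (c : C) g h : bounded_cfun g -> bounded_cfun h ->
  complexify (fun w => c * g w + h w) = c * complexify g + complexify h.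
Proof.
move=> bg bh; have rg := sup_bounded_Re bg; have ig := sup_bounded_Im bg.
have rh := sup_bounded_Re bh; have ih := sup_bounded_Im bh.
case: c => r s; rewrite /complexify.
have -> : (fun w => complex.Re ((r +i* s) * g w + h w)) =
    (fun w => r * complex.Re (g w) + (- s * complex.Im (g w) + complex.Re (h w))).
  by apply/funext => w; case: (g w) (h w) => ? ? [? ?] /=; ring.
have -> : (fun w => complex.Im ((r +i* s) * g w + h w)) =
    (fun w => r * complex.Im (g w) + (s * complex.Re (g w) + complex.Im (h w))).
  by apply/funext => w; case: (g w) (h w) => ? ? [? ?] /=; ring.
rewrite (sup_functional_lin r fP rg (sup_bounded_lin (- s) ig rh)).
rewrite (sup_functional_lin r fP ig (sup_bounded_lin s rg ih)).
rewrite (sup_functional_lin (- s) fP ig rh) (sup_functional_lin s fP rg ih).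
by simpc; congr (_ +i* _); ring.
Qed.

Lemma complexify_le h (c : R) : (forall w, normc (h w) <= c) -> 0 <= c ->
  normc (complexify h) <= c *+ 2.
Proof.
move=> hc c0; apply: le_trans (normc_le_ReIm _) _; rewrite mulr2n.
by have [_ _ f_le] := fP; apply: lerD; apply: f_le => // w; apply: le_trans (hc w);
  [exact: normc_Re|exact: normc_Im].
Qed.

Lemma complexify0 : complexify (fun=> 0) = 0.
Proof.
have b0 : bounded_cfun (fun=> 0) by exists 0 => w; rewrite normc0E.
transitivity (complexify (fun=> -1 * 0 + 0)).
  by congr complexify; apply/funext => w; rewrite mulr0 addr0.
by rewrite (complexify_lin (-1) b0 b0); ring.
Qed.

Lemma complexify_sum (I : Type) (r : seq I) (c : I -> C) (h : I -> test -> C) :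
  (forall i, bounded_cfun (h i)) ->
  bounded_cfun (fun w => \sum_(i <- r) c i * h i w) /\
  complexify (fun w => \sum_(i <- r) c i * h i w) =
  \sum_(i <- r) c i * complexify (h i).
Proof.
move=> bh; elim: r => [|i r [bs IH]].
  have -> : (fun w => \sum_(i <- [::]) c i * h i w) = (fun=> 0).
    by apply/funext => w; rewrite big_nil.
  by rewrite big_nil complexify0; split=> //; exists 0 => w; rewrite normc0E.
have -> : (fun w => \sum_(j <- i :: r) c j * h j w) =
    (fun w => c i * h i w + \sum_(j <- r) c j * h j w).
  by apply/funext => w; rewrite big_cons.
rewrite big_cons complexify_lin// IH; split=> //; exact: bounded_cfun_lin.
Qed.

End functional.

Lemma schur_le_finsupp v : finitely_supported v ->
  exists2 M : R, 0 <= M & schur_le (toeplitz v) M.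
Proof. by move/finitely_supported_fourier/fourier_schur_le. Qed.

Lemma herz_schur_m_norm v (M : R) : herz_schur v -> (m_norm v <= M%:E)%E ->
  schur_le (toeplitz v) M.
Proof.
move=> /herz_schur_schur_le [K _ vK] vM.
exact: schur_le_cb_norm (Smap_implements vK) vM.
Qed.

(** Otherwise Hahn-Banach yields a functional annihilating the products of [u]
    with finitely supported functions but not [u]; by [band_approx] it lies in
    the predual, which contradicts (AP). *)
Theorem approximation_property_band u (M e : R) : approximation_property R G ->
  schur_le (toeplitz u) M -> band_approx u -> 0 < e ->
  exists2 v, finitely_supported v & schur_le (toeplitz (u - v)) e.
Proof.
move=> [J [le [v [dir vHS vw]]]] uM uB e0; apply: contrapT => noapprox.
have M0 := schur_le_ge0 1%g uM.
(* The product of [u] with the test matrix is kept as one factor, to be replaced by a banded matrix,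
   and [x] enters linearly. *)
pose g (x : G -> C) (w : test) : C :=
  test_form (fun p q => toeplitz x p q * (toeplitz u p q * test_ker w p q)) w.
have g_lin c x y w : g (fun s => c * x s + y s) w = c * g x w + g y w.
  rewrite /g -test_form_lin; congr (\sum_(p <- _) _); apply/funext => p.
  by congr (\sum_(q <- _) _); apply/funext => q; rewrite /toeplitz; ring.
have g_le x K w : 0 <= K -> schur_le (toeplitz x) K -> normc (g x w) <= K * M.
  move=> K0 xK; apply: test_form_le; first exact: mulr_ge0.
  apply: schur_leZ => //; first exact: test_uniq.
  by apply: uM; [exact: test_uniq|exact: test_ker1].
have g_bd x K : 0 <= K -> schur_le (toeplitz x) K -> bounded_cfun (g x).
  by move=> K0 xK; exists (K * M) => w; exact: g_le.
have one1 : schur_le (toeplitz (fun _ : G => 1 : C)) 1.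
  by move=> F k uF; apply: eq_kernel_le => p q; rewrite /toeplitz mul1r.
have g0 w : g (fun=> 0) w = 0.
  transitivity (g (fun=> -1 * 0 + 0) w).
    by congr g; apply/funext => s; rewrite mulr0 addr0.
  by rewrite (g_lin (-1) (fun=> 0) (fun=> 0) w); ring.
have g1b := g_bd _ _ ler01 one1.
pose Msub : set (test -> R^o) := [set h | exists2 x, finitely_supported x &
  h = fun w => complex.Re (g x w)].
have fs0 : finitely_supported (fun _ : G => 0 : C).
  by apply/finitely_supportedP; exists [::].
have fs_lin (c : C) (x y : G -> C) : finitely_supported x -> finitely_supported y ->
    finitely_supported (fun s => c * x s + y s).
  move=> /finitely_supportedP [S uS xS] /finitely_supportedP [T uT yT].
  apply/finitely_supportedP; exists (undup (S ++ T)) => [|s]; first exact: undup_uniq.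
  by rewrite mem_undup mem_cat negb_or => /andP[/xS -> /yT ->]; rewrite mulr0 addr0.
have fsb x : finitely_supported x -> bounded_cfun (g x).
  by move=> /schur_le_finsupp [K K0 xK]; exact: g_bd xK.
have [f [fP fM f1]] : exists f : (test -> R^o) -> R,
    [/\ sup_functional f, forall h, Msub h -> f h = 0 &
       0 < f (fun w => complex.Re (g (fun=> 1) w))].
  apply: (separation e0).
  - exact: sup_bounded_Re.
  - by move=> h [x xf ->]; exact/sup_bounded_Re/fsb.
  - exists (fun=> 0) => //; apply/funext => w.
    by rewrite g0.
  - move=> _ _ [x xf ->] [y yf ->]; exists (fun s => 1 * x s + y s); first exact: fs_lin.
    apply/funext => w; rewrite g_lin mul1r.
    change (complex.Re (g x w) + complex.Re (g y w) = complex.Re (g x w + g y w)).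
    by case: (g x w) (g y w) => ? ? [].
  - move=> t _ [x xf ->]; exists (fun s => t%:C * x s + 0); first exact: (fs_lin _ _ (fun=> 0)).
    apply/funext => w; rewrite (g_lin _ _ (fun=> 0)) g0 addr0.
    change (t * complex.Re (g x w) = complex.Re (t%:C * g x w)).
    by case: (g x w) => ? ? /=; ring.
  - move=> _ [x xf ->]; apply: contrapT => H; apply: noapprox.
    exists (x \* u); first exact: finitely_supported_mul.
    move=> F k uF k1; apply: kernel_le_unit2; first exact: ltW.
    move=> a b a1 b1; set z := \sum_(_ <- _) _.
    (* The phase of the form is absorbed into one test vector, so real parts of the forms already
       detect its modulus. *)
    have [c c1 cz] := unimodular z.
    have ca1 : vnorm F (fun q => c * a q) <= 1 by rewrite vnormZ c1 mul1r.
    pose w := Test uF k1 ca1 b1.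
    have gw : g (fun=> 1) w - g x w = (normc z)%:C.
      rewrite -cz /g /test_form /z /= -sumrB mulr_sumr; apply: eq_bigr => p _.
      rewrite -sumrB mulr_sumr; apply: eq_bigr => q _; rewrite /toeplitz /=.
      set r := (p * q^-1)%g.
      have -> : (u - x \* u) r = u r - x r * u r by [].
      by ring.
    rewrite leNgt; apply/negP => ze; apply: H; exists w.
    rewrite -raddfB gw /= ger0_norm ?normc_ge0//; exact: ltW.
pose W (x : G -> C) : C := complexify f (g x).
have W1 : W (fun=> 1) != 0.
  apply/eqP => /(congr1 (@complex.Re R)) /= h; by rewrite h ltxx in f1.
have W0 x : finitely_supported x -> W x = 0.
  move=> xf; rewrite /W /complexify fM; last by exists x.
  (* Multiplication by - i turns the imaginary part into the real part of another element of the
     subspace, so both parts of [W x] vanish. *)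
  rewrite fM//; exists (fun s => (0 -i* 1) * x s + 0); first exact: (fs_lin _ _ (fun=> 0)).
  apply/funext => w; rewrite (g_lin _ _ (fun=> 0)) g0 addr0.
  by case: (g x w) => ? ? /=; ring.
have HSb x : herz_schur x -> bounded_cfun (g x).
  by move=> /herz_schur_schur_le [K K0 xK]; exact: g_bd xK.
have Wpre : predual W.
  split=> [c x y xH yH|d d0].
    rewrite /W -(complexify_lin fP)//; try exact: HSb.
    by congr complexify; apply/funext => w; rewrite -g_lin.
  (* Half of [d], because [complexify_le] treats real and imaginary parts separately and loses a
     factor 2. *)
  have d20 : 0 < d / 2 by rewrite divr_gt0.
  have [E HE] := uB _ d20.
  have /choice [B HB] : forall w : test, exists B : G -> G -> C,
      (forall p q, (p * q^-1)%g \notin E -> B p q = 0) /\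
      kernel_le (test_dom w) (fun p q => toeplitz u p q * test_ker w p q - B p q) (d / 2).
    by move=> w; apply: HE; [exact: test_uniq|exact: test_ker1].
  (* [h r] tests the part of [B w] on the diagonal p q^-1 = r. Since [B w] vanishes off the band,
     its Schur product with [toeplitz x] is tested by the sum over [E] of x r times [h r], and the
     values of the functional on the [h r] form the required element of l^1. *)
  pose h (r : G) (w : test) : C :=
    test_form (fun p q => (r == p * q^-1)%g%:R * B w p q) w.
  have BM w : kernel_le (test_dom w) (B w) (M + d / 2).
    have [_ Bd] := HB w.
    have uk := uM _ _ (test_uniq w) (@test_ker1 w).
    by apply: eq_kernel_le (kernel_leB uk Bd) => p q; rewrite opprB addrC subrK.
  have hb r : bounded_cfun (h r).
    have rf : finitely_supported (fun s : G => (r == s)%:R : C).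
      apply/finitely_supportedP; exists [:: r] => // s.
      by rewrite inE eq_sym => /negPf ->.
    have [K K0 rK] := schur_le_finsupp rf.
    exists (K * (M + d / 2)) => w; apply: test_form_le.
      by rewrite mulr_ge0// addr_ge0// ltW.
    apply: (schur_leZ _ (test_uniq w) rK (BM w)).
    by rewrite addr_ge0// ltW.
  pose E' := undup E.
  pose f0 (r : G) : C := if r \in E' then complexify f (h r) else 0.
  have f0E r : r \notin E' -> f0 r = 0 by rewrite /f0 => /negPf ->.
  exists f0; first exact: abs_summable_fin (undup_uniq E) f0E.
  move=> x xH x1.
  have xS : schur_le (toeplitz x) 1 by exact: herz_schur_m_norm xH x1.
  rewrite (@csum_fin _ _ _ E') ?undup_uniq//; last by move=> r /f0E ->; rewrite mul0r.
  have -> : \sum_(r <- E') f0 r * x r = \sum_(r <- E') x r * complexify f (h r).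
    by apply: eq_big_seq => r rE; rewrite /f0 rE mulrC.
  have [bs <-] := complexify_sum fP E' x hb.
  have -> : W x - complexify f (fun w => \sum_(r <- E') x r * h r w) =
      complexify f (fun w => -1 * (\sum_(r <- E') x r * h r w) + g x w).
    by rewrite (complexify_lin fP)//; [rewrite mulN1r addrC|exact: HSb].
  rewrite [leRHS](_ : d = (d / 2) *+ 2); last by rewrite mulr2n -splitr.
  apply: complexify_le; [exact: fP| |exact: ltW] => w.
  have [B0 Bd] := HB w.
  have -> : -1 * (\sum_(r <- E') x r * h r w) + g x w =
    test_form (fun p q => toeplitz x p q *
      (toeplitz u p q * test_ker w p q - B w p q)) w.
    have -> : \sum_(r <- E') x r * h r w = test_form (fun p q => toeplitz x p q * B w p q) w.
      rewrite /h /test_form; under eq_bigr do rewrite mulr_sumr.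
      rewrite exchange_big; apply: eq_bigr => p _ /=.
      under eq_bigr do rewrite mulr_sumr.
      rewrite exchange_big; apply: eq_bigr => q _ /=.
      have [pqE|pqE] := boolP ((p * q^-1)%g \in E').
        rewrite (bigD1_seq (p * q^-1)%g) ?undup_uniq//= eqxx mul1r big1 ?addr0.
          by rewrite /toeplitz; ring.
        by move=> r /negPf ->; rewrite !mul0r mulr0.
      rewrite B0 ?mulr0 ?mul0r; last by rewrite mem_undup in pqE.
      by rewrite big1// => r _; rewrite mulr0 !mul0r mulr0.
    rewrite /g -test_form_lin; congr (\sum_(p <- _) _); apply/funext => p.
    by congr (\sum_(q <- _) _); apply/funext => q; ring.
  apply: test_form_le; first exact: ltW.
  by have := schur_leZ (ltW d20) (test_uniq w) xS Bd; rewrite mul1r.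
have W1' : 0 < normc (W (fun=> 1)) by rewrite lt0r normc_eq0 W1 normc_ge0.
have [i Hi] := tails_cvg_real dir (vw W Wpre) W1'.
have W0i : W (v i) = 0 by apply: W0; case: (vHS i).
by move: Hi; rewrite W0i sub0r normcNE ger0_norm ?normc_ge0// ltxx.
Qed.

End approximation.

(** * Completely compact multipliers *)

Section hadamard.
Context (R : realType).
Local Notation C := R[i].

(** Schur's inequality: the rows of [k] and the columns of [l] have norms at most [K] and [L], and
    Cauchy-Schwarz in the inner sum separates the two matrices. *)
Lemma kernel_le_hadamard (I : choiceType) (F : seq I) (k l : I -> I -> C) (K L : R) :
  uniq F -> 0 <= K -> 0 <= L -> kernel_le F k K -> kernel_le F l L ->
  kernel_le F (fun p q => k p q * l p q) (K * L).
Proof.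
move=> uF K0 L0 kK lL a b.
pose c p : C := (vnorm F (fun q => l p q * a q))%:C.
have cN : vnorm F c <= L * vnorm F a.
  rewrite -(@ler_pXn2r _ 2) ?nnegrE ?mulr_ge0 ?vnorm_ge0// exprMn !vnorm_sqr.
  under eq_bigr do rewrite normc_real ger0_norm ?vnorm_ge0// vnorm_sqr.
  rewrite exchange_big mulr_sumr big_seq [leRHS]big_seq; apply: ler_sum => q qF /=.
  under eq_bigr do rewrite normcM exprMn.
  rewrite -mulr_suml ler_wpM2r ?sqr_ge0// -vnorm_sqr ler_pXn2r ?nnegrE ?vnorm_ge0//.
  have := kernel_le_vnorm (fun r => (r == q)%:R) L0 lL.
  have -> : vnorm F (fun r => (r == q)%:R : C) = 1.
    rewrite /vnorm (bigD1_seq q)//= eqxx normc1E expr1n big1 ?addr0 ?sqrtr1//.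
    by move=> w /negPf ->; rewrite normc0E expr0n.
  rewrite mulr1; apply: le_trans; rewrite le_eqVlt; apply/orP; left; apply/eqP.
  apply: eq_vnorm => p pF; rewrite (bigD1_seq q)//= eqxx mulr1 big1 ?addr0//.
  by move=> w /negPf ->; rewrite mulr0.
apply: le_trans (_ : K * (vnorm F c * vnorm F b) <= _); last first.
  by rewrite -!mulrA ler_wpM2l// mulrA ler_wpM2r ?vnorm_ge0.
apply: le_trans (ler_wpM2l K0 (cauchy_schwarz _ _ _)).
apply: le_trans (normc_sum _ _) _; rewrite mulr_sumr big_seq [leRHS]big_seq.
apply: ler_sum => p pF; rewrite -mulr_suml normcM mulrA ler_wpM2r ?normc_ge0//.
under eq_bigr do rewrite -mulrA.
apply: le_trans (normc_sum_mul _ _ _) _.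
rewrite normc_real ger0_norm ?vnorm_ge0// ler_wpM2r ?vnorm_ge0//.
exact: kernel_le_row uF pF kK.
Qed.

(** Rows and columns are selected by different maps, as needed to extract from each block of an
    operator matrix its entry at a fixed position. *)
Lemma kernel_le_map2 (A B : eqType) (g h : A -> B) (F : seq A) (k : B -> B -> C) M :
  uniq F -> injective g -> injective h ->
  kernel_le (undup (map g F ++ map h F)) k M ->
  kernel_le F (fun x y => k (g x) (h y)) M.
Proof.
move=> uF gI hI kM a b; set U := undup _ in kM.
have uU : uniq U by exact: undup_uniq.
have gU : {subset map g F <= U} by move=> x xF; rewrite mem_undup mem_cat xF.
have hU : {subset map h F <= U} by move=> x xF; rewrite mem_undup mem_cat xF orbT.
have ug : uniq (map g F) by rewrite map_inj_uniq.
have uh : uniq (map h F) by rewrite map_inj_uniq.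
pose push (f : A -> B) (c : A -> C) z := \sum_(x <- F | f x == z) c x.
have pushE f c x : injective f -> x \in F -> push f c (f x) = c x.
  move=> fI xF; rewrite /push big_mkcond (bigD1_seq x)//= eqxx big1 ?addr0//.
  by move=> y yx; rewrite (inj_eq fI) (negPf yx).
have push0 f c z : z \notin map f F -> push f c z = 0.
  move=> zF; rewrite /push big_seq_cond big1// => x /andP[xF /eqP fx].
  by rewrite -fx map_f in zF.
have vE f c : injective f -> uniq (map f F) -> {subset map f F <= U} ->
    vnorm U (push f c) = vnorm F c.
  move=> fI uf fU; rewrite /vnorm (big_uniq_sub uf uU fU); last first.
    by move=> z /push0 ->; rewrite normc0E expr0n.
  by rewrite big_map; congr Num.sqrt; apply: eq_big_seq => x xF; rewrite pushE.
have := kM (push h a) (push g b); rewrite !vE//.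
suff -> : \sum_(x <- U) \sum_(y <- U) k x y * push h a y * push g b x =
  \sum_(x <- F) \sum_(y <- F) k (g x) (h y) * a y * b x by [].
rewrite (big_uniq_sub ug uU gU); last first.
  by move=> z /push0 ->; rewrite big1// => y _; rewrite mulr0.
rewrite big_map; apply: eq_big_seq => x xF.
rewrite (big_uniq_sub uh uU hU); last by move=> z /push0 ->; rewrite mulr0 mul0r.
by rewrite big_map; apply: eq_big_seq => y yF; rewrite !pushE.
Qed.

(** Lagrange interpolation: the evaluations at finitely many points are
    coordinates on the span of [s]. *)
Lemma interpolation (X : eqType) (V : lmodType C) (ev : X -> V -> C) (D : set V)
    (s : seq V) :
  (forall x c v w, ev x (c *: v + w) = c * ev x v + ev x w) ->
  (forall c v w, D v -> D w -> D (c *: v + w)) -> D 0 ->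
  (forall v, v \in s -> D v) ->
  exists2 L : seq (X * V), (forall z, z \in L -> D z.2) &
    forall v, v \in s -> forall x,
      ev x v = \sum_(z <- L) ev z.1 v * ev x z.2.
Proof.
move=> ev_lin D_lin D0; elim: s => [|v s IH] sD; first by exists [::].
have sv : v \in v :: s by exact: mem_head.
have [L LD Ls] := IH (fun w ws => sD w (mem_behead (s := v :: s) ws)).
pose r := \sum_(z <- L) (- ev z.1 v) *: z.2.
have ev0 x : ev x 0 = 0.
  have := ev_lin x 1 0 0; rewrite scaler0 addr0 mul1r => /eqP.
  by rewrite -subr_eq subrr => /eqP.
have evr x : ev x r = - \sum_(z <- L) ev z.1 v * ev x z.2.
  rewrite /r; elim: (L) => [|z L' IH']; first by rewrite !big_nil ev0 oppr0.
  by rewrite !big_cons ev_lin IH' opprD mulNr.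
have Dr : D r.
  rewrite /r; elim: (L) LD => [|z L' IH'] LD; first by rewrite big_nil.
  rewrite big_cons; apply: D_lin; first exact/LD/mem_head.
  by apply: IH' => z' z'L; apply: LD; rewrite inE z'L orbT.
(* The residual of [v] after interpolation at the present nodes. If all evaluations kill it, [L]
   still serves; otherwise a point [t] that sees it becomes a new node. *)
pose w := 1 *: v + r.
have evw x : ev x w = ev x v - \sum_(z <- L) ev z.1 v * ev x z.2.
  by rewrite ev_lin mul1r evr.
have Dw : D w by apply: D_lin => //; exact: sD.
have [[t wt]|nt] := pselect (exists t, ev t w != 0); last first.
  exists L => // v' /[!inE] /orP[/eqP->|/Ls//] x.
  apply/eqP; rewrite -subr_eq0 -evw; apply/eqP.
  by apply: contrapT => /eqP h; apply: nt; exists x.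
pose n := (ev t w)^-1 *: w + 0.
have Dn : D n by exact: D_lin.
have evn x : ev x n = (ev t w)^-1 * ev x w by rewrite ev_lin ev0 addr0.
(* [n] takes the value 1 at [t], and the old vectors are corrected by multiples of [n] so as to
   vanish there. *)
exists ((t, n) :: map (fun z => (z.1, (- ev t z.2) *: n + z.2)) L).
  move=> z /[!inE] /orP[/eqP->//|/mapP [z' /LD z'D ->]]; exact: D_lin.
move=> v' v's x; rewrite big_cons big_map /=.
have -> : \sum_(z <- L) ev z.1 v' * ev x (- ev t z.2 *: n + z.2) =
    \sum_(z <- L) ev z.1 v' * ev x z.2 - (\sum_(z <- L) ev z.1 v' * ev t z.2) * ev x n.
  by rewrite mulr_suml -sumrB; apply: eq_bigr => z _; rewrite ev_lin; ring.
move: v's; rewrite inE => /orP[/eqP->|v's]; last by rewrite -!Ls// addrCA subrr addr0.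
set S1 := \sum_(z <- L) _ * ev t _; set S2 := \sum_(z <- L) _ * ev x _.
have e1 : ev t w = ev t v - S1 by rewrite evw.
have e2 : ev x w = ev x v - S2 by rewrite evw.
have -> : ev t v = ev t w + S1 by rewrite e1 subrK.
have -> : ev x v = ev x w + S2 by rewrite e2 subrK.
by rewrite evn; field.
Qed.

End hadamard.

(** * The implications of the equivalence *)

Section consequences.
Context (R : realType) (G : groupType).
Local Notation C := R[i].
Local Notation op := (op R G).
Implicit Types (u v f : G -> C) (F : seq G).

Lemma Cr_toeplitz (T : op) p q : Cr_dom T -> entry T p q = entry T (p * q^-1)%g 1%g.
Proof.
move=> /Cr_domP [_ HT]; apply/eqP; rewrite -subr_eq0 -normc_eq0; apply/eqP/le_anti.
rewrite normc_ge0 andbT; apply/ler_addgt0Pr => e e0; rewrite add0r.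
have [f _ Hf] := HT _ (divr_gt0 e0 (ltr0n R 2)).
have H a b : normc (entry T a b - f (a * b^-1)%g) <= e / 2.
  have uU := undup_uniq [:: a; b].
  have aU : a \in undup [:: a; b] by rewrite mem_undup mem_head.
  have bU : b \in undup [:: a; b] by rewrite mem_undup !inE eqxx orbT.
  exact: kernel_le_entry uU aU bU (Hf _ uU).
have := H p q; have := H (p * q^-1)%g 1%g; rewrite divg1 => h1 h2.
have -> : entry T p q - entry T (p * q^-1)%g 1%g =
  (entry T p q - f (p * q^-1)%g) - (entry T (p * q^-1)%g 1%g - f (p * q^-1)%g) by ring.
by rewrite [leRHS](splitr e); exact: le_trans (ler_normcB _ _) (lerD h2 h1).
Qed.

Lemma abs_summable_tail f (e : R) : abs_summable f -> 0 < e ->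
  exists2 S : seq G, uniq S & forall F, uniq F ->
    \sum_(s <- F) normc (if s \in S then 0 else f s) <= e.
Proof.
move=> /abs_summableP [K fK] e0.
have [S uS HS] := @esum_approx R G (fun s => normc (f s)) K (e / 2)
  (fun s => normc_ge0 _) fK (divr_gt0 e0 (ltr0n R 2)).
exists S => // F uF; set U := undup (S ++ F).
have uU : uniq U by exact: undup_uniq.
have sS : {subset S <= U} by move=> z zS; rewrite mem_undup mem_cat zS.
have sF : {subset F <= U} by move=> z zF; rewrite mem_undup mem_cat zF orbT.
have := HS U uU sS; have := HS S uS (fun _ => id).
rewrite !ler_norml => /andP[_ h1] /andP[h2 _].
apply: (@le_trans _ _ (\sum_(s <- U) normc (f s) - \sum_(s <- S) normc (f s))).
  rewrite lerBrDr -(big_uniq_mem _ uF uU sF) -(big_uniq_mem _ uS uU sS) -big_split.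
  apply: ler_sum => s _ /=; case: ifP => _; case: ifP => _;
    by rewrite ?normc0E ?addr0 ?add0r// normc_ge0.
by move: h1 h2; lra.
Qed.

Lemma Cr_finsupp (T : op) (e : R) : Cr_dom T -> 0 < e ->
  exists2 f, finitely_supported f &
    forall F, uniq F -> kernel_le F (fun p q => entry T p q - toeplitz f p q) e.
Proof.
move=> /Cr_domP [_ HT] e0; have e2 := divr_gt0 e0 (ltr0n R 2).
have [f sf Hf] := HT _ e2; have [S uS HS] := abs_summable_tail sf e2.
exists (fun s => if s \in S then f s else 0).
  by apply/finitely_supportedP; exists S => // s /negPf ->.
move=> F uF; have := kernel_leD (Hf F uF) (kernel_le_toeplitz HS uF).
rewrite -splitr; apply: eq_kernel_le => p q; rewrite /toeplitz.
by case: ifP => _; ring.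
Qed.


Lemma entry_sum (A : Type) (r : seq A) (c : A -> C) (T : A -> op) p q :
  entry (\sum_(i <- r) c i *: T i) p q = \sum_(i <- r) c i * entry (T i) p q.
Proof.
elim: r => [|i r IH]; first by rewrite !big_nil entryE.
by rewrite !big_cons entry_lin IH.
Qed.

Lemma Cr_sum (A : Type) (r : seq A) (c : A -> C) (T : A -> op) :
  (forall i, Cr_dom (T i)) -> Cr_dom (\sum_(i <- r) c i *: T i).
Proof.
move=> TC; elim: r => [|i r IH]; first by rewrite big_nil; exact: Cr_0.
rewrite big_cons; exact: (Cr_lin (c i) (TC i) IH).
Qed.

(** On the span of [b] the coordinates are matrix entries at fixed positions, so the coordinate
    matrices of the approximant [y] are submatrices of [blocks y], with a bound independent of [F].
    Replacing the spanning vectors by finitely supported convolutions then changes the result by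
    Hadamard products with small matrices. *)
Theorem completely_compact_band_approx u (M : R) : schur_le (toeplitz u) M ->
  completely_compact (Smap u : Cr R G -> Cr R G) -> band_approx u.
Proof.
move=> uM [_ cc] e e0; have M0 := schur_le_ge0 1%g uM.
have e2 : 0 < e / 2 by rewrite divr_gt0.
have [n [b [bD Hb]]] := cc _ e2.
have [|L LD HL] := @interpolation R (G * G)%type op (fun x T => entry T x.1 x.2)
  (@Cr_dom R G) [seq b j | j <- enum 'I_n] (fun x c T T' => entry_lin c T T' x.1 x.2)
  (@Cr_lin R G) (@Cr_0 R G).
  by move=> _ /mapP [j _ ->]; exact: bD.
have spanE (v : op) p q : lin_span b v ->
    entry v p q = \sum_(z <- L) entry v z.1.1 z.1.2 * entry z.2 p q.
  move=> [c _ <-]; rewrite entry_sum; under [RHS]eq_bigr do rewrite entry_sum mulr_suml.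
  rewrite exchange_big; apply: eq_bigr => j _ /=.
  rewrite (HL (b j) _ (p, q)) ?map_f ?mem_enum// mulr_sumr.
  by apply: eq_bigr => z _; rewrite mulrA.
(* [K] bounds [y], which lies within e / 2 of an image of norm at most [M]; [N] is chosen so that
   the errors, one of size K (e / 2 / N) for each element of [L], add up to at most e / 2. *)
pose K := M + e / 2; have K0 : 0 < K by rewrite ltr_wpDl.
pose N := K * (size L)%:R + 1; have N0 : 0 < N by rewrite ltr_wpDl// mulr_ge0// ltW.
have d0 : 0 < e / 2 / N by rewrite divr_gt0.
have /choice [f fP] : forall z : (G * G) * op, exists fS : (G -> C) * seq G,
    (forall s, s \notin fS.2 -> fS.1 s = 0) /\ (z \in L -> forall F, uniq F ->
      kernel_le F (fun p q => entry z.2 p q - toeplitz fS.1 p q) (e / 2 / N)).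
  move=> z; have [zL|_] := boolP (z \in L); last by exists (fun=> 0, [::]).
  have [g /finitely_supportedP [S uS gS] Hg] := Cr_finsupp (LD z zL) d0.
  by exists (g, S).
exists (flatten [seq (f z).2 | z <- L]) => F k uF k1.
have := Hb _ (twist F k) (@Cr_twist R G F k) (opmx_norm_twist uF k1).
move=> /ereal_inf_lt [_ [y yb <-] ylt].
pose s := tnth (in_tuple F).
have yC i j : Cr_dom (y i j) by have [c _ <-] := yb i j; exact: Cr_sum.
have imp := Smap_implements uM.
set X := map_mx _ _ in ylt.
have bX i j : bounded_op (X i j).
  by rewrite mxE; case: (imp _ (Cr_twist k i j)).
have eX i j p q : entry (X i j) p q = u (p * q^-1)%g * entry (twist F k i j) p q.
  by rewrite mxE; case: (imp _ (Cr_twist k i j)) => _ ->.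
have lX i j : linear_op (X i j) by exact: bounded_op_linear.
have Xy i j : (X - y) i j = X i j - y i j by rewrite mxE [(- y) i j]mxE.
have lXy i j : linear_op ((X - y) i j).
  by rewrite Xy; exact: bounded_op_linear (bounded_opB (bX i j) (Cr_bounded (yC i j))).
have X_le H (uH : uniq H) : kernel_le H (blocks X) M.
  apply: kernel_le_blocks lX _ uH.
  exact: cb_normP (m_norm_le uM) (Cr_twist k) (opmx_norm_twist uF k1).
have Xy_le H (uH : uniq H) : kernel_le H (blocks (X - y)) (e / 2).
  exact: kernel_le_blocks lXy (ltW ylt) uH.
have XyE x z : blocks (X - y) x z = blocks X x z - blocks y x z.
  by rewrite /blocks Xy (entryB (X x.1 z.1)).
have y_le H (uH : uniq H) : kernel_le H (blocks y) K.
  apply: eq_kernel_le (kernel_leB (X_le H uH) (Xy_le H uH)) => x z.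
  by rewrite XyE opprB addrC subrK.
(* [y] reindexed by group elements; the default 0 lies off [F], where the estimates do not look. *)
pose Y p q : op := if insub (index p F) is Some i then
  (if insub (index q F) is Some j then y i j else 0) else 0.
have YE i j : Y (s i) (s j) = y i j.
  have insubE (i' : 'I_(size F)) : insub (index (s i') F) = Some i'.
    by rewrite /s (tnth_nth 1%g) index_uniq// valK.
  by rewrite /Y !insubE.
(* The entry of [Y p q] at (p, q), expanded in coordinates, with each spanning vector replaced by
   its finitely supported approximation: the band is the union of the supports, whatever [F] and [k]
   are. *)
pose B p q := \sum_(z <- L) entry (Y p q) z.1.1 z.1.2 * toeplitz (f z).1 p q.
have EF : F = map s (enum 'I_(size F)).
  by have := map_tnth_enum (in_tuple F); rewrite /s => ->.
have diag : kernel_le F (fun p q => toeplitz u p q * k p q - entry (Y p q) p q) (e / 2).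
  apply: (kernel_le_untwist Xy_le) => i j.
  by rewrite XyE /blocks /= eX entry_twist eqxx mulr1 YE.
have coord (z : (G * G) * op) :
    kernel_le F (fun p q => entry (Y p q) z.1.1 z.1.2) K.
  rewrite EF; apply: kernel_le_unmap.
  have := @kernel_le_map2 R _ _ (fun i => (i, z.1.1)) (fun j => (j, z.1.2))
    (enum 'I_(size F)) (blocks y) K (enum_uniq _) _ _ (y_le _ (undup_uniq _)).
  move=> h; apply: eq_kernel_le (h _ _) => [i j|i j []//|i j []//].
  by rewrite /blocks YE.
exists B; split=> [p q pq|].
  rewrite /B big_seq big1// => z zL; have [z0 _] := fP z.
  rewrite /toeplitz z0 ?mulr0//; apply: contra pq => pq.
  by apply/flattenP; exists (f z).2 => //; exact: map_f.
pose err z p q := if z \in L then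
  entry (Y p q) z.1.1 z.1.2 * (entry z.2 p q - toeplitz (f z).1 p q) else 0.
have err_le z : kernel_le F (err z) (K * (e / 2 / N)).
  rewrite /err; case: (boolP (z \in L)) => zL; last first.
    apply: kernel_le_trans (kernel_le0 F); exact/mulr_ge0/ltW/d0/ltW.
  have [_ /(_ zL F uF)] := fP z.
  exact: kernel_le_hadamard uF (ltW K0) (ltW d0) (coord z).
have H := kernel_leD diag (kernel_le_sum L err_le).
apply: (kernel_le_trans _ (eq_in_kernel_le _ H)); last first.
  move=> p q; rewrite {1 2}EF => /mapP [i _ ->] /mapP [j _ ->].
  rewrite YE (spanE _ (s i) (s j) (yb i j)) /B YE -addrA; congr (_ + _).
  rewrite -sumrN -sumrN -big_split big_seq [RHS]big_seq /=.
  by apply: eq_bigr => z zL; rewrite /err zL YE; ring.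
rewrite big_const_seq count_predT iter_addr_0 -[_ *+ size L]mulr_natr.
rewrite [leRHS](splitr e) lerD2l.
have -> : K * (e / 2 / N) * (size L)%:R = (e / 2) * ((K * (size L)%:R) / N) by ring.
by apply: (ler_piMr (ltW e2)); rewrite ler_pdivrMr// mul1r /N lerDl.
Qed.

(** A single member of the net suffices: its Schur product with [k] has a band independent of [k],
    and [schur_le_op_norm] turns the plain norm of the difference into a bound on finite
    matrices. *)
Lemma schur_net_band_approx (J : Type) (le : J -> J -> Prop)
    (phi : J -> G -> G -> C) u (M : R) :
  schur_le (toeplitz u) M -> directed le ->
  (forall i, schur_multiplier (phi i) /\ band_finite (phi i)) ->
  @op_norm R (Bl2 R G) (Bl2 R G)
    (schur_map (Nmap u) \- schur_map (phi i)) @[i --> tails le] --> 0%E ->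
  band_approx u.
Proof.
move=> uM [_ refl _ _] phiP phiu e e0.
have [i Hi] := tails_cvg_ereal phiu e0.
have [phim [E /finite_seqP [S ->] phiE]] := phiP i.
have Nm : schur_multiplier (Nmap u).
  exact: (@schur_multiplier_schur_le R G (Nmap u) M (schur_le_ge0 1%g uM) uM).
have psi_le : schur_le (fun p q => Nmap u q p - phi i q p) e.
  apply: schur_le_op_norm (ltW (Hi i (refl i))) => T bT.
  have [b1 e1] := schur_mapP Nm bT; have [b2 e2] := schur_mapP phim bT.
  split=> [|p q]; first exact: (bounded_opB b1 b2).
  by rewrite (entryB (schur_map (Nmap u) T)) e1 e2 mulrBl.
exists S => F k uF k1; exists (fun p q => phi i q p * k p q); split=> [p q pq|].
  by rewrite phiE ?mul0r// => h; move: pq; rewrite [_ \in _]h.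
by apply: eq_kernel_le (psi_le F k uF k1) => p q; rewrite mulrBl.
Qed.

(** Both vectors are truncated, and [schur_le_coeff] bounds each error by a product of norms. [y] is
    cut after [x] because its tolerance involves the norm of the truncated [x']. *)
Lemma fourier_finitely_supported v (e : R) : in_fourier v -> 0 < e ->
  exists2 w, finitely_supported w & schur_le (toeplitz (v - w)) e.
Proof.
move=> [x [y ->]] e0; have e2 : 0 < e / 2 by rewrite divr_gt0.
have pos (z : l2 R G) : 0 < l2norm z + 1 by rewrite ltr_wpDl ?l2norm_ge0.
have [F uF HF] := l2norm_sub_cutoff x (divr_gt0 e2 (pos y)).
have {}HF := HF F uF (fun _ => id); set x' := cutoff F x in HF.
have [F' uF' HF'] := l2norm_sub_cutoff y (divr_gt0 e2 (pos x')).
have {}HF' := HF' F' uF' (fun _ => id); set y' := cutoff F' y in HF'.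
exists (coeff x' y').
  apply/finitely_supportedP.
  exists (undup [seq (t * p^-1)%g | t <- F', p <- F]) => [|s]; first exact: undup_uniq.
  rewrite mem_undup => sS; rewrite /coeff /dot (@csum_fin _ _ _ [::])//.
    by rewrite big_nil.
  move=> t _; rewrite lregE !cutoffE//; case: ifP => [sF|]; last by rewrite mul0r.
  case: ifP => [tF|]; last by rewrite rmorph0 mulr0.
  case/negP: sS; apply/allpairsP; exists (t, (s^-1 * t)%g); split=> //=.
  by rewrite invgM invgK mulgA mulgV mul1g.
have H := schur_leD (schur_le_coeff (x - x') y) (schur_le_coeff x' (y - y')).
apply: schur_le_trans (eq_schur_le _ H).
  rewrite [leRHS](splitr e); apply: lerD.
    apply: le_trans (ler_wpM2r (l2norm_ge0 y) HF) _.
    rewrite mulrAC ler_pdivrMr// ler_wpM2l ?(ltW e2)//.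
    by rewrite lerDl.
  apply: le_trans (ler_wpM2l (l2norm_ge0 x') HF') _.
  rewrite mulrA ler_pdivrMr// mulrC ler_wpM2l ?(ltW e2)//.
  by rewrite lerDl.
move=> p q; rewrite /toeplitz; set s := (p * q^-1)%g.
have -> : (coeff x y - coeff x' y') s = coeff x y s - coeff x' y' s by [].
have lx : lreg s (x - x') = -1 *: lreg s x' + lreg s x.
  by apply: l2P => t; rewrite l2_addE l2_scaleE !lregE l2_addE l2_oppE; ring.
have yy : y - y' = -1 *: y' + y by rewrite scaleN1r addrC.
rewrite /coeff lx dot_lin (dot_conj (y - y')) yy dot_lin.
rewrite (dot_conj (lreg s x') y) (dot_conj (lreg s x') y').
move: (dot (lreg s x') y) (dot (lreg s x') y') (dot (lreg s x) y).
by move=> [a b] [c d] [f g]; apply/eqP; rewrite eq_complex;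
  apply/andP; split; apply/eqP => /=; ring.
Qed.

(** A finitely supported [w] near [u] gives a map with range in the span of the translations by its
    support, and a cb norm estimate is uniform in the matrix size. *)
Theorem Acb_completely_compact u (M : R) : schur_le (toeplitz u) M -> in_Acb u ->
  completely_compact (Smap u : Cr R G -> Cr R G).
Proof.
move=> uM [_ uA]; split; first by case: (Smap_schur_spec uM).
move=> e e0; have e2 : 0 < e / 2 by rewrite divr_gt0.
(* Two errors of e / 4, from [u] to [v] and from [v] to [w], leave e / 2 and hence a strict final
   inequality. *)
have e4 : 0 < e / 2 / 2 by rewrite divr_gt0.
have [v vA uv] := uA _ e4.
have [K K0 vK] := fourier_schur_le vA.
have uvK : schur_le (toeplitz (u - v)) (M + K).
  by apply: eq_schur_le (schur_leB uM vK) => p q.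
have uv_le := schur_le_cb_norm (Smap_implements uvK) (ltW uv).
have [w wf vw] := fourier_finitely_supported vA e4.
have uw : schur_le (toeplitz (u - w)) (e / 2).
  rewrite [e / 2](splitr); apply: eq_schur_le (schur_leD uv_le vw) => p q.
  by rewrite /toeplitz; exact: subrKA.
have [N N0 wN] := schur_le_finsupp wf.
have [S uS wS] := (finitely_supportedP w).1 wf.
pose b (j : 'I_(size S)) : op := lreg (tnth (in_tuple S) j).
have bC j : Cr_dom (b j) by exact: Cr_lreg.
have imp := Smap_implements wN.
have SwE T : Cr_dom T -> lin_span b (Smap w T).
  move=> TC; have [b1 e1] := imp T TC.
  (* The Fourier coefficient at s of an element of the reduced algebra is its entry at (s, 1). *)
  pose c s := w s * entry T s 1%g.
  exists (fun j => c (tnth (in_tuple S) j)) => //.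
  apply: (bounded_op_eq _ b1) => [|p q]; first exact/Cr_bounded/Cr_sum.
  rewrite entry_sum e1 (Cr_toeplitz p q TC) -/(c (p * q^-1)%g).
  under eq_bigr do rewrite entry_lreg.
  rewrite -(@big_tnth _ _ _ _ S xpredT (fun s => c s * (s == p * q^-1)%g%:R)).
  have [pqS|pqS] := boolP ((p * q^-1)%g \in S).
    rewrite (bigD1_seq (p * q^-1)%g)//= eqxx mulr1 big1 ?addr0//.
    by move=> s /negPf ->; rewrite mulr0.
  rewrite /c wS// mul0r big_seq big1// => s sS.
  by case: eqVneq => [sE|]; [rewrite -sE sS in pqS|rewrite mulr0].
exists (size S), b; split=> // m X XC X1.
apply: (@le_lt_trans _ _ (e / 2)%:E); last first.
  by rewrite lte_fin ltr_pdivrMr// ltr_pMr// ltr1n.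
apply: (@le_trans _ _ (opmx_norm (map_mx (Smap u) X - map_mx (Smap w) X))).
  apply: ereal_inf_lbound; exists (map_mx (Smap w) X) => // i j.
  by rewrite mxE; exact: (SwE _ (XC i j)).
have -> : map_mx (Smap u) X - map_mx (Smap w) X = map_mx (Smap u \- Smap w) X.
  by apply/matrixP => i j; rewrite !mxE.
have imp' := implementsB (Smap_implements uM) imp.
exact: cb_normP (cb_norm_schur_le imp' (ltW e2) uw) XC X1.
Qed.

Lemma op_norm_ge0 (D : Bl2 R G -> Bl2 R G) : (0 <= op_norm D)%E.
Proof.
apply: le_trans (opnorm_ge0 (D 0)) _; apply: ereal_sup_ubound; exists 0 => //.
by split; [exact: bounded_op0|exact: opnorm0].
Qed.

Lemma band_approx_finitely_supported u (M : R) : approximation_property R G ->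
  schur_le (toeplitz u) M -> band_approx u ->
  exists (J : Type) (le : J -> J -> Prop) (v : J -> G -> C),
    [/\ directed le, (forall i, in_fourier (v i) /\ finitely_supported (v i)) &
      cb_norm (Smap u \- Smap (v i)) @[i --> tails le] --> 0%E].
Proof.
move=> AP uM uB.
have /choice [v vP] : forall n : nat, exists v, finitely_supported v /\
    schur_le (toeplitz (u - v)) n.+1%:R^-1.
  move=> n; have n0 : 0 < n.+1%:R^-1 :> R by rewrite invr_gt0 ltr0n.
  by have [v fv uv] := approximation_property_band AP uM uB n0; exists v.
exists nat, (fun m n => (m <= n)%N : Prop), v; split.
- split=> [|i|i j k|i j]; first exact: (inhabits 0%N).
  + exact: leqnn.
  + exact: leq_trans.
  + by exists (maxn i j); rewrite ?leq_maxl ?leq_maxr.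
- by move=> n; have [fv _] := vP n; split=> //; exact: finitely_supported_fourier.
apply: cvg_tails_ereal => [n|e e0]; first exact: cb_norm_ge0.
have [n0 Hn0] := ltr_add_invr e0; exists n0 => n n0n.
have [fv uv] := vP n; have [K _ vK] := schur_le_finsupp fv.
have imp := implementsB (Smap_implements uM) (Smap_implements vK).
apply: (cb_norm_schur_le imp (ltW e0)); apply: schur_le_trans uv.
apply: le_trans (ltW Hn0); rewrite add0r lef_pV2 ?posrE ?ltr0n//.
by rewrite ler_nat.
Qed.

(** Both norms are compared with [schur_le] for the same Toeplitz kernel, so the tolerance carries
    over unchanged. *)
Lemma finitely_supported_schur_net (J : Type) (le : J -> J -> Prop)
    (v : J -> G -> C) u (M : R) :
  schur_le (toeplitz u) M ->
  (forall i, finitely_supported (v i)) ->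
  cb_norm (Smap u \- Smap (v i)) @[i --> tails le] --> 0%E ->
  (forall i, schur_multiplier (Nmap (v i)) /\ band_finite (Nmap (v i))) /\
  @op_norm R (Bl2 R G) (Bl2 R G)
    (schur_map (Nmap u) \- schur_map (Nmap (v i))) @[i --> tails le] --> 0%E.
Proof.
move=> uM fv uv.
have Nm (w : G -> C) (K : R) : schur_le (toeplitz w) K -> schur_multiplier (Nmap w).
  by move=> wK; exact: (@schur_multiplier_schur_le R G (Nmap w) K (schur_le_ge0 1%g wK) wK).
split=> [i|].
  have [K _ vK] := schur_le_finsupp (fv i); split; first exact: Nm vK.
  by exists [set s | v i s != 0]; [exact: fv|move=> s t /negP/negPn/eqP].
apply: cvg_tails_ereal => [i|e e0]; first exact: op_norm_ge0.
have [i0 Hi0] := tails_cvg_ereal uv e0; exists i0 => i /Hi0 uvi.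
have [K _ vK] := schur_le_finsupp (fv i).
have imp := implementsB (Smap_implements uM) (Smap_implements vK).
have := schur_le_cb_norm imp (ltW uvi).
apply: op_norm_schur_le (ltW e0) => T bT.
have [b1 e1] := schur_mapP (Nm _ _ uM) bT; have [b2 e2] := schur_mapP (Nm _ _ vK) bT.
split=> [|p q]; first exact: (bounded_opB b1 b2).
by rewrite (entryB (schur_map (Nmap u) T)) e1 e2 -mulrBl.
Qed.

Lemma band_approx_Acb u : approximation_property R G -> herz_schur u ->
  band_approx u -> in_Acb u.
Proof.
move=> AP hu uB; split=> // e e0; have [M _ uM] := herz_schur_schur_le hu.
have e2 : 0 < e / 2 by rewrite divr_gt0.
have [v fv uv] := approximation_property_band AP uM uB e2.
exists v; first exact: finitely_supported_fourier.
apply: le_lt_trans (m_norm_le uv) _.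
by rewrite lte_fin ltr_pdivrMr// ltr_pMr// ltr1n.
Qed.

End consequences.

Theorem corollary3p9 (R : realType) (G : groupType) (u : G -> R[i])
    (hAP : approximation_property R G) (hu : herz_schur u) :
  [<->
    completely_compact (Smap u);
    exists (J : Type) (le : J -> J -> Prop) (v : J -> G -> R[i]),
      [/\ directed le,
          (forall i, in_fourier (v i) /\ finitely_supported (v i)) &
          cb_norm (Smap u \- Smap (v i)) @[i --> tails le] --> 0%E];
    exists (J : Type) (le : J -> J -> Prop) (phi : J -> G -> G -> R[i]),
      [/\ directed le,
          (forall i, schur_multiplier (phi i) /\ band_finite (phi i)) &
          @op_norm R (Bl2 R G) (Bl2 R G)
            (schur_map (Nmap u) \- schur_map (phi i)) @[i --> tails le] --> 0%E];
    in_Acb u].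
Proof.
have [M _ uM] := herz_schur_schur_le hu.
tfae.
- move=> uc; apply: (band_approx_finitely_supported hAP uM).
  exact: completely_compact_band_approx uM uc.
- move=> [J [le [v [dir vP uv]]]].
  have [phiP uphi] := finitely_supported_schur_net uM (fun i => (vP i).2) uv.
  by exists J, le, (fun i => Nmap (v i)).
- move=> [J [le [phi [dir phiP uphi]]]].
  exact: band_approx_Acb hAP hu (schur_net_band_approx uM dir phiP uphi).
- exact: Acb_completely_compact uM.
Qed.
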